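(* Let $n,\alpha\in\mathbb{Z}_{\geq 1}$ be such that $2n\equiv -1 \pmod{3^{\alpha}}$. Then \[ c\psi_{6,0}(n)\equiv 0 \pmod{3^{\lfloor \alpha/2\rfloor+2}}. \]
   Context: Let $\tau$ range over the upper half-plane $\mathbb{H}$, $z\in\mathbb{C}$, $q:=e^{2\pi i\tau}$, $\zeta:=e^{2\pi i z}$, $(q;q)_\infty:=\prod_{m\ge 1}(1-q^m)$, and $\eta(\tau):=q^{1/24}(q;q)_\infty$. Let $\theta$ be the Jacobi theta function \[ \theta(\tau,z):=\sum_{m\in\frac12+\mathbb{Z}} e^{\pi i m^2\tau+2\pi i m(z+\frac12)} . \] For a positive integer $k$ and $a\in\frac{k}{2}+\mathbb{Z}$, the $(k,a)$-colored Frobenius partition function $c\psi_{k,a}(n)$ is defined by its generating function: $C\Psi_{k,a}(q):=\sum_{n=0}^{\infty}c\psi_{k,a}(n)q^n$ is the coefficient of $\zeta^a$ in \[ F_k(\tau,z)=\left(\frac{-\theta(\tau,z+\frac12)}{q^{1/12}\,\eta(\tau)}\right)^{k}. \] Here $-\theta(\tau,z+\frac12)=\sum_{m\in\frac12+\mathbb{Z}}q^{m^2/2}\zeta^m$. The function $c\psi_{6,0}(n)$ is the case $k=6$, $a=0$. For $x\in\mathbb{R}$, $\lfloor x\rfloor$ is the greatest integer less than or equal to $x$. *)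

(* Defs.v *)
From Stdlib Require Import Reals ZArith ClassicalEpsilon.
From Coquelicot Require Import Coquelicot.
Open Scope C_scope.

Definition Cexp (w : C) : C :=
  (exp (Re w) * cos (Im w), exp (Re w) * sin (Im w))%R.

(* Total limit, taken componentwise; it is the limit in C whenever u converges,
   and is only meant to be used then. *)
Definition CLim (u : nat -> C) : C :=
  (real (Lim_seq (fun n => Re (u n))), real (Lim_seq (fun n => Im (u n)))).

Definition CSeries (u : nat -> C) : C :=
  CLim (fun N => @sum_n C_AbelianMonoid u N).

(* Two-sided sums over the coset s + Z, as the sum of the two one-sided series
   over s, s + 1, s + 2, ... and s - 1, s - 2, ... . *)
Definition CSeries_coset (s : R) (f : R -> C) : C :=
  CSeries (fun n => f (s + INR n)%R) + CSeries (fun n => f (s - 1 - INR n)%R).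

Definition is_Cseries (u : nat -> C) (l : C) : Prop :=
  @is_series C_AbsRing C_NormedModule u l.

Definition is_Cseries_coset (s : R) (f : R -> C) (l : C) : Prop :=
  exists l1 l2 : C,
    is_Cseries (fun n => f (s + INR n)%R) l1 /\
    is_Cseries (fun n => f (s - 1 - INR n)%R) l2 /\
    l = l1 + l2.

(* q^x := e^(2 pi i x tau) and zeta^x := e^(2 pi i x z) for real x: the branch
   of the fractional powers is the one determined by tau and z. *)
Definition qpow (tau : C) (x : R) : C := Cexp (2 * PI * Ci * x * tau).
Definition zetapow (z : C) (x : R) : C := Cexp (2 * PI * Ci * x * z).

Definition qq (tau : C) : C := qpow tau 1.

Fixpoint Cprod (u : nat -> C) (N : nat) : C :=
  match N with
  | O => 1
  | S N' => Cprod u N' * u N'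
  end.

(* The factor of index j is 1 - q^m with m = j + 1. *)
Definition qpoch_inf (tau : C) : C :=
  CLim (Cprod (fun j => 1 - qq tau ^ (S j))).

Definition eta (tau : C) : C := qpow tau (1 / 24) * qpoch_inf tau.

Definition theta (tau z : C) : C :=
  CSeries_coset (1 / 2)
    (fun m : R => Cexp (PI * Ci * (m * m)%R * tau
                        + 2 * PI * Ci * m * (z + (1 / 2)%R))).

Definition Fk (k : nat) (tau z : C) : C :=
  ((- theta tau (z + (1 / 2)%R)) / (qpow tau (1 / 12) * eta tau)) ^ k.

(* A is the family of Fourier (Laurent) coefficients of F_k(tau, .):
   F_k(tau, z) is the sum of A(b) zeta^b over b in k/2 + Z, for every z.
   The values of A off k/2 + Z are irrelevant. *)
Definition is_zeta_expansion (k : nat) (tau : C) (A : R -> C) : Prop :=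
  forall z : C,
    is_Cseries_coset (INR k / 2)%R (fun b => A b * zetapow z b) (Fk k tau z).

(* On the upper half-plane, the sum of c(n) q^n over n >= 0 is the coefficient
   of zeta^a in F_k(tau, z). *)
Definition is_cpsi (k : nat) (a : R) (c : nat -> Z) : Prop :=
  forall tau : C, (0 < Im tau)%R ->
    exists A : R -> C,
      is_zeta_expansion k tau A /\
      is_Cseries (fun n => RtoC (IZR (c n)) * qq tau ^ n) (A a).

(* For k >= 1 and a in k/2 + Z there is exactly one integer sequence satisfying
   is_cpsi k a; for other (k, a) the value is meaningless. *)
Definition cpsi (k : nat) (a : R) : nat -> Z :=
  epsilon (inhabits (fun _ : nat => 0%Z)) (is_cpsi k a).

(* Main.v *)
Require Import Defs.
From Stdlib Require Import Reals Lra ZArith Lia Ring ClassicalEpsilon FunctionalExtensionality Classical.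
From Coquelicot Require Import Coquelicot.
From HB Require Import structures.
From mathcomp Require Import ssreflect ssrfun ssrbool.
From mathcomp Require eqtype ssrnat seq bigop zify_ssreflect.

(** Why the congruence holds.

Write T(j) = j(j+1)/2, Theta(q) for the sum of q^T(j) over all integers j, and
E = (q;q)_oo. Up to a factor q^(3/4) zeta^3 the numerator of F_6 is the sixth
power of the sum of q^T(j) zeta^j, and its denominator is q^(3/4) E^6. The
coefficient of zeta^0 is therefore numer6 / E^6, where numer6 is a theta series
of Z^6 restricted to coordinate sum -3. Cutting Z^3 by the coordinate sum
modulo 3 factors it: numer6 = Theta(q^6) a^2 + 9 g k^2, with g twice the sum of
q^(3n^2+n) over all integers n, and a, b, c = 3 q^(1/3) k the cubic theta
functions of the Borweins, for which a^3 = b^3 + c^3, b = E^3 / E(q^3),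
k = E(q^3)^3 / E (numer6_lattice, numer6_borwein).

Let e be the exponent of 3 in the hypothesis, which says 2n+1 = 3^e (2m+1) for some
m. Since n -> 3n+1 multiplies 2n+1 by 3, cpsi_{6,0}(n) is the m-th coefficient of
the e-fold iterate of the section U : sum f_n q^n -> sum f_(3n+1) q^n (sec1_iter_index). These iterates
alternate between two modules of rank two over Z[r], where
r = 3 q E(q^3)^12 / E^12: odd iterates have the form odd_form and even ones the
form even_form. What makes U computable there is the pair
alpha = a(q^3)/b(q^3), gamma = c(q^3)/b(q^3). It satisfies
alpha^3 - gamma^3 = 1, gamma^3 = 9 r(q^3) and r = gamma / (alpha - gamma)^4, so
every element of Z[r] is
  y0(q^3) + alpha^2 gamma y1(q^3) + alpha gamma^2 y2(q^3)
with y0, y1, y2 in Z[r] (Zr_deg0), and each factor gamma carries a factor 3 q.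
Applying U merely selects one coordinate. The remaining theta factors must be
series in q^3 for this to work. In odd_form they are so after the
dissection of Theta(q^2) modulo 3; in even_form the series g is removed by the
relation three_term, which expresses 3 g k(q^3) through Theta(q^6) and a series in
q^3. The first section is divisible by 9 (cpsi60_series_Odd), an odd to even step
gains a factor 3 (Odd_Even), and an even to odd step keeps the power of 3, because
the 3 it gains pays for the 3 in three_term (Even_Odd). Hence the exponent
floor(e/2) + 2.

The identities between theta series come from rearranging lattice sums and from
three classical facts: the pentagonal number theorem, Jacobi's formula for
E^3, and the value E(q^3)^4 / E(q^9) of the product of E(w q) over the three
cube roots of unity w (norm_euler). From these follow the equality of the hexagonal
theta series with a (hex_borwein_a) and three_term, the latter by eliminating the sum
of the squares of the three residue parts of E between class_squares_rel and
class_squares_b.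

Finally cpsi is chosen among the integer sequences satisfying is_cpsi, so existence
and uniqueness are both used. For existence, the six-fold product of
theta series is an absolutely convergent sum over Z^6 and may be regrouped by powers
of zeta and of q (cpsi60_series_is_cpsi). For uniqueness, averaging over z and
z + 1/2^(k+1) for increasing k leaves only the coefficient of zeta^0
(coefficient_zero), and a power series vanishing on an interval is zero. *)

Module Series.
Local Close Scope C_scope.

(** * The ring of formal power series over Z *)

Definition ser := nat -> Z.

Module Ser.
Local Open Scope Z_scope.

Definition cst (c : Z) : ser := fun n => match n with O => c | _ => 0 end.
Definition add (f g : ser) : ser := fun n => f n + g n.
Definition opp (f : ser) : ser := fun n => - f n.
Definition sub (f g : ser) : ser := fun n => f n - g n.
Definition tl (f : ser) : ser := fun n => f (S n).
(** The Cauchy product, computed by splitting off the constant term of the left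
    factor, so that each ring axiom is a plain induction on the degree. *)
Fixpoint mulc (n : nat) (f g : ser) : Z :=
  match n with
  | O => f O * g O
  | S m => f O * g (S m) + mulc m (tl f) g
  end.
Definition mul (f g : ser) : ser := fun n => mulc n f g.
Definition var : ser := fun n => match n with 1%nat => 1 | _ => 0 end.

Lemma ext (f g : ser) : (forall n, f n = g n) -> f = g.
Proof. exact: functional_extensionality. Qed.

Lemma mulc_addl n f g h : mulc n (add f g) h = mulc n f h + mulc n g h.
Proof.
elim: n f g => [|n IH] f g /=; first by rewrite /add; ring.
by rewrite -[tl (add f g)]/(add (tl f) (tl g)) IH /add; ring.
Qed.

Lemma mulc_scale n c f g : mulc n (fun k => c * f k) g = c * mulc n f g.
Proof.
elim: n f => [|n IH] f /=; first by ring.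
by rewrite -[tl _]/(fun k => c * tl f k) IH; ring.
Qed.

Lemma mulc_r n f g : mulc (S n) f g = mulc n f (tl g) + f (S n) * g O.
Proof.
elim: n f => [|n IH] f; first by rewrite /= /tl; ring.
by rewrite [LHS]/= -/(mulc (S n) (tl f) g) IH /= /tl; ring.
Qed.

Lemma mulC f g : mul f g = mul g f.
Proof.
apply: ext => n; rewrite /mul; elim: n f g => [|n IH] f g; first by rewrite /=; ring.
by rewrite mulc_r /= IH; ring.
Qed.

Lemma tl_mul f g : tl (mul f g) = add (fun k => f O * tl g k) (mul (tl f) g).
Proof. by []. Qed.

Lemma mulA f g h : mul f (mul g h) = mul (mul f g) h.
Proof.
apply: ext => n; rewrite /mul; elim: n f g h => [|n IH] f g h; first by rewrite /=; ring.
rewrite /= -/(mul f g) tl_mul mulc_addl mulc_scale -IH.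
by rewrite /mul /=; ring.
Qed.

Lemma mul_addl f g h : mul (add f g) h = add (mul f h) (mul g h).
Proof. by apply: ext => n; apply: mulc_addl. Qed.

Lemma cst_mul c f : mul (cst c) f = fun n => c * f n.
Proof.
apply: ext => n; rewrite /mul; case: n => [|n] //=.
have -> : tl (cst c) = fun k => 0 * cst c k by apply: ext => k; rewrite /tl /=; ring.
by rewrite mulc_scale; ring.
Qed.

Lemma ser_ring : ring_theory (cst 0) (cst 1) add mul sub opp eq.
Proof.
split.
- by move=> x; apply: ext => -[|n]; rewrite /add /=.
- by move=> x y; apply: ext => n; rewrite /add; ring.
- by move=> x y z; apply: ext => n; rewrite /add; ring.
- by move=> x; rewrite cst_mul; apply: ext => n; ring.
- exact: mulC.
- exact: mulA.
- exact: mul_addl.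
- by [].
- by move=> x; apply: ext => -[|n]; rewrite /add /opp /=; ring.
Qed.

Lemma cst_morph : ring_morph (cst 0) (cst 1) add mul sub opp eq
  0 1 Z.add Z.mul Z.sub Z.opp Z.eqb cst.
Proof.
split=> //.
- by move=> x y; apply: ext => -[|n].
- by move=> x y; apply: ext => -[|n].
- by move=> x y; rewrite cst_mul; apply: ext => -[|n] /=; ring.
- by move=> x; apply: ext => -[|n].
- by move=> x y /Z.eqb_eq ->.
Qed.

Fixpoint pow (f : ser) (n : nat) : ser :=
  match n with O => cst 1 | S m => mul f (pow f m) end.

Lemma pow_th : power_theory (cst 1) mul (@eq ser) nat_of_N pow.
Proof.
split=> r [|p] //=; rewrite /nat_of_N /=.
elim: p => [p IH|p IH|]; last by rewrite /= mulC cst_mul; apply: ext => n; ring.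
- rewrite Pos2Nat.inj_xI /= -IH.
  have H (a b : nat) : pow r (a + b) = mul (pow r a) (pow r b).
    elim: a => [|a IHa] /=; last by rewrite IHa mulA.
    by rewrite cst_mul; apply: ext => k; ring.
  by rewrite Nat.add_0_r H.
- rewrite Pos2Nat.inj_xO /= -IH.
  have H (a b : nat) : pow r (a + b) = mul (pow r a) (pow r b).
    elim: a => [|a IHa] /=; last by rewrite IHa mulA.
    by rewrite cst_mul; apply: ext => k; ring.
  by rewrite Nat.add_0_r H.
Qed.
End Ser.

Declare Scope ser_scope.
Delimit Scope ser_scope with ser.
Bind Scope ser_scope with ser.
Notation "f + g" := (Ser.add f g) : ser_scope.
Notation "f - g" := (Ser.sub f g) : ser_scope.
Notation "f * g" := (Ser.mul f g) : ser_scope.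
Notation "- f" := (Ser.opp f) : ser_scope.
Notation "f ^ n" := (Ser.pow f n%nat) : ser_scope.
Notation cst := Ser.cst.
Notation q := Ser.var.

(** Integer constants and literal exponents are declared to the ring tactic: most
    identities below are polynomial identities modulo a few defining relations. *)
Ltac ser_cst t := match t with cst ?c => match isZcst c with true => c | _ => constr:(InitialRing.NotConstant) end
  | _ => constr:(InitialRing.NotConstant) end.
Ltac ser_pow_cst t := match isnatcst t with true => constr:(N.of_nat t) | _ => constr:(InitialRing.NotConstant) end.
Add Ring ser_ring : Ser.ser_ring
  (morphism Ser.cst_morph, constants [ser_cst], power_tac Ser.pow_th [ser_pow_cst]).

Local Open Scope ser_scope.

(** * Truncation, dilation and sections modulo 3 *)

Lemma add_coef f g n : (f + g) n = (f n + g n)%Z. Proof. by []. Qed.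
Lemma sub_coef f g n : (f - g) n = (f n - g n)%Z. Proof. by []. Qed.
Lemma opp_coef f n : (- f) n = (- f n)%Z. Proof. by []. Qed.
Lemma cst_mul_coef c f n : (cst c * f) n = (c * f n)%Z.
Proof. by rewrite Ser.cst_mul. Qed.
Lemma mul_coef0 f g : (f * g) O = (f O * g O)%Z. Proof. by []. Qed.

Lemma var_mul f : q * f = fun n => match n with O => 0%Z | S m => f m end.
Proof.
apply: Ser.ext => -[|n] //; rewrite /Ser.mul /=.
have -> : Ser.tl q = cst 1 by apply: Ser.ext => -[|m].
by rewrite -/(Ser.mul (cst 1) f n) Ser.cst_mul; case: (f n).
Qed.

Lemma head_tail f : f = cst (f O) + q * Ser.tl f.
Proof. by rewrite var_mul; apply: Ser.ext => -[|n]; rewrite add_coef /= /Ser.tl; lia. Qed.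

Lemma var_pow_mul k f n :
  (q ^ k * f) n = if (n <? k)%nat then 0%Z else f (n - k)%nat.
Proof.
elim: k n => [|k IH] n.
  have -> : q ^ 0 * f = f by ring.
  by rewrite Nat.sub_0_r.
have -> : q ^ (S k) * f = q * (q ^ k * f) by rewrite /=; ring.
by rewrite var_mul; case: n => [|n] //; rewrite IH.
Qed.

Lemma var_cancel g h : q * g = q * h -> g = h.
Proof.
rewrite !var_mul => E; apply: Ser.ext => n.
exact: (f_equal (fun s : ser => s (S n)) E).
Qed.

(** Congruence modulo q^N: infinite products and sums are compared through their
    finite truncations. *)
Definition eqm (N : nat) (f g : ser) := forall n, (n < N)%nat -> f n = g n.

Lemma eqm_eq f g : (forall N, eqm N f g) -> f = g.
Proof. by move=> H; apply: Ser.ext => n; apply: (H (S n)); lia. Qed.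
Lemma eqm_sym N f g : eqm N f g -> eqm N g f.
Proof. by move=> H n Hn; rewrite H. Qed.
Lemma eqm_trans N f g h : eqm N f g -> eqm N g h -> eqm N f h.
Proof. by move=> H K n Hn; rewrite H // K. Qed.
Lemma eqm_le N M f g : (M <= N)%nat -> eqm N f g -> eqm M f g.
Proof. by move=> HM H n Hn; apply: H; lia. Qed.
Lemma eqm_add N f g f' g' : eqm N f g -> eqm N f' g' -> eqm N (f + f') (g + g').
Proof. by move=> H K n Hn; rewrite !add_coef H // K. Qed.
Lemma eqm_sub N f g f' g' : eqm N f g -> eqm N f' g' -> eqm N (f - f') (g - g').
Proof. by move=> H K n Hn; rewrite !sub_coef H // K. Qed.
Lemma eqm_mull N f g h : eqm N f g -> eqm N (f * h) (g * h).
Proof.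
move=> H n Hn; rewrite /Ser.mul; elim: n f g h N H Hn => [|n IH] f g h N H Hn /=.
  by rewrite H.
rewrite (H O); last by lia.
rewrite (IH (Ser.tl f) (Ser.tl g) h (Nat.pred N)) //; last by lia.
by move=> m Hm; apply: H; lia.
Qed.
Lemma eqm_mul N f g f' g' : eqm N f g -> eqm N f' g' -> eqm N (f * f') (g * g').
Proof.
move=> H K; apply: (eqm_trans N _ (g * f')); first exact: eqm_mull.
by rewrite (Ser.mulC g) (Ser.mulC g); apply: eqm_mull.
Qed.
Lemma eqm_pow N f g k : eqm N f g -> eqm N (f ^ k) (g ^ k).
Proof. by move=> H; elim: k => [|k IH] //=; apply: eqm_mul. Qed.
Lemma eqm_var N f g : eqm N f g -> eqm (S N) (q * f) (q * g).
Proof. by move=> H; rewrite !var_mul => -[|n] // Hn; apply: H; lia. Qed.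

(** A nonzero constant term suffices, the coefficients being integers: the
    coefficient of degree N is compared once those of lower degree agree. *)
Lemma eqm_cancel N f g h : f O <> 0%Z -> eqm N (f * g) (f * h) -> eqm N g h.
Proof.
move=> f0; elim: N => [|N IH] H; first by move=> n; lia.
have {}IH : eqm N g h by apply: IH; apply: eqm_le H; lia.
move=> m Hm; case: (Nat.eq_dec m N) => [->|ne]; last by apply: IH; lia.
(* In degree N the second summand involves only coefficients of z below N. *)
have e1 z : f * z = cst (f O) * z + q * (Ser.tl f * z) by rewrite {1}(head_tail f); ring.
have := H N ltac:(lia); rewrite !e1 !add_coef !cst_mul_coef.
have -> : (q * (Ser.tl f * g)) N = (q * (Ser.tl f * h)) N.
  case: N IH {H Hm} => [|N] IH; first by rewrite !var_mul.
  have X : eqm (S (S N)) (q * (Ser.tl f * g)) (q * (Ser.tl f * h)).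
    by apply: eqm_var; rewrite !(Ser.mulC (Ser.tl f)); apply: eqm_mull.
  by apply: X; lia.
move=> e; apply: (Z.mul_reg_l _ _ (f O)) => //; lia.
Qed.

Lemma mul_cancel f g h : f O <> 0%Z -> f * g = f * h -> g = h.
Proof. by move=> f0 e; apply: eqm_eq => N; apply: (eqm_cancel _ f) => //; rewrite e. Qed.

Lemma cst_cancel c g h : c <> 0%Z -> cst c * g = cst c * h -> g = h.
Proof. exact: mul_cancel. Qed.

(** Substitution of q^k for q. *)
Definition dil (k : nat) (f : ser) : ser :=
  fun n => if (n mod k =? 0)%nat then f (n / k)%nat else 0%Z.

Section Dil.
Variables (k : nat) (k0 : k <> O).

Lemma dil_add f g : dil k (f + g) = dil k f + dil k g.
Proof. by apply: Ser.ext => n; rewrite add_coef /dil; case: ifP. Qed.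
Lemma dil_sub f g : dil k (f - g) = dil k f - dil k g.
Proof. by apply: Ser.ext => n; rewrite sub_coef /dil; case: ifP. Qed.
Lemma dil_cst c : dil k (cst c) = cst c.
Proof.
apply: Ser.ext => n; rewrite /dil.
case: (Nat.eqb_spec (n mod k) 0) => H.
  have [m ->] : exists m, n = (k * m)%nat by exists (n / k)%nat; apply/Nat.Div0.div_exact.
  by rewrite Nat.mul_comm Nat.div_mul //; case: m => [|m] //=; case: k k0 => // k' _; rewrite Nat.mul_comm.
by case: n H => [|n] //; rewrite Nat.Div0.mod_0_l.
Qed.
Lemma dil_var_mul f : dil k (q * f) = q ^ k * dil k f.
Proof.
apply: Ser.ext => n; rewrite var_pow_mul.
rewrite {1}/dil var_mul; case: (Nat.ltb_spec n k) => H.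
  case: (Nat.eqb_spec (n mod k) 0) => // e.
  by rewrite Nat.div_small.
have -> : n = ((n - k) + 1 * k)%nat by lia.
rewrite Nat.Div0.mod_add Nat.div_add // /dil.
have -> : (n - k + 1 * k - k = n - k)%nat by lia.
by rewrite Nat.add_comm.
Qed.
Lemma dil_mul f g : dil k (f * g) = dil k f * dil k g.
Proof.
apply: Ser.ext => n.
have: exists N, (n < N)%nat by exists (S n); lia.
move=> [N]; elim: N n f g => [|N IH] n f g Hn; first by lia.
rewrite {1 2}(head_tail f) dil_add dil_cst dil_var_mul.
have -> : (cst (f O) + q * Ser.tl f) * g = cst (f O) * g + q * (Ser.tl f * g) by ring.
have -> : (cst (f O) + q ^ k * dil k (Ser.tl f)) * dil k g =
  cst (f O) * dil k g + q ^ k * (dil k (Ser.tl f) * dil k g) by ring.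
rewrite dil_add dil_var_mul !add_coef !var_pow_mul; congr Z.add.
  by rewrite cst_mul_coef /dil; case: ifP => _; rewrite ?cst_mul_coef //; lia.
case: (Nat.ltb_spec n k) => // H; apply: IH; lia.
Qed.
Lemma dil_pow f m : dil k (f ^ m) = dil k f ^ m.
Proof. by elim: m => [|m IH] /=; rewrite ?dil_cst // dil_mul IH. Qed.
Lemma dil_var : dil k q = q ^ k.
Proof.
have -> : q = q * cst 1 by ring.
rewrite dil_var_mul dil_cst; have -> : q * cst 1 = q by ring. by ring.
Qed.
Lemma dil_comp l f : l <> O -> dil k (dil l f) = dil (k * l) f.
Proof.
move=> l0; apply: Ser.ext => n; rewrite /dil.
case: (Nat.eqb_spec (n mod k) 0) => H.
  have [m ->] : exists m, n = (k * m)%nat by exists (n / k)%nat; apply/Nat.Div0.div_exact.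
  rewrite (Nat.mul_comm k m) Nat.div_mul // (Nat.mul_comm m k).
  rewrite Nat.Div0.mul_mod_distr_l Nat.Div0.div_mul_cancel_l //.
  case: (Nat.eqb_spec (m mod l) 0) => [->|ne]; first by rewrite Nat.mul_0_r.
  case: (Nat.eqb_spec (k * (m mod l)) 0) => //; lia.
case: (Nat.eqb_spec (n mod (k * l)) 0) => // /Nat.Div0.div_exact E.
by case: H; rewrite E -Nat.mul_assoc Nat.mul_comm Nat.Div0.mod_mul.
Qed.
Lemma dil_eqm N f g : eqm N f g -> eqm (k * N) (dil k f) (dil k g).
Proof.
move=> H n Hn; rewrite /dil; case: ifP => // _; apply: H.
by apply: Nat.Div0.div_lt_upper_bound.
Qed.
End Dil.

(** For r = 1 this is the operator U of the recursion. *)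
Definition sec (r : nat) (f : ser) : ser := fun n => f (3 * n + r)%nat.

Lemma sec_add r f g : sec r (f + g) = sec r f + sec r g. Proof. by []. Qed.
Lemma sec_cst_mul r c f : sec r (cst c * f) = cst c * sec r f.
Proof. by rewrite !Ser.cst_mul. Qed.
Lemma sec_var r f : sec (S r) (q * f) = sec r f.
Proof. by apply: Ser.ext => n; rewrite var_mul /sec Nat.add_succ_r. Qed.
Lemma sec0_var f : sec 0 (q * f) = q * sec 2 f.
Proof.
apply: Ser.ext => -[|n]; rewrite !var_mul /sec //.
by have -> : (3 * S n + 0 = S (3 * n + 2))%nat by lia.
Qed.

(** Sections are linear over series in q^3, so only the residue parts of the other
    factor are affected. *)
Lemma sec_dil_mul r g f : (r < 3)%nat -> sec r (dil 3 g * f) = g * sec r f.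
Proof.
move=> r3; apply: Ser.ext => n; elim: n g f => [|n IH] g f; rewrite {1 2}(head_tail g) dil_add // dil_cst // dil_var_mul //.
all: have -> : (cst (g 0%nat) + q ^ 3 * dil 3 (Ser.tl g)) * f = cst (g O) * f + q^3 * (dil 3 (Ser.tl g) * f) by ring.
all: have -> : (cst (g O) + q * Ser.tl g) * sec r f = cst (g O) * sec r f + q * (Ser.tl g * sec r f) by ring.
all: rewrite !add_coef {1}/sec !add_coef var_pow_mul !cst_mul_coef var_mul.
  by case: Nat.ltb_spec => H //; lia.
case: Nat.ltb_spec => H; first by lia.
rewrite -IH /sec; have -> : (3 * S n + r - 3 = 3 * n + r)%nat by lia.
by [].
Qed.

Lemma sec1 r : (0 < r < 3)%nat -> sec r (cst 1) = cst 0.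
Proof. by move=> Hr; apply: Ser.ext => n; rewrite /sec; case: r Hr => [|r] Hr; [lia|rewrite Nat.add_succ_r; case: n]. Qed.
Lemma sec01 : sec 0 (cst 1) = cst 1.
Proof. by apply: Ser.ext => -[|n]. Qed.

Lemma sec_dil0 g : sec 0 (dil 3 g) = g.
Proof. have -> : dil 3 g = dil 3 g * cst 1 by ring. by rewrite sec_dil_mul ?sec01; [ring|lia]. Qed.
Lemma sec_dil g r : (0 < r < 3)%nat -> sec r (dil 3 g) = cst 0.
Proof. move=> H; have -> : dil 3 g = dil 3 g * cst 1 by ring. by rewrite sec_dil_mul ?sec1 //; [ring|lia]. Qed.

Lemma sec_eqm N r f g : (r < 3)%nat -> eqm (3 * N) f g -> eqm N (sec r f) (sec r g).
Proof. by move=> Hr H n Hn; apply: H; lia. Qed.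

Lemma sec_ext f g : sec 0 f = sec 0 g -> sec 1 f = sec 1 g -> sec 2 f = sec 2 g -> f = g.
Proof.
move=> H0 H1 H2; apply: Ser.ext => n.
have E : (n = 3 * (n / 3) + n mod 3)%nat := Nat.div_mod_eq n 3.
have L := Nat.mod_upper_bound n 3.
rewrite {}E; move: (n mod 3) L => [|[|[|r]]] L; last by lia.
- exact: (f_equal (fun s : ser => s (n / 3)%nat) H0).
- exact: (f_equal (fun s : ser => s (n / 3)%nat) H1).
- exact: (f_equal (fun s : ser => s (n / 3)%nat) H2).
Qed.

(** The series with sections x0, x1 and x2. *)
Definition mix (x0 x1 x2 : ser) : ser := dil 3 x0 + q * dil 3 x1 + q ^ 2 * dil 3 x2.

Lemma sec_mix x0 x1 x2 :
  (sec 0 (mix x0 x1 x2) = x0) * (sec 1 (mix x0 x1 x2) = x1) * (sec 2 (mix x0 x1 x2) = x2).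
Proof.
have E : mix x0 x1 x2 = dil 3 x0 + q * (dil 3 x1 + q * dil 3 x2) by rewrite /mix; ring.
rewrite E !sec_add sec0_var !sec_var !sec_add sec0_var !sec_var !sec_dil0 !sec_dil; try lia.
by repeat split; ring.
Qed.

Lemma dissect f : f = mix (sec 0 f) (sec 1 f) (sec 2 f).
Proof. by apply: sec_ext; rewrite sec_mix. Qed.

(** The product rule on residue parts: the indices 0, 1, 2 add modulo 3 and a
    carry contributes one factor q after q^3 is read as q. *)
Lemma mix_mul x0 x1 x2 y0 y1 y2 : mix x0 x1 x2 * mix y0 y1 y2 =
  mix (x0 * y0 + q * (x1 * y2 + x2 * y1)) (x0 * y1 + x1 * y0 + q * (x2 * y2))
      (x0 * y2 + x1 * y1 + x2 * y0).
Proof. by rewrite /mix !dil_add // !dil_var_mul // !dil_add // !dil_mul //; ring. Qed.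

(** * The Euler product: pentagonal numbers, the Jacobi cube, the norm modulo 3 *)

Lemma pow_add f m n : f ^ (m + n) = f ^ m * f ^ n.
Proof. by elim: m => [|m IH] /=; [ring|rewrite IH; ring]. Qed.
Lemma pow_mul f m n : f ^ (m * n) = (f ^ n) ^ m.
Proof. by elim: m => [|m IH] //=; rewrite pow_add IH. Qed.
Lemma eqm_var_pow N k f g : eqm N f g -> eqm (k + N) (q ^ k * f) (q ^ k * g).
Proof.
move=> H n Hn; rewrite !var_pow_mul; case: Nat.ltb_spec => // L; apply: H; lia.
Qed.
Lemma eqm_var_pow0 k f : eqm k (q ^ k * f) (cst 0).
Proof. by move=> n Hn; rewrite var_pow_mul; case: Nat.ltb_spec => L; [case: n {Hn L}|lia]. Qed.

(** The expansion of 1/(1 - q^m). *)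
Definition geo (m : nat) : ser := fun n => if (n mod m =? 0)%nat then 1%Z else 0%Z.

Lemma geoE m : m <> O -> (cst 1 - q ^ m) * geo m = cst 1.
Proof.
move=> m0; have -> : geo m = dil m (fun _ => 1%Z) by [].
have H : (cst 1 - q) * (fun _ => 1%Z) = cst 1.
  have -> : forall f, (cst 1 - q) * f = f - q * f by move=> f; ring.
  by rewrite var_mul; apply: Ser.ext => -[|n].
rewrite -(dil_var m) // -(dil_cst m m0 1) -dil_sub // -dil_mul // H.
by rewrite dil_cst.
Qed.

(** The finite product (q;q)_n. *)
Fixpoint poch (n : nat) : ser := match n with O => cst 1 | S m => poch m * (cst 1 - q ^ n) end.
Fixpoint inv_poch (n : nat) : ser := match n with O => cst 1 | S m => inv_poch m * geo n end.
(** The n-th coefficient of the infinite product is that of the n-th partial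
    product, where it has stabilised. *)
Definition euler : ser := fun n => poch n n.
Definition partitions : ser := fun n => inv_poch n n.
Notation E := euler.
Notation p := partitions.

Lemma poch_inv n : poch n * inv_poch n = cst 1.
Proof.
elim: n => [|n IH] /=; first by ring.
have H := geoE (S n) (Nat.neq_succ_0 n).
have -> : poch n * (cst 1 - q * q ^ n) * (inv_poch n * geo (S n)) = (poch n * inv_poch n) * ((cst 1 - q ^ S n) * geo (S n)).
  by rewrite /=; ring.
by rewrite IH H; ring.
Qed.

Lemma poch_stable n m : (n <= m)%nat -> eqm (S n) (poch m) (poch n).
Proof.
move=> H; elim: m H => [|m IH] H; first by have -> : n = O by lia.
case: (Nat.eq_dec n (S m)) => [->//|ne].
apply: eqm_trans (IH _); last by lia.
rewrite [poch (S m)]/=; have -> : poch m * (cst 1 - q * q ^ m) = poch m - q ^ S m * poch m by rewrite /=; ring.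
apply: (eqm_trans _ _ (poch m - cst 0)); last by have -> : poch m - cst 0 = poch m by ring.
apply: eqm_sub => //; apply: eqm_le (eqm_var_pow0 (S m) _); lia.
Qed.

Lemma inv_poch_stable n m : (n <= m)%nat -> eqm (S n) (inv_poch m) (inv_poch n).
Proof.
move=> H; have e1 : inv_poch m * (poch n * inv_poch n) = inv_poch m by rewrite poch_inv; ring.
have e2 : inv_poch m * (poch m * inv_poch n) = inv_poch n.
  have -> : inv_poch m * (poch m * inv_poch n) = (poch m * inv_poch m) * inv_poch n by ring.
  by rewrite poch_inv; ring.
rewrite -e1 -[X in eqm _ _ X]e2; apply: eqm_mul => //; apply: eqm_mul => //.
by apply: eqm_sym; apply: poch_stable.
Qed.

Lemma euler_poch n : eqm (S n) E (poch n).
Proof. by move=> k Hk; rewrite /E; apply: eqm_sym (poch_stable k n _) _ _; lia. Qed.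
Lemma partitions_inv_poch n : eqm (S n) p (inv_poch n).
Proof. by move=> k Hk; rewrite /p; apply: eqm_sym (inv_poch_stable k n _) _ _; lia. Qed.
Lemma euler_partitions : E * p = cst 1.
Proof.
apply: eqm_eq => -[|N]; first by move=> n; lia.
rewrite -(poch_inv N); apply: eqm_mul; [exact: euler_poch|exact: partitions_inv_poch].
Qed.

Fixpoint ssum (n : nat) (f : nat -> ser) : ser :=
  match n with O => cst 0 | S m => ssum m f + f m end.
Definition sg (n : nat) : Z := if Nat.even n then 1%Z else (-1)%Z.
Lemma sg_S n : sg (S n) = (- sg n)%Z.
Proof. by rewrite /sg Nat.even_succ -Nat.negb_even; case: Nat.even. Qed.
Fixpoint tri (n : nat) : nat := match n with O => O | S m => (tri m + S m)%nat end.

(** The product of 1 - q^m for s < m <= s + d. *)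
Fixpoint shQ (s d : nat) : ser := match d with O => cst 1 | S e => shQ s e * (cst 1 - q ^ (s + d)) end.
Lemma shQ_l s d : shQ s (S d) = (cst 1 - q ^ (S s)) * shQ (S s) d.
Proof.
elim: d => [|d IH]; first by rewrite /= Nat.add_1_r /=; ring.
rewrite [LHS]/= -/(shQ s (S d)) IH [shQ (S s) (S d)]/=.
have -> : (s + S (S d) = S (s + S d))%nat by lia. rewrite /=; ring.
Qed.

(** Summand of the identity of Shanks; shH is its telescoping partner, the change of
    shF under d -> d + 1 being a difference of two values of shH. *)
Definition shF (s d : nat) : ser := cst (sg s) * (shQ s d * q ^ (s * (s + d) + tri s)).
Definition shH (s d : nat) : ser := cst (sg s) * (shQ s d * q ^ (S s * (s + d) + tri (S s))).

Lemma shanks_term s d : shF (S s) (S d) = shF (S s) d + shH s (S d) - shH (S s) d.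
Proof.
rewrite /shF /shH !sg_S.
have -> : cst (- sg s) = - cst (sg s) by apply: Ser.ext => -[|?]; rewrite opp_coef /=; lia.
rewrite (shQ_l s d) [shQ (S s) (S d)]/=.
set m := (S s * (S s + d) + tri (S s))%nat.
have -> : (S s * (S s + S d) + tri (S s) = m + S s)%nat by rewrite /m; lia.
have -> : (S s * (s + S d) + tri (S s) = m)%nat by rewrite /m; lia.
have -> : (S (S s) * (S s + d) + tri (S (S s)) = m + (S s + S d) + S s)%nat by rewrite /m /=; lia.
have -> : cst 1 - q * q ^ (s + S d) = cst 1 - q ^ (S s + S d) by [].
by rewrite !pow_add; ring.
Qed.
Lemma shanks_term0 d : shF 0 (S d) = shF 0 d - shH 0 d.
Proof.
rewrite /shF /shH [shQ 0 (S d)]/= /=.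
have -> : (d + 0 + 1 = S d)%nat by lia. rewrite /=; ring.
Qed.

Lemma shanks_sum j n : (j <= n)%nat ->
  ssum (S j) (fun s => shF s (S n - s)) = ssum (S j) (fun s => shF s (n - s)) - shH j (n - j).
Proof.
elim: j => [|j IH] Hj.
  by rewrite /= !Nat.sub_0_r shanks_term0; ring.
have -> : forall f, ssum (S (S j)) f = ssum (S j) f + f (S j) by [].
rewrite IH; last by lia.
have -> : forall f, ssum (S (S j)) f = ssum (S j) f + f (S j) by [].
have -> : (S n - S j = S (n - S j))%nat by lia.
rewrite shanks_term; have -> : (S (n - S j) = n - j)%nat by lia. ring.
Qed.

Definition pent1 (s : nat) : ser := cst (sg s) * q ^ (s * s + tri s).
Definition pent2 (s : nat) : ser := cst (sg (S s)) * q ^ (S s * s + tri (S s)).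

(** Finite pentagonal number theorem of Shanks. The left side still carries
    truncated products, but raising n changes it, by telescoping, by exactly the two
    pentagonal terms of index n + 1. *)
Lemma shanks n : ssum (S n) (fun s => shF s (n - s)) = ssum (S n) pent1 + ssum n pent2.
Proof.
elim: n => [|n IH].
  by rewrite /= /shF /pent1 /sg /=; ring.
have -> : forall f, ssum (S (S n)) f = ssum (S n) f + f (S n) by [].
rewrite shanks_sum // IH.
have -> : forall f, ssum (S (S n)) f = ssum (S n) f + f (S n) by [].
have -> : ssum (S n) pent2 = ssum n pent2 + pent2 n by [].
rewrite !Nat.sub_diag /shF /shH /pent1 /pent2 !sg_S.
have -> : cst (- sg n) = - cst (sg n) by apply: Ser.ext => -[|?]; rewrite opp_coef /=; lia.
rewrite !Nat.add_0_r [shQ n 0]/= [shQ (S n) 0]/=; ring.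
Qed.

Lemma ssum_eqm N n f g : (forall i, (i < n)%nat -> eqm N (f i) (g i)) -> eqm N (ssum n f) (ssum n g).
Proof.
elim: n => [|n IH] H //=; apply: eqm_add; first by apply: IH => i Hi; apply: H; lia.
by apply: H; lia.
Qed.
Lemma ssum0 n : ssum n (fun _ => cst 0) = cst 0.
Proof. by elim: n => [|n IH] //=; rewrite IH; ring. Qed.

Lemma ssum_l n f : ssum (S n) f = f O + ssum n (fun s => f (S s)).
Proof.
elim: n => [|n IH]; first by rewrite /=; ring.
have -> : ssum (S (S n)) f = ssum (S n) f + f (S n) by [].
by rewrite IH /=; ring.
Qed.

(** All summands on the left of Shanks's identity except the first, which is
    (q;q)_n, start at degree n + 1 or higher. *)
Lemma pentagonal_truncated n : eqm (S n) E (ssum (S n) pent1 + ssum n pent2).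
Proof.
rewrite -shanks; apply: eqm_trans (euler_poch n) _.
rewrite ssum_l Nat.sub_0_r.
have -> : poch n = poch n + cst 0 by ring.
apply: eqm_add.
  rewrite /shF /=; have -> : cst (sg 0) * (shQ 0 n * cst 1) = shQ 0 n by rewrite /sg /=; ring.
  by move=> k Hk; congr (_ k); elim: n {Hk} => [|m IH] //=; rewrite IH.
rewrite -(ssum0 n); apply: ssum_eqm => i Hi; rewrite /shF.
have -> : (S i * (S i + (n - S i)) + tri (S i) = S n + (i * n + tri (S i) - 1))%nat by rewrite /=; nia.
rewrite pow_add; set x := q ^ S n; set y := q ^ (_ - 1).
have -> : cst (sg (S i)) * (shQ (S i) (n - S i) * (x * y)) = x * (cst (sg (S i)) * shQ (S i) (n - S i) * y) by ring.
by apply: eqm_sym; apply: eqm_var_pow0.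
Qed.

(** The coefficient of z^j, for j >= 0, in (1 + 1/z) times the product over m <= N of
    (1 + z q^m)(1 + q^m / z). That product is symmetric under exchanging z^j and
    z^(-1-j), so for j = 0 the coefficient of z^(-1) is the one of index 0. *)
Fixpoint tripleB (N j : nat) : ser :=
  match N with
  | O => match j with O => cst 1 | _ => cst 0 end
  | S M => (cst 1 + q ^ (2 * N)) * tripleB M j
           + q ^ N * (tripleB M (match j with O => O | S i => i end) + tripleB M (S j))
  end.

Lemma tripleB_big N j : (N < j)%nat -> tripleB N j = cst 0.
Proof.
elim: N j => [|N IH] [|j] Hj; try lia; first by [].
rewrite /= !IH; try lia. ring.
Qed.

Lemma inv_poch_pred m : inv_poch m = inv_poch (S m) * (cst 1 - q ^ S m).
Proof.
rewrite [inv_poch (S m)]/=; have := geoE (S m) (Nat.neq_succ_0 m) => e.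
have -> : inv_poch m * geo (S m) * (cst 1 - q ^ S m) = inv_poch m * ((cst 1 - q ^ S m) * geo (S m)) by ring.
by rewrite e; ring.
Qed.

Lemma pow_dbl f n : f ^ (2 * n) = f ^ n * f ^ n.
Proof. by rewrite pow_mul /=; ring. Qed.

(** The Gauss form q^T(j) (q)_(2N+1) / ((q)_(N-j) (q)_(N+1+j)): both sides satisfy
    the same recursion, and N - j is named d to stay clear of truncated subtraction. *)
Lemma tripleB_closed N j d : (j + d = N)%nat ->
  tripleB N j = q ^ tri j * (poch (2 * N + 1) * (inv_poch d * inv_poch (N + 1 + j))).
Proof.
elim: N j d => [|N IH] j d Hd.
  have -> : j = O by lia. have -> : d = O by lia.
  change (cst 1 = cst 1 * (poch 1 * (cst 1 * inv_poch 1))).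
  have -> : cst 1 * (poch 1 * (cst 1 * inv_poch 1)) = poch 1 * inv_poch 1 by ring.
  by rewrite poch_inv.
have BS : tripleB (S N) j = (cst 1 + q ^ (2 * S N)) * tripleB N j
    + q ^ S N * (tripleB N (match j with O => O | S i => i end) + tripleB N (S j)) by [].
case: d Hd => [|e] Hd.
  have Ej : j = S N by lia.
  rewrite BS Ej (tripleB_big N (S N)) ?(tripleB_big N (S (S N))); try lia.
  change (match S N with O => O | S i => i end) with N.
  rewrite (IH N O); last by lia.
  have -> : (N + 1 + N = 2 * N + 1)%nat by lia.
  have -> : (S N + 1 + S N = 2 * S N + 1)%nat by lia.
  set m := (2 * S N + 1)%nat; set l := (2 * N + 1)%nat.
  have -> : tri (S N) = (tri N + S N)%nat by [].
  rewrite pow_add [inv_poch 0]/=; have e1 := poch_inv m; have e2 := poch_inv l.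
  transitivity (q ^ S N * (q ^ tri N * (poch l * inv_poch l))); first by ring.
  by rewrite e2; ring [e1].
have EN : N = (j + e)%nat by lia.
have P2 : poch (2 * S N + 1) = poch (2 * N + 1) * ((cst 1 - q ^ (2 * N + 2)) * (cst 1 - q ^ (2 * N + 3))).
  have -> : (2 * S N + 1 = S (S (2 * N + 1)))%nat by lia.
  have -> : (2 * N + 2 = S (2 * N + 1))%nat by lia.
  have -> : (2 * N + 3 = S (S (2 * N + 1)))%nat by lia.
  by move: (2 * N + 1)%nat => m; rewrite /=; ring.
set PP := poch (2 * N + 1) in P2 IH.
set I1 := inv_poch (S e); set I2 := inv_poch (S N + 1 + j).
have e1 : inv_poch e = I1 * (cst 1 - q ^ S e) by apply: inv_poch_pred.
have e2 : inv_poch (N + 1 + j) = I2 * (cst 1 - q ^ (N + 2 + j)).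
  rewrite inv_poch_pred /I2; have -> : (S N + 1 + j = S (N + 1 + j))%nat by lia.
  by have -> : (N + 2 + j = S (N + 1 + j))%nat by lia.
have e3 : inv_poch (N + j) = I2 * (cst 1 - q ^ (N + 2 + j)) * (cst 1 - q ^ (N + 1 + j)).
  by rewrite -e2 inv_poch_pred; have -> : (S (N + j) = N + 1 + j)%nat by lia.
have h0 : tripleB N j = q ^ tri j * (PP * (inv_poch e * inv_poch (N + 1 + j))) by apply: IH; lia.
have h1 : tripleB N (S j) = q ^ tri (S j) * (PP * (I1 * (cst 1 - q ^ S e) * (cst 1 - q ^ e) * I2)).
  case: (e) EN @I1 e1 h0 => [|e'] EN I1 e1 h0.
    by rewrite tripleB_big; [ring|lia].
  rewrite (IH (S j) e'); last by lia.
  rewrite inv_poch_pred e1; have -> : (N + 1 + S j = S N + 1 + j)%nat by lia.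
  by rewrite /I2; ring.
have h2 : q ^ j * tripleB N (match j with O => O | S i => i end) =
   q ^ tri j * (PP * (I1 * inv_poch (N + j))).
  case: j EN {h0 h1 e2 e3 BS Hd} @I2 => [|i] EN I2.
    rewrite (IH O N) // /I1.
    have -> : (N + 1 + 0 = S N)%nat by lia. have -> : S e = S N by lia.
    by rewrite Nat.add_0_r /=; ring.
  rewrite (IH i (S e)); last by lia.
  have -> : tri (S i) = (tri i + S i)%nat by [].
  have -> : (N + 1 + i = N + S i)%nat by lia.
  by rewrite pow_add /I1; ring.
rewrite BS P2 h0 h1 e1 e2.
have -> : q ^ S N = q ^ S e * q ^ j by rewrite -pow_add; congr Ser.pow; lia.
(* With a = q^j and b = q^e all powers are monomials and the recursion is polynomial. *)
set a := q ^ j in h2 *; set b := q ^ e in h1 *.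
have -> : forall X Y, q ^ S e * a * (X + Y) = q ^ S e * (a * X) + q ^ S e * a * Y by move=> X Y; ring.
rewrite h2 e3.
have -> : q ^ S e = q * b by [].
have -> : q ^ (2 * S N) = q ^ 2 * (a * b) ^ 2.
  by rewrite /a /b -pow_add -EN pow_dbl /=; ring.
have -> : q ^ (2 * N + 2) = q ^ 2 * (a * b) ^ 2.
  by rewrite /a /b -pow_add -EN pow_add pow_dbl /=; ring.
have -> : q ^ (2 * N + 3) = q ^ 3 * (a * b) ^ 2.
  by rewrite /a /b -pow_add -EN pow_add pow_dbl /=; ring.
have -> : q ^ (N + 2 + j) = q ^ 2 * a ^ 2 * b.
  by rewrite {1}EN !pow_add -/a -/b; ring.
have -> : q ^ (N + 1 + j) = q * a ^ 2 * b.
  by rewrite {1}EN !pow_add -/a -/b /=; ring.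
have -> : q ^ tri (S j) = q ^ tri j * (q * a) by rewrite [tri (S j)]/= pow_add.
by ring.
Qed.

(** Up to sign the derivative of z^j + z^(-1-j) at z = -1. *)
Definition jac (j : nat) : Z := (sg j * (2 * Z.of_nat j + 1))%Z.

Lemma tripleB_S N j : tripleB (S N) j = (cst 1 + q ^ (2 * S N)) * tripleB N j
    + q ^ S N * (tripleB N (match j with O => O | S i => i end) + tripleB N (S j)).
Proof. by []. Qed.
Lemma ssum_S n f : ssum (S n) f = ssum n f + f n. Proof. by []. Qed.

(** Summation by parts in the recursion of tripleB, leaving boundary terms at M; they
    vanish once M exceeds N. *)
Lemma tripleB_weighted N M :
  ssum (S M) (fun j => cst (jac j) * tripleB (S N) j) =
    (cst 1 - q ^ S N) ^ 2 * ssum (S M) (fun j => cst (jac j) * tripleB N j)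
    + q ^ S N * (cst (jac M) * tripleB N (S M) - cst (jac (S M)) * tripleB N M).
Proof.
elim: M => [|M IH].
  by rewrite [ssum 1 _]/= [ssum 1 _]/= -/(tripleB (S N) 0) tripleB_S pow_dbl /jac /sg; simpl Nat.even; move: (q ^ S N) => a /=; ring.
rewrite ssum_S IH (ssum_S (S M) (fun j => cst (jac j) * tripleB N j)) tripleB_S pow_dbl.
have E1 : cst (jac (S M)) = - (cst (sg M) * (cst 2 * cst (Z.of_nat M) + cst 3)).
  by rewrite /jac !sg_S !Nat2Z.inj_succ /Z.succ; apply: Ser.ext => -[|n]; rewrite opp_coef !cst_mul_coef add_coef !cst_mul_coef /Ser.cst; ring.
have E0 : cst (jac M) = cst (sg M) * (cst 2 * cst (Z.of_nat M) + cst 1).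
  by rewrite /jac; apply: Ser.ext => -[|n]; rewrite !cst_mul_coef add_coef !cst_mul_coef /Ser.cst; ring.
have E2 : cst (jac (S (S M))) = cst (sg M) * (cst 2 * cst (Z.of_nat M) + cst 5).
  by rewrite /jac ?sg_S ?Nat2Z.inj_succ /Z.succ; apply: Ser.ext => -[|n]; rewrite !cst_mul_coef add_coef !cst_mul_coef /Ser.cst; ring.
by rewrite E0 E1 E2; ring.
Qed.

(** Up to sign both sides are the derivative at z = -1 of the product behind tripleB, where only
    the factor 1 + 1/z vanishes. *)
Lemma jacobi_finite N : ssum (S N) (fun j => cst (jac j) * tripleB N j) = poch N ^ 2.
Proof.
elim: N => [|N IH]; first by rewrite /= /jac /sg /=; ring.
rewrite tripleB_weighted (tripleB_big N (S N)) ?(tripleB_big N (S (S N))); try lia.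
rewrite ssum_S (tripleB_big N (S N)); last by lia.
rewrite IH; have -> : poch (S N) = poch N * (cst 1 - q ^ S N) by [].
by ring.
Qed.

Lemma tri_ge n : (n <= tri n)%nat.
Proof. by elim: n => [|n IH] /=; lia. Qed.

(** As N grows, the closed form of tripleB N j tends to q^T(j) / E, so jacobi_finite
    becomes the formula of Jacobi divided by E. *)
Lemma jacobi_truncated N : eqm N (E ^ 3) (ssum (S N) (fun j => cst (jac j) * q ^ tri j)).
Proof.
have H : eqm N (E ^ 2) (ssum (S N) (fun j => cst (jac j) * q ^ tri j) * p).
  apply: (eqm_trans _ _ (poch N ^ 2)); first by apply: eqm_pow; apply: eqm_le (euler_poch N); lia.
  rewrite -jacobi_finite.
  have -> : forall n f, ssum n f * p = ssum n (fun j => f j * p).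
    by move=> n f; elim: n => [|n IH] /=; [ring|rewrite -IH; ring].
  apply: ssum_eqm => j Hj.
  rewrite (tripleB_closed N j (N - j)); last by lia.
  set X := poch _ * _.
  have -> : cst (jac j) * (q ^ tri j * X) = q ^ tri j * (cst (jac j) * X) by ring.
  have -> : cst (jac j) * q ^ tri j * p = q ^ tri j * (cst (jac j) * p) by ring.
  have L := tri_ge j.
  apply: (eqm_le (tri j + (S (N - j)))); first by lia.
  apply: eqm_var_pow; apply: eqm_mul => //.
  (* E p^2 matches the three factors of the closed form one by one. *)
  have -> : p = E * (p * p) by ring [euler_partitions].
  rewrite /X; apply: eqm_mul.
    by apply: eqm_sym; apply: eqm_le (euler_poch _); lia.
  by apply: eqm_mul; apply: eqm_sym; apply: eqm_le (partitions_inv_poch _); lia.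
have -> : ssum (S N) (fun j => cst (jac j) * q ^ tri j) =
  ssum (S N) (fun j => cst (jac j) * q ^ tri j) * p * E.
  by set X := ssum _ _; ring [euler_partitions].
have -> : E ^ 3 = E ^ 2 * E by ring.
exact: eqm_mul.
Qed.

(** The product of f(q), f(w q), f(w^2 q) for a primitive cube root of unity w, a
    series in q^3, written with q^3 replaced by q. *)
Definition norm (f : ser) : ser :=
  sec 0 f ^ 3 + q * sec 1 f ^ 3 + q ^ 2 * sec 2 f ^ 3 - cst 3 * q * (sec 0 f * sec 1 f * sec 2 f).

Lemma norm_mul f g : norm (f * g) = norm f * norm g.
Proof. by rewrite {1}/norm (dissect f) (dissect g) mix_mul !sec_mix /norm !sec_mix; ring. Qed.

Lemma dil_opp k f : k <> O -> dil k (- f) = - dil k f.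
Proof. move=> k0; have -> : - f = cst 0 - f by ring.
by rewrite dil_sub // dil_cst //; ring. Qed.
Lemma dil_var_pow k n : k <> O -> dil k (q ^ n) = q ^ (n * k).
Proof. by move=> k0; rewrite dil_pow // dil_var // -pow_mul. Qed.

Lemma norm_factor0 n : norm (cst 1 - q ^ (n * 3)) = (cst 1 - q ^ n) ^ 3.
Proof.
have -> : cst 1 - q ^ (n * 3) = mix (cst 1 - q ^ n) (cst 0) (cst 0).
  by rewrite /mix dil_sub // !dil_cst // dil_var_pow //; ring.
by rewrite /norm !sec_mix; ring.
Qed.
Lemma norm_factor1 n : norm (cst 1 - q ^ (S (n * 3))) = cst 1 - q ^ (S (n * 3)).
Proof.
rewrite [X in norm X](_ : _ = mix (cst 1) (- q ^ n) (cst 0)); last first.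
  by rewrite /mix dil_opp // !dil_cst // dil_var_pow // [q ^ S _]/=; ring.
rewrite /norm !sec_mix.
have -> : q ^ S (n * 3) = q * (q ^ n) ^ 3 by rewrite -pow_mul Nat.mul_comm.
by ring.
Qed.
Lemma norm_factor2 n : norm (cst 1 - q ^ (S (S (n * 3)))) = cst 1 - q ^ (S (S (n * 3))).
Proof.
rewrite [X in norm X](_ : _ = mix (cst 1) (cst 0) (- q ^ n)); last first.
  by rewrite /mix dil_opp // !dil_cst // dil_var_pow // [q ^ S _]/=; ring.
rewrite /norm !sec_mix.
have -> : q ^ S (S (n * 3)) = q ^ 2 * (q ^ n) ^ 3.
  by rewrite -pow_mul Nat.mul_comm -pow_add.
by ring.
Qed.

(** A factor 1 - q^n has norm 1 - q^n if 3 does not divide n, and (1 - q^(n/3))^3 if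
    it does. *)
Lemma norm_poch n : norm (poch (n * 3)) * dil 3 (poch n) = poch (n * 3) * poch n ^ 3.
Proof.
elim: n => [|n IH].
  change (norm (cst 1) * dil 3 (cst 1) = cst 1 * cst 1 ^ 3); rewrite dil_cst //.
  rewrite [X in norm X](_ : _ = mix (cst 1) (cst 0) (cst 0)); last by rewrite /mix !dil_cst //; ring.
  by rewrite /norm !sec_mix; ring.
have -> : poch (S n * 3) = poch (n * 3) * (cst 1 - q ^ (S (n * 3))) * (cst 1 - q ^ (S (S (n * 3)))) * (cst 1 - q ^ (S n * 3)) by [].
have -> : poch (S n) = poch n * (cst 1 - q ^ S n) by [].
rewrite !norm_mul norm_factor0 norm_factor1 norm_factor2 dil_mul // dil_sub // dil_cst // dil_var_pow //.
set a := cst 1 - q ^ (S (n * 3)); set b := cst 1 - q ^ _; set c := cst 1 - q ^ _; set d := cst 1 - q ^ _.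
transitivity (norm (poch (n * 3)) * dil 3 (poch n) * (a * b * c ^ 3 * d)); first by ring.
by rewrite IH; ring.
Qed.

Lemma norm_eqm N f g : eqm (3 * N) f g -> eqm N (norm f) (norm g).
Proof.
move=> H; rewrite /norm.
have S0 := sec_eqm N 0 f g ltac:(lia) H.
have S1 := sec_eqm N 1 f g ltac:(lia) H.
have S2 := sec_eqm N 2 f g ltac:(lia) H.
by repeat first [apply: eqm_sub | apply: eqm_add | apply: eqm_mul | apply: eqm_pow | by [] | assumption].
Qed.

Lemma norm_euler : norm E * dil 3 E = E ^ 4.
Proof.
apply: eqm_eq => N.
have e1 : eqm (3 * N) E (poch (N * 3)) by apply: eqm_le (euler_poch _); lia.
have e2 : eqm N E (poch N) by apply: eqm_le (euler_poch _); lia.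
apply: (eqm_trans _ _ (norm (poch (N * 3)) * dil 3 (poch N))).
  apply: eqm_mul; first exact: norm_eqm.
  by apply: (eqm_le (3 * N)); [lia|apply: dil_eqm].
rewrite norm_poch; have -> : E ^ 4 = E * E ^ 3 by ring.
apply: eqm_mul; apply: eqm_sym; last exact: eqm_pow.
by apply: eqm_le e1; lia.
Qed.

Lemma dil_varpow_mul k n f : k <> O -> dil k (q ^ n * f) = q ^ (n * k) * dil k f.
Proof. by move=> k0; rewrite dil_mul // dil_var_pow. Qed.
Lemma dil_cst_mul k c f : k <> O -> dil k (cst c * f) = cst c * dil k f.
Proof. by move=> k0; rewrite dil_mul // dil_cst. Qed.

End Series.

Module Lattice.
Import Series.
Import eqtype ssrnat seq bigop zify_ssreflect.
Local Close Scope C_scope.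
Local Open Scope ser_scope.

(** * Generating series of weighted index sets *)

Lemma Zeqb_axiom : Equality.axiom Z.eqb.
Proof. by move=> x y; apply: (iffP idP) => /Z.eqb_eq. Qed.
HB.instance Definition _ := hasDecEq.Build Z Zeqb_axiom.
HB.instance Definition _ := Monoid.isComLaw.Build Z 0%Z Z.add Z.add_assoc Z.add_comm Z.add_0_l.
HB.instance Definition _ := Monoid.isMulLaw.Build Z 0%Z Z.mul Z.mul_0_l Z.mul_0_r.
HB.instance Definition _ := Monoid.isAddLaw.Build Z Z.mul Z.add Z.mul_add_distr_r Z.mul_add_distr_l.

Notation "\zsum_ ( i <- r ) F" := (\big[Z.add/0%Z]_(i <- r) F%Z)
  (at level 41, F at level 41, i, r at level 50).

Lemma mul_coef f g n : (f * g) n = \zsum_(i <- iota 0 n.+1) (f i * g (n - i)%N).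
Proof.
rewrite /Ser.mul; elim: n f => [|n IH] f; first by rewrite big_seq1.
have -> : iota 0 n.+2 = 0%N :: map (addn 1) (iota 0 n.+1) by rewrite -(iotaDl 1 0).
by rewrite big_cons big_map /= subn0 IH.
Qed.

(** Every value is attained finitely often: the condition under which the sum of
    c i * q^(e i) makes sense. *)
Definition fin {I : eqType} (e : I -> Z) :=
  forall n : nat, exists l : seq I, forall i, e i = Z.of_nat n -> i \in l.

(** Index types are arbitrary, so the list enumerating a fibre is chosen by epsilon
    rather than computed. *)
Definition fiber {I : eqType} (e : I -> Z) (n : nat) : seq I :=
  epsilon (inhabits nil) (fun l => uniq l /\ forall i, (i \in l) = (e i == Z.of_nat n)).

(** The sum of c i * q^(e i) over all i. *)
Definition gen {I : eqType} (e : I -> Z) (c : I -> Z) : ser := fun n => \zsum_(i <- fiber e n) c i.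

Lemma fiberP {I : eqType} (e : I -> Z) n : fin e ->
  uniq (fiber e n) /\ forall i, (i \in fiber e n) = (e i == Z.of_nat n).
Proof.
move=> /(_ n) [l Hl]; apply: (epsilon_spec (inhabits [::]) (fun l => uniq l /\ forall i, (i \in l) = (e i == Z.of_nat n))).
exists (undup [seq i <- l | e i == Z.of_nat n]); split; first exact: undup_uniq.
by move=> i; rewrite mem_undup mem_filter; case: eqP => //= /Hl ->.
Qed.

(** Any list containing the support of c on the fibre computes the coefficient,
    whichever list fiber has chosen. *)
Lemma gen_coef {I : eqType} (e : I -> Z) c n (l : seq I) : fin e -> uniq l ->
  (forall i, e i = Z.of_nat n -> c i <> 0%Z -> i \in l) ->
  gen e c n = \zsum_(i <- l) (if e i == Z.of_nat n then c i else 0).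
Proof.
move=> /(fiberP e n) [U M] Ul Hl; rewrite /gen.
have aux (s : seq I) : \zsum_(i <- s) c i = \zsum_(i <- [seq i <- s | c i != 0%Z]) c i.
  by rewrite big_filter [RHS]big_mkcond; apply: eq_bigr => i _; case: eqP.
rewrite -big_mkcond -[RHS]big_filter aux [RHS]aux; apply: perm_big.
apply: uniq_perm; rewrite ?filter_uniq // => i.
rewrite !mem_filter M; case: (eqVneq (c i) 0%Z) => //= /eqP ci.
by case: eqP => //= ei; rewrite Hl.
Qed.

Section Reindex.
Context {I J : eqType} (h : J -> I) (hi : injective h).
(** Finiteness passes to preimages; excluded middle decides whether an element has
    one. *)
Lemma preimages (l : seq I) : exists l' : seq J, forall j, h j \in l -> j \in l'.
Proof.
elim: l => [|i l [l' IH]]; first by exists [::].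
case: (excluded_middle_informative (exists j, h j = i)) => [[j0 E0]|N].
  exists (j0 :: l') => j; rewrite !in_cons => /orP[/eqP e0|/IH ->]; last by rewrite orbT.
  by rewrite -(hi _ _ (etrans E0 (esym e0))) eqxx.
exists l' => j; rewrite in_cons => /orP[/eqP e0|/IH //].
by case: N; exists j.
Qed.
Lemma fin_inj (e : I -> Z) : fin e -> fin (fun j => e (h j)).
Proof.
by move=> H n; have [l Hl] := H n; have [l' Hl'] := preimages l; exists l' => j /Hl /Hl'.
Qed.

(** Reindexing along an injection whose image contains the support of the weights; a
    summation condition can thus be absorbed into the index set. *)
Lemma gen_inj (e : I -> Z) c : fin e -> (forall i, c i <> 0%Z -> exists j, h j = i) ->
  gen e c = gen (fun j => e (h j)) (fun j => c (h j)).
Proof.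
move=> fe hs; apply: Ser.ext => n.
have [U M] := fiberP _ n (fin_inj e fe).
rewrite (gen_coef e c n (map h (fiber (fun j => e (h j)) n)) fe).
- rewrite big_map /gen -big_mkcond -big_filter; congr bigop.body.
  by apply/all_filterP/allP => j; rewrite M.
- by rewrite map_inj_uniq.
- move=> i ei /hs [j ej]; rewrite -ej mem_map // M ej ei; exact: eqxx.
Qed.
End Reindex.

Lemma fin_ext {I : eqType} (e e' : I -> Z) : e =1 e' -> fin e -> fin e'.
Proof. by move=> H K n; have [l Hl] := K n; exists l => i; rewrite -H; apply: Hl. Qed.

Lemma gen_ext {I : eqType} (e e' c c' : I -> Z) : e =1 e' -> c =1 c' -> gen e c = gen e' c'.
Proof.
move=> /functional_extensionality -> H; apply: Ser.ext => n; rewrite /gen.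
by apply: eq_bigr => i _.
Qed.

Lemma gen_add {I : eqType} (e c c' : I -> Z) : gen e c + gen e c' = gen e (fun i => (c i + c' i)%Z).
Proof. by apply: Ser.ext => n; rewrite add_coef /gen -big_split. Qed.
Lemma gen_scale {I : eqType} (e c : I -> Z) k : gen e (fun i => (k * c i)%Z) = cst k * gen e c.
Proof. by apply: Ser.ext => n; rewrite cst_mul_coef /gen big_distrr. Qed.

Lemma gen_sum {I J : eqType} (e c : I + J -> Z) : fin e ->
  gen e c = gen (fun i => e (inl i)) (fun i => c (inl i)) + gen (fun j => e (inr j)) (fun j => c (inr j)).
Proof.
move=> fe; apply: Ser.ext => n; rewrite add_coef.
have fl : fin (fun i => e (inl i)) by apply: (fin_inj inl) fe => x y [].
have fr : fin (fun i => e (inr i)) by apply: (fin_inj inr) fe => x y [].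
have [U M] := fiberP _ n fl. have [U' M'] := fiberP _ n fr.
rewrite (gen_coef e c n (map inl (fiber (fun i => e (inl i)) n) ++ map inr (fiber (fun i => e (inr i)) n)) fe).
- rewrite big_cat !big_map /gen; congr Z.add; rewrite -big_mkcond -big_filter; congr bigop.body;
    by apply/all_filterP/allP => j; rewrite ?M ?M'.
- rewrite cat_uniq !map_inj_uniq ?U ?U'; try by move=> x y [].
  by rewrite andbT /=; apply/hasPn => x /mapP [j _ ->]; apply/negP => /mapP [].
- by move=> [i|j] E _; rewrite mem_cat; [rewrite (map_f inl) // M E eqxx|rewrite (map_f inr) ?orbT // M' E eqxx].
Qed.

Lemma fin_prod {I J : eqType} (e : I -> Z) (e' : J -> Z) : fin e -> fin e' ->
  (forall i, (0 <= e i)%Z) -> (forall i, (0 <= e' i)%Z) -> fin (fun x : I * J => (e x.1 + e' x.2)%Z).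
Proof.
move=> H H' p0 p1 n.
have K (X : eqType) (w : X -> Z) : fin w -> forall N : nat, exists l : seq X, forall i, (0 <= w i < Z.of_nat N)%Z -> i \in l.
  move=> fw; elim=> [|N [l Hl]]; first by exists [::] => i; lia.
  have [l' Hl'] := fw N; exists (l ++ l') => i Hi; rewrite mem_cat.
  case: (Z.eq_dec (w i) (Z.of_nat N)) => [/Hl' ->|ne]; first by rewrite orbT.
  by rewrite Hl //; lia.
have [l Hl] := K _ _ H (S n); have [l' Hl'] := K _ _ H' (S n).
exists (allpairs pair l l') => -[i j] /= E; apply: allpairs_f; [apply: Hl|apply: Hl'].
  by have := p0 i; have := p1 j; lia.
by have := p0 i; have := p1 j; lia.
Qed.

Lemma uniq_flatten_map {A B : eqType} (f : A -> seq B) r : uniq r -> (forall i, uniq (f i)) ->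
  (forall i j x, x \in f i -> x \in f j -> i = j) -> uniq (flatten [seq f i | i <- r]).
Proof.
move=> Ur Uf D; elim: r Ur => [|i r IH] //= /andP [ni Ur].
rewrite cat_uniq Uf IH // andbT; apply/hasPn => x /flatten_mapP [j mj mx].
by apply/negP => mi; rewrite (D _ _ _ mi mx) mj in ni.
Qed.

Lemma gen_mul {I J : eqType} (e c : I -> Z) (e' c' : J -> Z) : fin e -> fin e' ->
  (forall i, (0 <= e i)%Z) -> (forall i, (0 <= e' i)%Z) ->
  gen e c * gen e' c' = gen (fun x : I * J => (e x.1 + e' x.2)%Z) (fun x => (c x.1 * c' x.2)%Z).
Proof.
move=> H H' p0 p1; apply: Ser.ext => n; rewrite mul_coef.
have F := fin_prod e e' H H' p0 p1.
set L := flatten [seq allpairs pair (fiber e i) (fiber e' (n - i)%N) | i <- iota 0 n.+1].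
have ML x : (x \in L) = ((e x.1 + e' x.2)%Z == Z.of_nat n).
  case: x => x y /=; apply/flatten_mapP/eqP => [[i]|E].
    rewrite mem_iota => /andP [_ Hi] /allpairsP [[x' y'] /= [mx my [ex ey]]]; subst x' y'.
    move: mx my; have [_ ->] := fiberP _ i H; have [_ ->] := fiberP _ (n - i)%N H'.
    by move=> /eqP -> /eqP ->; lia.
  have q0 := p0 x; have q1 := p1 y.
  exists (Z.to_nat (e x)); first by rewrite mem_iota; apply/andP; split=> //; lia.
  apply: allpairs_f; [have [_ ->] := fiberP _ (Z.to_nat (e x)) H|have [_ ->] := fiberP _ (n - Z.to_nat (e x))%N H'];
    apply/eqP; lia.
have UL : uniq L.
  apply: uniq_flatten_map; first exact: iota_uniq.
    move=> i; apply: allpairs_uniq; [by case: (fiberP e i H)|by case: (fiberP e' (n - i)%N H')|by move=> [? ?] [? ?]].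
  move=> i j x /allpairsP [[x1 x2] /= [m1 _ ->]] /allpairsP [[y1 y2] /= [m2 _ [E _]]]; subst y1.
  move: m1 m2; have [_ ->] := fiberP e i H; have [_ ->] := fiberP e j H.
  by move=> /eqP -> /eqP; lia.
rewrite (gen_coef _ _ n L F UL); last by move=> x E _; rewrite ML E eqxx.
rewrite big_flatten big_map big_seq [RHS]big_seq; apply: eq_bigr => i; rewrite mem_iota => Hi.
rewrite /gen big_distrlr big_allpairs /=.
rewrite big_seq [RHS]big_seq; apply: eq_bigr => x; have [_ ->] := fiberP e i H => /eqP Ex.
rewrite big_seq [RHS]big_seq; apply: eq_bigr => y; have [_ ->] := fiberP e' (n - i)%N H' => /eqP Ey.
by case: eqP => // ne; exfalso; lia.
Qed.

Lemma fin_scale {I : eqType} (e : I -> Z) (k : Z) : (0 < k)%Z -> fin e -> fin (fun i => (k * e i)%Z).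
Proof.
move=> k0 fe n; have [l Hl] := fe (Z.to_nat (Z.of_nat n / k)).
exists l => i E; apply: Hl.
have -> : (Z.of_nat n / k = e i)%Z by rewrite -E Z.mul_comm Z.div_mul //; lia.
by nia.
Qed.

Lemma gen_dil {I : eqType} (e c : I -> Z) (k : nat) : k <> O -> fin e ->
  dil k (gen e c) = gen (fun i => (Z.of_nat k * e i)%Z) c.
Proof.
move=> k0 fe; apply: Ser.ext => n; rewrite /dil.
have fk : fin (fun i => (Z.of_nat k * e i)%Z) by apply: fin_scale => //; lia.
case: (PeanoNat.Nat.eqb_spec (Nat.modulo n k) 0) => H.
  have En : n = Nat.mul k (Nat.div n k) by apply/PeanoNat.Nat.Div0.div_exact.
  set m := Nat.div n k in En *.
  have [U M] := fiberP e m fe.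
  rewrite (gen_coef _ c n (fiber e m) fk U).
    rewrite /gen big_seq [RHS]big_seq; apply: eq_bigr => i; rewrite M => /eqP Ei.
    by case: eqP => // ne; exfalso; apply: ne; rewrite Ei En; lia.
  by move=> i E _; rewrite M; apply/eqP; nia.
rewrite (gen_coef _ c n [::] fk) ?big_nil // => i E _; exfalso; apply: H.
have := PeanoNat.Nat.div_mod_eq n k; have := PeanoNat.Nat.mod_upper_bound n k.
set a := Nat.div n k; set b := Nat.modulo n k => h1 h2.
have {}h1 : (b < k)%coq_nat by apply: h1; lia.
have E2 : (Z.of_nat k * (e i - Z.of_nat a) = Z.of_nat b)%Z by nia.
have : (e i = Z.of_nat a)%Z by nia.
nia.
Qed.

Lemma gen_shift {I : eqType} (e c : I -> Z) (k : nat) : fin e -> (forall i, (0 <= e i)%Z) ->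
  fin (fun i => (Z.of_nat k + e i)%Z) ->
  q ^ k * gen e c = gen (fun i => (Z.of_nat k + e i)%Z) c.
Proof.
move=> fe p0 fk; apply: Ser.ext => n; rewrite var_pow_mul.
case: PeanoNat.Nat.ltb_spec => H.
  by rewrite (gen_coef _ c n [::] fk) ?big_nil // => i E _; have := p0 i; lia.
set m := Nat.sub n k; have [U M] := fiberP e m fe.
rewrite (gen_coef _ c n (fiber e m) fk U).
  rewrite /gen big_seq [RHS]big_seq; apply: eq_bigr => i; rewrite M => /eqP Ei.
  by case: eqP => // ne; exfalso; lia.
by move=> i E _; rewrite M; apply/eqP; lia.
Qed.

Lemma fin_shift {I : eqType} (e : I -> Z) (k : Z) : fin e -> (0 <= k)%Z -> (forall i, (0 <= e i)%Z) -> fin (fun i => (k + e i)%Z).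
Proof.
move=> fe k0 p0 n; have [l Hl] := fe (Z.to_nat (Z.of_nat n - k)).
by exists l => i E; apply: Hl; have := p0 i; lia.
Qed.

(** Linear growth is all that the quadratic exponents below need. *)
Lemma fin_Z (e : Z -> Z) : (forall i, (Z.abs i <= e i + 1)%Z) -> fin e.
Proof.
move=> H n; exists (map (fun k => (Z.of_nat k - Z.of_nat n - 1)%Z) (iota 0 (2 * n + 3))) => i E.
have := H i => Hi; apply/mapP; exists (Z.to_nat (i + Z.of_nat n + 1)); last by lia.
by rewrite mem_iota; apply/andP; split=> //; lia.
Qed.

(** * One-dimensional theta series *)

(** Parametrizations of the parts of an index set are glued to one map on a sum type,
    so that disjointness and exhaustion are injectivity and surjectivity. *)
Definition case2 {A B C : Type} (f : A -> C) (g : B -> C) (x : A + B) : C :=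
  match x with inl a => f a | inr b => g b end.

Lemma gen_split2 {I J K : eqType} (f : I -> K) (g : J -> K) (e c : K -> Z) : fin e ->
  injective (case2 f g) -> (forall k, exists s, case2 f g s = k) ->
  gen e c = gen (fun i => e (f i)) (fun i => c (f i)) + gen (fun i => e (g i)) (fun i => c (g i)).
Proof.
move=> fe inj sur; rewrite (gen_inj (case2 f g) inj e c fe); last by move=> k _; apply: sur.
by rewrite gen_sum //; apply: (fin_inj (case2 f g)).
Qed.

Lemma gen_split3 {I J L K : eqType} (f : I -> K) (g : J -> K) (h : L -> K) (e c : K -> Z) : fin e ->
  injective (case2 f (case2 g h)) -> (forall k, exists s, case2 f (case2 g h) s = k) ->
  gen e c = gen (fun i => e (f i)) (fun i => c (f i)) + gen (fun i => e (g i)) (fun i => c (g i))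
      + gen (fun i => e (h i)) (fun i => c (h i)).
Proof.
move=> fe inj sur; rewrite (gen_inj (case2 f (case2 g h)) inj e c fe); last by move=> k _; apply: sur.
rewrite gen_sum; last by apply: (fin_inj (case2 f (case2 g h))).
rewrite (gen_sum (fun j => e (case2 f (case2 g h) (inr j)))) /=; first by ring.
by apply: (fin_inj (case2 f (case2 g h) \o inr)) fe => x y /inj [].
Qed.

Lemma mod3_inj : injective (case2 (fun i => 3 * i)%Z (case2 (fun i => 3 * i + 1)%Z (fun i => 3 * i - 1)%Z)).
Proof. by move=> [i|[i|i]] [j|[j|j]]; rewrite /case2 => H; repeat f_equal; try lia; exfalso; lia. Qed.
Lemma mod3_sur k : exists s, case2 (fun i => 3 * i)%Z (case2 (fun i => 3 * i + 1)%Z (fun i => 3 * i - 1)%Z) s = k.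
Proof.
have D := Z_div_mod_eq_full k 3; have M := Z.mod_pos_bound k 3 ltac:(lia).
have : (k mod 3 = 0 \/ k mod 3 = 1 \/ k mod 3 = 2)%Z by lia.
move=> [H|[H|H]]; [exists (inl (k / 3)%Z)|exists (inr (inl (k / 3)%Z))|exists (inr (inr (k / 3 + 1)%Z))]; rewrite /case2; lia.
Qed.
Definition gen_mod3 (e c : Z -> Z) (fe : fin e) := gen_split3 _ _ _ e c fe mod3_inj mod3_sur.

Lemma neg_inj : injective (fun i => - i)%Z. Proof. by move=> i j; lia. Qed.
Lemma refl_inj : injective (fun i => -1 - i)%Z. Proof. by move=> i j; lia. Qed.
Lemma gen_neg e c : fin e -> gen e c = gen (fun i => e (- i)%Z) (fun i => c (- i)%Z).
Proof. by move=> fe; apply: (gen_inj _ neg_inj) => // i _; exists (- i)%Z; lia. Qed.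
(** The symmetry j -> -1 - j of triangular numbers. *)
Lemma gen_refl e c : fin e -> gen e c = gen (fun i => e (-1 - i)%Z) (fun i => c (-1 - i)%Z).
Proof. by move=> fe; apply: (gen_inj _ refl_inj) => // i _; exists (-1 - i)%Z; lia. Qed.

Definition triZ (j : Z) : Z := (j * (j + 1) / 2)%Z.
Notation T := triZ.
Definition pent (j : Z) : Z := (j * (3 * j + 1) / 2)%Z.
Definition sgnZ (j : Z) : Z := if Z.even j then 1%Z else (-1)%Z.

Lemma triZ_double j : (2 * T j = j * (j + 1))%Z.
Proof.
rewrite /T; have [m [->|->]] : exists m, (j = 2 * m \/ j = 2 * m + 1)%Z.
- by exists (j / 2)%Z; have := Z_div_mod_eq_full j 2; have := Z.mod_pos_bound j 2; lia.
- by rewrite -Z.mul_assoc Z.mul_comm (Z.mul_comm 2 (m * _)) Z.div_mul //; lia.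
- have -> : ((2 * m + 1) * (2 * m + 1 + 1) = ((2 * m + 1) * (m + 1)) * 2)%Z by ring.
  by rewrite Z.div_mul //; lia.
Qed.
Lemma pent_double j : (2 * pent j = j * (3 * j + 1))%Z.
Proof.
have := triZ_double j; rewrite /pent; have -> : (j * (3 * j + 1) = 2 * (T j + j * j))%Z by have := triZ_double j; nia.
by move=> _; rewrite (Z.mul_comm 2 (_ + _)) Z.div_mul //; lia.
Qed.
Lemma pentE j : pent j = (T j + j * j)%Z.
Proof. by have := triZ_double j; have := pent_double j; nia. Qed.
Lemma sgnZD i j : sgnZ (i + j) = (sgnZ i * sgnZ j)%Z.
Proof. by rewrite /sgnZ Z.even_add; case: Z.even; case: Z.even. Qed.
Lemma sgnZN i : sgnZ (- i) = sgnZ i. Proof. by rewrite /sgnZ Z.even_opp. Qed.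
Lemma sgnZ_even i : sgnZ (2 * i) = 1%Z. Proof. by rewrite /sgnZ Z.even_mul. Qed.
Lemma sgnZS i : sgnZ (i + 1) = (- sgnZ i)%Z. Proof. by rewrite sgnZD Z.mul_comm. Qed.

Lemma T_ge j : (Z.abs j <= T j + 1)%Z. Proof. by have := triZ_double j; nia. Qed.
Lemma T_pos j : (0 <= T j)%Z. Proof. by have := triZ_double j; nia. Qed.
Lemma pent_ge j : (Z.abs j <= pent j + 1)%Z. Proof. by rewrite pentE; have := T_ge j; nia. Qed.
Lemma pent_pos j : (0 <= pent j)%Z. Proof. by rewrite pentE; have := T_pos j; nia. Qed.
Lemma fin_T : fin T. Proof. exact: fin_Z T_ge. Qed.
Lemma fin_pent : fin pent. Proof. exact: fin_Z pent_ge. Qed.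

Definition e24 (j : Z) : Z := (3 * j * j + j)%Z.
Definition e15 (j : Z) : Z := (3 * j * j + 2 * j)%Z.
Definition esq (j : Z) : Z := (j * j)%Z.
Lemma e24_pos j : (0 <= e24 j)%Z. Proof. by rewrite /e24; nia. Qed.
Lemma e15_pos j : (0 <= e15 j)%Z. Proof. by rewrite /e15; nia. Qed.
Lemma esq_pos j : (0 <= esq j)%Z. Proof. by rewrite /esq; nia. Qed.
Lemma fin_e24 : fin e24. Proof. by apply: fin_Z => j; rewrite /e24; nia. Qed.
Lemma fin_e15 : fin e15. Proof. by apply: fin_Z => j; rewrite /e15; nia. Qed.
Lemma fin_esq : fin esq. Proof. by apply: fin_Z => j; rewrite /esq; nia. Qed.

Definition unit_wt {I : Type} (_ : I) : Z := 1%Z.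
Definition theta_tri : ser := gen T unit_wt.
Notation Th := theta_tri.
(** The part of E^3 in degrees divisible by 3, with q^3 replaced by q; divided by E it
    is the cubic theta function a. *)
Definition euler_cube0 : ser := gen pent (fun j => sgnZ j * (6 * j + 1))%Z.
Notation Gs := euler_cube0.
Definition theta24 : ser := gen e24 unit_wt.
(** The subscripts of theta24 and theta15 record the exponents 2, 4 and 1, 5 modulo 6 of q in
    the products with which the triple product identity writes these series. *)
Definition theta15 : ser := gen e15 unit_wt.
Definition theta_sq : ser := gen esq unit_wt.

Lemma ssum_coef n f m : (ssum n f) m = \zsum_(i <- iota 0 n) (f i m).
Proof.
elim: n => [|n IH]; first by rewrite big_nil; case: m.
by rewrite -addn1 iotaD big_cat /= big_seq1 addn1 ssum_S add_coef IH.
Qed.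

Lemma cvar_coef c k n : (cst c * q ^ k) n = if (k == n)%N then c else 0%Z.
Proof.
rewrite cst_mul_coef; have -> : q ^ k = q ^ k * cst 1 by ring.
rewrite var_pow_mul; case: PeanoNat.Nat.ltb_spec => H.
  by case: eqP => [E|_]; lia.
case: eqP => [->|ne]; first by rewrite PeanoNat.Nat.sub_diag /=; lia.
case E : (n - k)%coq_nat => [|m] /=; [exfalso; apply: ne; lia|lia].
Qed.

(** The bridge from generating series to the truncated sums: modulo q^N only finitely
    many terms are left. *)
Lemma gen_nat (e c : nat -> Z) N M : fin e -> (forall i, (0 <= e i)%Z) ->
  (forall i, (M <= i)%coq_nat -> (Z.of_nat N <= e i)%Z) ->
  eqm N (gen e c) (ssum M (fun i => cst (c i) * q ^ Z.to_nat (e i))).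
Proof.
move=> fe p0 H n Hn; rewrite (gen_coef e c n (iota 0 M) fe (iota_uniq _ _)).
  rewrite ssum_coef; apply: eq_bigr => i _; rewrite cvar_coef.
  by case: eqP => E; case: eqP => E' //; exfalso; [apply: E'; lia|apply: E; have := p0 i; lia].
move=> i Ei _; rewrite mem_iota; apply/andP; split=> //.
case: (leqP M i) => L; last by lia.
by have := H i ltac:(lia); lia.
Qed.

Lemma half_inj : injective (case2 Z.of_nat (fun n => -1 - Z.of_nat n)%Z).
Proof. by move=> [i|i] [j|j]; rewrite /case2 => H; repeat f_equal; try lia; exfalso; lia. Qed.
Lemma half_sur k : exists s, case2 Z.of_nat (fun n => -1 - Z.of_nat n)%Z s = k.
Proof.
case: (Z.leb_spec 0 k) => H; [exists (inl (Z.to_nat k))|exists (inr (Z.to_nat (-1 - k)))]; rewrite /case2; lia.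
Qed.
Lemma of_nat_inj : injective Z.of_nat. Proof. by move=> i j; lia. Qed.
Lemma neg_nat_inj : injective (fun n => -1 - Z.of_nat n)%Z. Proof. by move=> i j; lia. Qed.

Lemma tri_triZ n : Z.of_nat (tri n) = T (Z.of_nat n).
Proof.
have := triZ_double (Z.of_nat n); have : (2 * tri n = n * S n)%coq_nat.
  by elim: n => [|n IH] //=; lia.
by lia.
Qed.
Lemma sg_sgnZ n : sg n = sgnZ (Z.of_nat n).
Proof.
elim: n => [|n IH] //; rewrite sg_S IH Nat2Z.inj_succ -Z.add_1_r sgnZS; lia.
Qed.

Theorem pentagonal_number_theorem : E = gen pent sgnZ.
Proof.
apply: eqm_eq => N.
rewrite (gen_split2 Z.of_nat (fun n => -1 - Z.of_nat n)%Z pent sgnZ fin_pent half_inj half_sur).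
apply: (eqm_trans _ _ (ssum (S N) pent1 + ssum N pent2)).
  by apply: eqm_le (pentagonal_truncated N); lia.
apply: eqm_add; apply: eqm_sym.
  apply: (eqm_trans _ _ _ _ (gen_nat _ _ N (S N) _ _ _)).
  - by apply: (fin_inj _ of_nat_inj); apply: fin_pent.
  - by move=> i; apply: pent_pos.
  - by move=> i Hi; rewrite pentE; have := T_pos (Z.of_nat i); nia.
  apply: ssum_eqm => i _; rewrite /pent1 sg_sgnZ.
  have -> : Z.to_nat (pent (Z.of_nat i)) = (i * i + tri i)%coq_nat; last by [].
  by rewrite pentE -tri_triZ; lia.
apply: (eqm_trans _ _ _ _ (gen_nat _ _ N N _ _ _)).
- by apply: (fin_inj _ neg_nat_inj); apply: fin_pent.
- by move=> i; apply: pent_pos.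
- by move=> i Hi; have := pent_double (-1 - Z.of_nat i)%Z; nia.
apply: ssum_eqm => i _; rewrite /pent2 sg_sgnZ.
have -> : (-1 - Z.of_nat i = - (Z.of_nat (S i)))%Z by lia.
rewrite sgnZN.
have -> : Z.to_nat (pent (- Z.of_nat (S i))) = (S i * i + tri (S i))%coq_nat; last by [].
have := pent_double (- Z.of_nat (S i)); have := tri_triZ (S i); have := triZ_double (Z.of_nat (S i)); nia.
Qed.

(** Stated over all of Z, where the terms of index j and -1-j are equal; this doubling
    is the factor 2. *)
Theorem jacobi_cube_identity : cst 2 * E ^ 3 = gen T (fun j => sgnZ j * (2 * j + 1))%Z.
Proof.
apply: eqm_eq => N.
rewrite (gen_split2 Z.of_nat (fun n => -1 - Z.of_nat n)%Z T _ fin_T half_inj half_sur).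
have -> : gen (fun i => T (-1 - Z.of_nat i)%Z) (fun i => sgnZ (-1 - Z.of_nat i) * (2 * (-1 - Z.of_nat i) + 1))%Z =
  gen (fun i => T (Z.of_nat i)) (fun i => sgnZ (Z.of_nat i) * (2 * Z.of_nat i + 1))%Z.
  apply: gen_ext => i.
    by have := triZ_double (-1 - Z.of_nat i)%Z; have := triZ_double (Z.of_nat i); nia.
  have -> : (-1 - Z.of_nat i = - (Z.of_nat i + 1))%Z by lia.
  rewrite sgnZN sgnZS; ring.
have -> : cst 2 * E ^ 3 = E ^ 3 + E ^ 3 by ring.
suff H : eqm N (E ^ 3) (gen (fun i => T (Z.of_nat i)) (fun i => sgnZ (Z.of_nat i) * (2 * Z.of_nat i + 1))%Z) by apply: eqm_add.
apply: (eqm_trans _ _ _ _ (jacobi_truncated N)); apply: eqm_sym.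
apply: (eqm_trans _ _ _ _ (gen_nat _ _ N (S N) _ _ _)).
- by apply: (fin_inj _ of_nat_inj); apply: fin_T.
- by move=> i; apply: T_pos.
- by move=> i Hi; have := triZ_double (Z.of_nat i); nia.
by apply: ssum_eqm => i _; rewrite /jac sg_sgnZ -tri_triZ Nat2Z.id.
Qed.

(** * Dissections modulo 3 and the squares of the residue parts of E *)

(** In the sum for E^3 the indices 3i and 3i - 1 give equal multiples of Gs(q^3), while
    T(3i + 1) = 9 T(i) + 1 with weight -3 times the weight of i reproduces E(q^9)^3. *)
Lemma jacobi_dissect : E ^ 3 = dil 3 Gs - cst 3 * q * dil 9 E ^ 3.
Proof.
have H9 : dil 9 (cst 2 * E ^ 3) = cst 2 * dil 9 E ^ 3 by rewrite dil_mul // dil_cst // dil_pow.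
apply: (cst_cancel 2) => //; rewrite {1}jacobi_cube_identity (gen_mod3 _ _ fin_T).
rewrite [X in X + _ + _](_ : _ = dil 3 Gs); last first.
  rewrite /Gs (gen_dil _ _ 3) //; [apply: gen_ext => i|exact: fin_pent].
    by have := triZ_double (3 * i); have := pent_double i; lia.
  have -> : (3 * i = 2 * i + i)%Z by lia.
  by rewrite sgnZD sgnZ_even; ring.
rewrite [X in _ + _ + X](_ : _ = dil 3 Gs); last first.
  rewrite /Gs (gen_neg _ _ fin_pent) (gen_dil _ _ 3) //; [apply: gen_ext => i|exact: (fin_inj _ neg_inj _ fin_pent)].
    by have := triZ_double (3 * i - 1); have := pent_double (-i); lia.
  have -> : (3 * i - 1 = 2 * (i - 1) + (i + 1))%Z by lia.
  by rewrite sgnZD sgnZ_even sgnZS sgnZN; ring.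
rewrite [X in _ + X + _](_ : _ = - (cst 3 * (q ^ 1 * dil 9 (cst 2 * E ^ 3)))); last first.
  have f9 : fin (fun i => Z.of_nat 9 * T i)%Z by apply: fin_scale fin_T.
  have p9 i : (0 <= Z.of_nat 9 * T i)%Z by have := T_pos i; lia.
  rewrite jacobi_cube_identity (gen_dil _ _ 9) //; last exact: fin_T.
  rewrite gen_shift //; last by apply: fin_shift.
  have -> : forall X, - (cst 3 * X) = cst (-3) * X by move=> X; ring.
  rewrite -gen_scale; apply: gen_ext => i.
    by have := triZ_double (3 * i + 1); have := triZ_double i; lia.
  have -> : (3 * i + 1 = 2 * i + (i + 1))%Z by lia.
  by rewrite sgnZD sgnZ_even sgnZS; ring.
by rewrite H9; ring.
Qed.

(** The argument of jacobi_dissect without weights. *)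
Lemma theta_tri_dissect : dil 2 Th = cst 2 * dil 3 theta24 + q ^ 2 * dil 18 Th.
Proof.
have f2 : fin (fun i => Z.of_nat 2 * T i)%Z by apply: fin_scale fin_T.
rewrite {1}/Th (gen_dil _ _ 2) //; last exact: fin_T.
rewrite (gen_mod3 _ _ f2).
rewrite [X in X + _ + _](_ : _ = dil 3 theta24); last first.
  rewrite /theta24 (gen_dil _ _ 3) //; [apply: gen_ext => i //|exact: fin_e24].
  by have := triZ_double (3 * i); rewrite /e24; lia.
rewrite [X in _ + _ + X](_ : _ = dil 3 theta24); last first.
  rewrite /theta24 (gen_neg _ _ fin_e24) (gen_dil _ _ 3) //; [apply: gen_ext => i //|exact: (fin_inj _ neg_inj _ fin_e24)].
  by have := triZ_double (3 * i - 1); rewrite /e24; lia.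
rewrite [X in _ + X + _](_ : _ = q ^ 2 * dil 18 Th); last first.
  have f9 : fin (fun i => Z.of_nat 18 * T i)%Z by apply: fin_scale fin_T.
  have p9 i : (0 <= Z.of_nat 18 * T i)%Z by have := T_pos i; lia.
  rewrite /Th (gen_dil _ _ 18) //; last exact: fin_T.
  rewrite gen_shift //; last by apply: fin_shift.
  by apply: gen_ext => i //; have := triZ_double (3 * i + 1); have := triZ_double i; lia.
by ring.
Qed.

Lemma theta_sq_dissect : theta_sq = dil 9 theta_sq + cst 2 * q * dil 3 theta15.
Proof.
rewrite {1}/theta_sq (gen_mod3 _ _ fin_esq).
have fs : fin (fun i => Z.of_nat 3 * e15 i)%Z by apply: fin_scale fin_e15.
have ps i : (0 <= Z.of_nat 3 * e15 i)%Z by have := e15_pos i; lia.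
have F : q ^ 1 * dil 3 theta15 = gen (fun i => 1 + 3 * e15 i)%Z unit_wt.
  rewrite /theta15 (gen_dil _ _ 3) //; last exact: fin_e15.
  by rewrite gen_shift //; apply: fin_shift.
rewrite [X in X + _ + _](_ : _ = dil 9 theta_sq); last first.
  rewrite /theta_sq (gen_dil _ _ 9) //; [apply: gen_ext => i //|exact: fin_esq].
  by rewrite /esq; lia.
rewrite [X in _ + _ + X](_ : _ = q ^ 1 * dil 3 theta15); last first.
  have fF : fin (fun i => 1 + 3 * e15 i)%Z by apply: (fin_shift (fun i => Z.of_nat 3 * e15 i)%Z 1 fs _ ps).
  rewrite F (gen_neg _ _ fF).
  by apply: gen_ext => i //; rewrite /esq /e15; lia.
rewrite [X in _ + X + _](_ : _ = q ^ 1 * dil 3 theta15); last first.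
  by rewrite F; apply: gen_ext => i //; rewrite /esq /e15; lia.
by ring.
Qed.

(** Rotation by 45 degrees turns a sum of two pentagonal exponents into a sum of
    two forms in separate variables. Its image has index 2, and rot1 covers the
    other coset. *)
Definition rot0 (x : Z * Z) : Z * Z := (x.1 + x.2, x.1 - x.2)%Z.
Definition rot1 (x : Z * Z) : Z * Z := (x.1 + x.2 + 1, x.1 - x.2)%Z.
Lemma rot_inj : injective (case2 rot0 rot1).
Proof.
by move=> [[a b]|[a b]] [[c d]|[c d]]; rewrite /case2 /rot0 /rot1 => -[/= H1 H2]; repeat f_equal; try lia; exfalso; lia.
Qed.
Lemma rot_sur x : exists s, case2 rot0 rot1 s = x.
Proof.
case: x => i j; have D := Z_div_mod_eq_full (i + j) 2; have M := Z.mod_pos_bound (i + j) 2 ltac:(lia).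
have : ((i + j) mod 2 = 0 \/ (i + j) mod 2 = 1)%Z by lia.
by move=> [H|H]; [exists (inl ((i + j) / 2, (i + j) / 2 - j)%Z)|exists (inr ((i + j) / 2, (i + j) / 2 - j)%Z)];
  rewrite /case2 /rot0 /rot1 /=; f_equal; lia.
Qed.

(** The terms of the pentagonal series with index congruent to r modulo 3. *)
Definition euler_class (r : Z) : ser := gen (fun i => pent (3 * i + r)) (fun i => sgnZ (3 * i + r)).
Lemma aff_inj r : injective (fun i => 3 * i + r)%Z. Proof. by move=> i j; lia. Qed.
Lemma fin_pent3 r : fin (fun i => pent (3 * i + r)). Proof. exact: fin_inj _ (aff_inj r) _ fin_pent. Qed.
Lemma aff15_inj r : injective (fun i => -2 - (3 * i + r))%Z. Proof. by move=> i j; lia. Qed.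

(** Both indices lie in the same class modulo 3, so after the rotation the first variable
    remains in a fixed class while the second is divisible by 3; summing over the
    classes will then make the first variable unrestricted. *)
Lemma euler_class_sq r : euler_class r ^ 2 =
  gen (fun i => e24 (3 * i + r)) unit_wt * dil 27 theta_sq
  - q ^ 7 * (gen (fun i => e15 (-2 - (3 * i + r))) unit_wt * dil 54 Th).
Proof.
have -> : euler_class r ^ 2 = euler_class r * euler_class r by ring.
have pp i : (0 <= pent (3 * i + r))%Z by apply: pent_pos.
rewrite gen_mul //; try exact: fin_pent3.
have f2 : fin (fun x : Z * Z => pent (3 * x.1 + r) + pent (3 * x.2 + r))%Z.
  by apply: (fin_prod (fun i => pent (3 * i + r)) (fun i => pent (3 * i + r))) => //; exact: fin_pent3.
rewrite (gen_split2 _ _ _ _ f2 rot_inj rot_sur).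
have f24' : fin (fun i => e24 (3 * i + r)) by exact: fin_inj _ (aff_inj r) _ fin_e24.
have f15' : fin (fun i => e15 (-2 - (3 * i + r))) by exact: fin_inj _ (aff15_inj r) _ fin_e15.
have fsq : fin (fun i => Z.of_nat 27 * esq i)%Z by apply: fin_scale fin_esq.
have fT : fin (fun i => Z.of_nat 54 * T i)%Z by apply: fin_scale fin_T.
have psq i : (0 <= Z.of_nat 27 * esq i)%Z by have := esq_pos i; lia.
have pT i : (0 <= Z.of_nat 54 * T i)%Z by have := T_pos i; lia.
have p24 i : (0 <= e24 (3 * i + r))%Z by apply: e24_pos.
have p15 i : (0 <= e15 (-2 - (3 * i + r)))%Z by apply: e15_pos.
rewrite /theta_sq /Th (gen_dil _ _ 27) ?(gen_dil _ _ 54) //; try exact: fin_esq; try exact: fin_T.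
rewrite !gen_mul //.
have f3 := fin_prod _ _ f15' fT p15 pT.
rewrite gen_shift //; last 2 first.
- by move=> x; have := p15 x.1; have := pT x.2; lia.
- by apply: fin_shift => // x; have := p15 x.1; have := pT x.2; lia.
have -> : forall X Y, X - Y = X + cst (-1) * Y by move=> X Y; ring.
rewrite -gen_scale; congr Ser.add; apply: gen_ext => -[l m]; rewrite /rot0 /rot1 /unit_wt; cbn [fst snd].
- by have := pent_double (3 * (l + m) + r); have := pent_double (3 * (l - m) + r); rewrite /e24 /esq; nia.
- rewrite -sgnZD. have -> : (3 * (l + m) + r + (3 * (l - m) + r) = 2 * (3 * l + r))%Z by ring.
  by rewrite sgnZ_even.
- by have := pent_double (3 * (l + m + 1) + r); have := pent_double (3 * (l - m) + r); have := triZ_double m; rewrite /e15; nia.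
- rewrite -sgnZD. have -> : (3 * (l + m + 1) + r + (3 * (l - m) + r) = 2 * (3 * l + r + 1) + 1)%Z by ring.
  by rewrite sgnZS sgnZ_even.
Qed.

(** The same rotation, with no restriction on the indices. *)
Lemma euler_sq : E ^ 2 = dil 3 theta_sq * theta24 - q * (theta15 * dil 6 Th).
Proof.
have -> : E ^ 2 = E * E by ring.
have pp := pent_pos; have fp := fin_pent.
rewrite pentagonal_number_theorem (gen_mul _ _ _ _ fp fp pp pp).
rewrite (gen_split2 _ _ _ _ (fin_prod _ _ fp fp pp pp) rot_inj rot_sur).
have fsq : fin (fun i => Z.of_nat 3 * esq i)%Z by apply: fin_scale fin_esq.
have fT : fin (fun i => Z.of_nat 6 * T i)%Z by apply: fin_scale fin_T.
have psq i : (0 <= Z.of_nat 3 * esq i)%Z by have := esq_pos i; lia.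
have pT i : (0 <= Z.of_nat 6 * T i)%Z by have := T_pos i; lia.
rewrite (Ser.mulC (dil 3 theta_sq)) /theta_sq /Th (gen_dil _ _ 3) ?(gen_dil _ _ 6) //; try exact: fin_esq; try exact: fin_T.
rewrite [theta24 * _](gen_mul _ _ _ _ fin_e24 fsq e24_pos psq) /theta15.
have -> : gen e15 unit_wt = gen (fun i => e15 (-1 - i)%Z) unit_wt by exact: (gen_refl e15 unit_wt fin_e15).
have f15a : fin (fun i => e15 (-1 - i)%Z) by exact: (fin_inj _ refl_inj _ fin_e15).
have p15a i : (0 <= e15 (-1 - i))%Z by apply: e15_pos.
rewrite (gen_mul _ _ _ _ f15a fT p15a pT).
have f3 := fin_prod _ _ f15a fT p15a pT.
have -> : forall X Y, X - q * Y = X + cst (-1) * (q ^ 1 * Y) by move=> X Y; ring.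
rewrite gen_shift //; last 2 first.
- by move=> x; have := p15a x.1; have := pT x.2; lia.
- by apply: fin_shift => // x; have := p15a x.1; have := pT x.2; lia.
rewrite -gen_scale; congr Ser.add; apply: gen_ext => -[l m]; rewrite /rot0 /rot1 /unit_wt; cbn [fst snd].
- by have := pent_double (l + m); have := pent_double (l - m); rewrite /e24 /esq; nia.
- rewrite -sgnZD; have -> : (l + m + (l - m) = 2 * l)%Z by ring.
  by rewrite sgnZ_even.
- by have := pent_double (l + m + 1); have := pent_double (l - m); have := triZ_double m; rewrite /e15; nia.
- rewrite -sgnZD; have -> : (l + m + 1 + (l - m) = 2 * l + 1)%Z by ring.
  by rewrite sgnZS sgnZ_even.
Qed.

Lemma euler_classes : E = euler_class 0 + euler_class 1 + euler_class (-1).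
Proof.
rewrite pentagonal_number_theorem (gen_mod3 _ _ fin_pent) /euler_class; congr (_ + _ + _)%ser; apply: gen_ext => i //=;
  by rewrite ?Z.add_0_r.
Qed.

Lemma euler_class_dil r s (P0 : Z -> Z) : (forall i, pent (3 * i + r) = Z.of_nat s + 3 * P0 i)%Z ->
  (forall i, (0 <= P0 i)%Z) -> fin P0 ->
  euler_class r = q ^ s * dil 3 (gen P0 (fun i => sgnZ (3 * i + r))).
Proof.
move=> H P0_pos f0; rewrite (gen_dil _ _ 3) //.
have f3 : fin (fun i => Z.of_nat 3 * P0 i)%Z by apply: fin_scale.
have p3 i : (0 <= Z.of_nat 3 * P0 i)%Z by have := P0_pos i; lia.
rewrite gen_shift //; last by apply: fin_shift => //; lia.
by apply: gen_ext => i //; rewrite H.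
Qed.

(** The exponents (pent(3i) - 0)/3, (pent(3i-1) - 1)/3 and (pent(3i+1) - 2)/3 of the three
    sections of E. *)
Definition expo0 (i : Z) : Z := ((9 * i * i + i) / 2)%Z.
Definition expo1 (i : Z) : Z := ((9 * i * i - 5 * i) / 2)%Z.
Definition expo2 (i : Z) : Z := ((9 * i * i + 7 * i) / 2)%Z.
Lemma half_eq a b : (a = 2 * b -> a / 2 = b)%Z.
Proof. by move=> ->; rewrite Z.mul_comm Z.div_mul. Qed.
Lemma expo0E i : (2 * expo0 i = 9 * i * i + i)%Z.
Proof. by rewrite /expo0 (half_eq _ (T i + 4 * i * i)); have := triZ_double i; lia. Qed.
Lemma expo1E i : (2 * expo1 i = 9 * i * i - 5 * i)%Z.
Proof. by rewrite /expo1 (half_eq _ (T i + 4 * i * i - 3 * i)); have := triZ_double i; lia. Qed.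
Lemma expo2E i : (2 * expo2 i = 9 * i * i + 7 * i)%Z.
Proof. by rewrite /expo2 (half_eq _ (T i + 4 * i * i + 3 * i)); have := triZ_double i; lia. Qed.

(** Squares that serve as hints to nia, separately on either side of 0. *)
Ltac sq_nia i := have := Z.square_nonneg i; have := Z.square_nonneg (i - 1);
  have := Z.square_nonneg (i + 1); case: (Z.le_gt_cases i 0) => h; nia.

(** The classes of the index modulo 3 are the classes of the exponent modulo 3: pent
    takes the residues 0, 2, 1 at 0, 1, -1. *)
Lemma euler_class_sec : (euler_class 0 = dil 3 (sec 0 E)) * (euler_class (-1) = q * dil 3 (sec 1 E)) *
   (euler_class 1 = q ^ 2 * dil 3 (sec 2 E)).
Proof.
have a0 : euler_class 0 = q ^ 0 * dil 3 (gen expo0 (fun i => sgnZ (3 * i + 0))).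
  apply: euler_class_dil => [i|i|]; first by have := pent_double (3 * i + 0); have := expo0E i; lia.
    by have := expo0E i; sq_nia i.
  by apply: fin_Z => i; have := expo0E i; sq_nia i.
have a1 : euler_class (-1) = q ^ 1 * dil 3 (gen expo1 (fun i => sgnZ (3 * i + -1))).
  apply: euler_class_dil => [i|i|]; first by have := pent_double (3 * i + -1); have := expo1E i; lia.
    by have := expo1E i; sq_nia i.
  by apply: fin_Z => i; have := expo1E i; sq_nia i.
have a2 : euler_class 1 = q ^ 2 * dil 3 (gen expo2 (fun i => sgnZ (3 * i + 1))).
  apply: euler_class_dil => [i|i|]; first by have := pent_double (3 * i + 1); have := expo2E i; lia.
    by have := expo2E i; sq_nia i.
  by apply: fin_Z => i; have := expo2E i; sq_nia i.
move: a0 a1 a2; set x0 := gen expo0 _; set x1 := gen expo1 _; set x2 := gen expo2 _ => a0 a1 a2.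
have EE : E = mix x0 x1 x2 by rewrite euler_classes a0 a1 a2 /mix; ring.
by rewrite EE !sec_mix a0 a1 a2; repeat split; ring.
Qed.

(** As the class of the exponent is the class of the index, this is the sum over pairs
    of indices congruent modulo 3. *)
Definition class_squares : ser := dil 3 (sec 0 E) ^ 2 + (q * dil 3 (sec 1 E)) ^ 2 + (q ^ 2 * dil 3 (sec 2 E)) ^ 2.

Lemma class_squares_theta : class_squares = dil 27 theta_sq * theta24 - q ^ 7 * (theta15 * dil 54 Th).
Proof.
have [[a0 a1] a2] := euler_class_sec.
rewrite /class_squares -a0 -a1 -a2 !euler_class_sq.
have -> : theta24 = gen (fun i => e24 (3 * i + 0)) unit_wt + gen (fun i => e24 (3 * i + 1)) unit_wt + gen (fun i => e24 (3 * i + -1)) unit_wt.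
  rewrite /theta24 (gen_mod3 _ _ fin_e24); congr (_ + _ + _)%ser; apply: gen_ext => i //=; by rewrite ?Z.add_0_r.
have -> : theta15 = gen (fun i => e15 (-2 - (3 * i + 0))) unit_wt + gen (fun i => e15 (-2 - (3 * i + 1))) unit_wt + gen (fun i => e15 (-2 - (3 * i + -1))) unit_wt.
  have inj : injective (fun i => -2 - i)%Z by move=> i j; lia.
  rewrite /theta15 (gen_inj _ inj _ _ fin_e15); last by move=> i _; exists (-2 - i)%Z; lia.
  rewrite (gen_mod3 (fun i => e15 (-2 - i))); last exact: (fin_inj _ inj _ fin_e15).
  congr (_ + _ + _)%ser; apply: gen_ext => i //=; by rewrite ?Z.add_0_r.
by ring.
Qed.

(** Dissecting Theta(q^6) and theta_sq(q^3) expresses all terms through the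
    same six theta series, and the relation becomes a polynomial identity, in
    which the mixed terms cancel as in a Wronskian. *)
Lemma class_squares_rel : dil 6 Th * class_squares = cst 2 * theta24 * dil 9 E ^ 2 + q ^ 6 * dil 54 Th * E ^ 2.
Proof.
have h1 : dil 9 E ^ 2 = dil 27 theta_sq * dil 9 theta24 - q ^ 9 * (dil 9 theta15 * dil 54 Th).
  by rewrite -dil_pow // euler_sq dil_sub // dil_var_mul // !dil_mul // !dil_comp.
have h2 : dil 6 Th = cst 2 * dil 9 theta24 + q ^ 6 * dil 54 Th.
  have := f_equal (dil 3) theta_tri_dissect; rewrite dil_add // dil_cst_mul // dil_varpow_mul // !dil_comp //; cbv [muln Nat.mul Nat.add] => ->; ring.
have h3 : dil 3 theta_sq = dil 27 theta_sq + cst 2 * q ^ 3 * dil 9 theta15.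
  have := f_equal (dil 3) theta_sq_dissect; have -> : cst 2 * q * dil 3 theta15 = cst 2 * (q ^ 1 * dil 3 theta15) by ring.
  rewrite dil_add // dil_cst_mul // dil_varpow_mul // !dil_comp //; cbv [muln Nat.mul Nat.add] => ->; ring.
by rewrite class_squares_theta h1 euler_sq h3 h2; ring.
Qed.

(** * Lattices of rank 2, 3 and 6 *)

Definition eT3 (u : Z * Z * Z) : Z := (T u.1.1 + T u.1.2 + T u.2)%Z.
Definition s3 (u : Z * Z * Z) : Z := (u.1.1 + u.1.2 + u.2)%Z.
(** The norm form of the hexagonal lattice; 3 eC + 1 is its restriction to a nontrivial
    coset of the sublattice of index 3. *)
Definition eA (x : Z * Z) : Z := (x.1 * x.1 + x.1 * x.2 + x.2 * x.2)%Z.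
Definition eC (x : Z * Z) : Z := (x.1 * x.1 + x.1 * x.2 + x.2 * x.2 + x.1 + x.2)%Z.
Definition hex : ser := gen eA unit_wt.
Definition hexc : ser := gen eC unit_wt.

Lemma T2_fin : fin (fun x : Z * Z => T x.1 + T x.2)%Z.
Proof. exact: fin_prod fin_T fin_T T_pos T_pos. Qed.
Lemma T2_pos (x : Z * Z) : (0 <= T x.1 + T x.2)%Z.
Proof. by have := T_pos x.1; have := T_pos x.2; lia. Qed.
Lemma eT3_fin : fin eT3.
Proof. exact: (fin_prod (fun x : Z * Z => T x.1 + T x.2)%Z T T2_fin fin_T T2_pos T_pos). Qed.
Lemma eT3_pos u : (0 <= eT3 u)%Z.
Proof. by rewrite /eT3; have := T_pos u.1.1; have := T_pos u.1.2; have := T_pos u.2; lia. Qed.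

(** The parts of Z^3 with coordinate sum 0, -1 and -2 modulo 3. The coordinates are
    chosen so that the exponent splits into a hexagonal form in u.1 and a form in u.2,
    the coordinate along (1,1,1). *)
Definition m0 (u : Z * Z * Z) : Z * Z * Z := (u.1.1 + u.2, u.1.2 + u.2, u.2 - u.1.1 - u.1.2)%Z.
Definition m1 (u : Z * Z * Z) : Z * Z * Z := (u.1.1 + u.2, u.1.2 + u.2, u.2 - 1 - u.1.1 - u.1.2)%Z.
Definition m2 (u : Z * Z * Z) : Z * Z * Z :=
  (- u.2 - 1 - u.1.1, - u.2 - 1 - u.1.2, - u.2 + u.1.1 + u.1.2)%Z.

Ltac inj3 := move=> [[a b] c] [[a' b'] c'] [/= H1 H2 H3]; repeat f_equal; lia.
Lemma m0_inj : injective m0. Proof. by inj3. Qed.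
Lemma m1_inj : injective m1. Proof. by inj3. Qed.
Lemma m2_inj : injective m2. Proof. by inj3. Qed.

Lemma eT3_m0 u : eT3 (m0 u) = (eA u.1 + 3 * T u.2)%Z.
Proof.
case: u => [[x y] k]; rewrite /eT3 /m0 /eA; cbn [fst snd].
have := triZ_double (x + k); have := triZ_double (y + k); have := triZ_double (k - x - y); have := triZ_double k; lia.
Qed.
Lemma eT3_m1 u : eT3 (m1 u) = (eC u.1 + pent u.2)%Z.
Proof.
case: u => [[x y] k]; rewrite /eT3 /m1 /eC; cbn [fst snd].
have := triZ_double (x + k); have := triZ_double (y + k); have := triZ_double (k - 1 - x - y); have := pent_double k; lia.
Qed.
Lemma eT3_m2 u : eT3 (m2 u) = (eC u.1 + pent u.2)%Z.
Proof.
case: u => [[x y] k]; rewrite /eT3 /m2 /eC; cbn [fst snd].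
have := triZ_double (- k - 1 - x); have := triZ_double (- k - 1 - y); have := triZ_double (- k + x + y); have := pent_double k; lia.
Qed.
Lemma s3_m0 u : s3 (m0 u) = (3 * u.2)%Z. Proof. by rewrite /s3 /m0; cbn [fst snd]; lia. Qed.
Lemma s3_m1 u : s3 (m1 u) = (3 * u.2 - 1)%Z. Proof. by rewrite /s3 /m1; cbn [fst snd]; lia. Qed.
Lemma s3_m2 u : s3 (m2 u) = (- 3 * u.2 - 2)%Z. Proof. by rewrite /s3 /m2; cbn [fst snd]; lia. Qed.

Lemma m_inj : injective (case2 m0 (case2 m1 m2)).
Proof.
have K (x y : Z * Z * Z) : x = y -> s3 x = s3 y by move=> ->.
move=> [u|[u|u]] [v|[v|v]]; rewrite /case2 => H;
 first [by rewrite (m0_inj _ _ H)|by rewrite (m1_inj _ _ H)|by rewrite (m2_inj _ _ H)|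
   by move/K: H; rewrite ?s3_m0 ?s3_m1 ?s3_m2; lia].
Qed.
Lemma m0_sur w k : s3 w = (3 * k)%Z -> exists x, m0 (x, k) = w.
Proof.
case: w => [[x y] z]; rewrite /s3 /m0; cbn [fst snd] => H.
by exists (x - k, y - k)%Z; cbn [fst snd]; repeat f_equal; lia.
Qed.
Lemma m1_sur w k : s3 w = (3 * k - 1)%Z -> exists x, m1 (x, k) = w.
Proof.
case: w => [[x y] z]; rewrite /s3 /m1; cbn [fst snd] => H.
by exists (x - k, y - k)%Z; cbn [fst snd]; repeat f_equal; lia.
Qed.
Lemma m2_sur w k : s3 w = (- 3 * k - 2)%Z -> exists x, m2 (x, k) = w.
Proof.
case: w => [[x y] z]; rewrite /s3 /m2; cbn [fst snd] => H.
by exists (- k - 1 - x, - k - 1 - y)%Z; cbn [fst snd]; repeat f_equal; lia.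
Qed.
Lemma m_sur w : exists s, case2 m0 (case2 m1 m2) s = w.
Proof.
have D := Z_div_mod_eq_full (s3 w) 3; have M := Z.mod_pos_bound (s3 w) 3 ltac:(lia).
have : (s3 w mod 3 = 0 \/ s3 w mod 3 = 1 \/ s3 w mod 3 = 2)%Z by lia.
move=> [H|[H|H]].
- by have [|x Hx] := m0_sur w (s3 w / 3)%Z; [lia|exists (inl (x, s3 w / 3)%Z)].
- by have [|x Hx] := m2_sur w (- (s3 w / 3) - 1)%Z; [lia|exists (inr (inr (x, - (s3 w / 3) - 1)%Z))].
- by have [|x Hx] := m1_sur w (s3 w / 3 + 1)%Z; [lia|exists (inr (inl (x, s3 w / 3 + 1)%Z))].
Qed.

Lemma eA_pos x : (0 <= eA x)%Z. Proof. by rewrite /eA; nia. Qed.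
Lemma eC_pos x : (0 <= eC x)%Z.
Proof. by have := eT3_m1 (x, 0%Z); have := eT3_pos (m1 (x, 0%Z)); cbn [fst snd]; have := pent_double 0; lia. Qed.
Lemma eA_fin : fin eA.
Proof.
have inj : injective (fun x : Z * Z => m0 (x, 0%Z)) by move=> x y /m0_inj [].
apply: (fin_ext _ _ _ (fin_inj _ inj _ eT3_fin)) => x.
by rewrite eT3_m0; cbn [fst snd]; have := triZ_double 0; lia.
Qed.
Lemma eC_fin : fin eC.
Proof.
have inj : injective (fun x : Z * Z => m1 (x, 0%Z)) by move=> x y /m1_inj [].
apply: (fin_ext _ _ _ (fin_inj _ inj _ eT3_fin)) => x.
by rewrite eT3_m1; cbn [fst snd]; have := pent_double 0; lia.
Qed.

(** The terms of index j and -1-j cancel. *)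
Lemma alternating_tri0 : gen T sgnZ = cst 0.
Proof.
apply: (cst_cancel 2) => //.
have H : gen T sgnZ = cst (-1) * gen T sgnZ.
  rewrite {1}(gen_refl T sgnZ fin_T) -gen_scale; apply: gen_ext => i.
    by have := triZ_double (-1 - i); have := triZ_double i; lia.
  have -> : (-1 - i = - (i + 1))%Z by lia.
  by rewrite sgnZN sgnZS; lia.
have -> : cst 2 * gen T sgnZ = gen T sgnZ + gen T sgnZ by ring.
by rewrite {1}H; ring.
Qed.

(** With weight (-1)^s (2s + 3), s the coordinate sum, the sum of q^(T(x)+T(y)+T(z)) over
    Z^3 is three times the product of the series of Jacobi for E^3 and two copies of
    alternating_tri0, hence zero: the derivative of theta^3 at a zero of theta.
    Splitting by s modulo 3 turns this vanishing into the identity. *)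
Lemma theta_cube_derivative : cst 3 * dil 3 E ^ 3 * hex = hexc * Gs.
Proof.
set c := fun u : Z * Z * Z => (sgnZ (s3 u) * (2 * s3 u + 3))%Z.
have Z0 : gen eT3 c = cst 0.
  set d := fun j => (sgnZ j * (2 * j + 1))%Z.
  have A : gen eT3 (fun u : Z * Z * Z => (d u.1.1 * sgnZ u.1.2) * sgnZ u.2)%Z = cst 0.
    rewrite -(gen_mul (fun x : Z * Z => T x.1 + T x.2)%Z (fun x : Z * Z => d x.1 * sgnZ x.2)%Z T sgnZ) ?alternating_tri0;
     [by ring|exact: T2_fin|exact: fin_T|exact: T2_pos|exact: T_pos].
  have B : gen eT3 (fun u : Z * Z * Z => (sgnZ u.1.1 * d u.1.2) * sgnZ u.2)%Z = cst 0.
    rewrite -(gen_mul (fun x : Z * Z => T x.1 + T x.2)%Z (fun x : Z * Z => sgnZ x.1 * d x.2)%Z T sgnZ) ?alternating_tri0;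
     [by ring|exact: T2_fin|exact: fin_T|exact: T2_pos|exact: T_pos].
  have C : gen eT3 (fun u : Z * Z * Z => (sgnZ u.1.1 * sgnZ u.1.2) * d u.2)%Z = cst 0.
    rewrite -(gen_mul (fun x : Z * Z => T x.1 + T x.2)%Z (fun x : Z * Z => sgnZ x.1 * sgnZ x.2)%Z T d).
    - rewrite -(gen_mul T sgnZ T sgnZ); [|exact: fin_T|exact: fin_T|exact: T_pos|exact: T_pos].
      by rewrite alternating_tri0; ring.
    - exact: T2_fin. - exact: fin_T. - exact: T2_pos. - exact: T_pos.
  have -> : gen eT3 c = gen eT3 (fun u : Z * Z * Z => (d u.1.1 * sgnZ u.1.2) * sgnZ u.2)%Z
     + gen eT3 (fun u : Z * Z * Z => (sgnZ u.1.1 * d u.1.2) * sgnZ u.2)%Z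
     + gen eT3 (fun u : Z * Z * Z => (sgnZ u.1.1 * sgnZ u.1.2) * d u.2)%Z.
    by rewrite !gen_add; apply: gen_ext => // -[[x y] z]; rewrite /c /d /s3; cbn [fst snd]; rewrite !sgnZD; ring.
  by rewrite A B C; ring.
move: Z0; rewrite (gen_split3 _ _ _ _ _ eT3_fin m_inj m_sur).
have f3T : fin (fun k => Z.of_nat 3 * T k)%Z by apply: fin_scale fin_T.
have p3T k : (0 <= Z.of_nat 3 * T k)%Z by have := T_pos k; lia.
rewrite [X in X + _ + _](_ : _ = hex * (cst 3 * dil 3 (cst 2 * E ^ 3))); last first.
  rewrite jacobi_cube_identity (gen_dil _ _ 3) //; last exact: fin_T.
  rewrite -gen_scale gen_mul; [|exact: eA_fin|exact: f3T|exact: eA_pos|exact: p3T].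
  apply: gen_ext => u; first by rewrite eT3_m0.
  rewrite /c s3_m0 /unit_wt; have -> : sgnZ (3 * u.2) = sgnZ u.2.
    have -> : (3 * u.2 = 2 * u.2 + u.2)%Z by lia.
    by rewrite sgnZD sgnZ_even; lia.
  by case: u => -[x y] k; cbn [fst snd]; move: (sgnZ k) => z; ring.
rewrite [X in _ + X + _](_ : _ = hexc * (cst (-1) * Gs)); last first.
  rewrite -gen_scale gen_mul; [|exact: eC_fin|exact: fin_pent|exact: eC_pos|exact: pent_pos].
  apply: gen_ext => u; first by rewrite eT3_m1.
  rewrite /c s3_m1 /unit_wt; have -> : sgnZ (3 * u.2 - 1) = (- sgnZ u.2)%Z.
    have -> : (3 * u.2 - 1 = 2 * (u.2 - 1) + (u.2 + 1))%Z by lia.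
    by rewrite sgnZD sgnZ_even sgnZS; lia.
  by case: u => -[x y] k; cbn [fst snd]; move: (sgnZ k) => z; ring.
rewrite [X in _ + X](_ : _ = hexc * (cst (-1) * Gs)); last first.
  rewrite -gen_scale gen_mul; [|exact: eC_fin|exact: fin_pent|exact: eC_pos|exact: pent_pos].
  apply: gen_ext => u; first by rewrite eT3_m2.
  rewrite /c s3_m2 /unit_wt; have -> : sgnZ (-3 * u.2 - 2) = sgnZ u.2.
    have -> : (-3 * u.2 - 2 = 2 * (- u.2 - 1) + - u.2)%Z by lia.
    by rewrite sgnZD sgnZ_even sgnZN; lia.
  by case: u => -[x y] k; cbn [fst snd]; move: (sgnZ k) => z; ring.
rewrite dil_cst_mul // dil_pow // => H.
apply: (cst_cancel 2) => //.
have -> : cst 2 * (cst 3 * dil 3 E ^ 3 * hex) = (hex * (cst 3 * (cst 2 * dil 3 E ^ 3)) + hexc * (cst (-1) * Gs) + hexc * (cst (-1) * Gs)) + cst 2 * (hexc * Gs) by ring.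
by rewrite H; ring.
Qed.

(** The sublattice of index 3, similar to the lattice itself, and its two other cosets. *)
Definition h0 (x : Z * Z) : Z * Z := (x.1 + 2 * x.2, x.1 - x.2)%Z.
Definition h1 (x : Z * Z) : Z * Z := (x.1 + 2 * x.2 + 1, x.1 - x.2)%Z.
Definition h2 (x : Z * Z) : Z * Z := (x.1 - x.2, x.1 + 2 * x.2 + 1)%Z.
Lemma h_inj : injective (case2 h0 (case2 h1 h2)).
Proof.
by move=> [[a b]|[[a b]|[a b]]] [[c d]|[[c d]|[c d]]]; rewrite /case2 /h0 /h1 /h2; cbn [fst snd] => H;
  have H1 := f_equal fst H; have H2 := f_equal snd H; cbn [fst snd] in H1, H2;
  repeat f_equal; try lia; exfalso; lia.
Qed.
Lemma h_sur x : exists s, case2 h0 (case2 h1 h2) s = x.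
Proof.
case: x => i j; have D := Z_div_mod_eq_full (i - j) 3; have M := Z.mod_pos_bound (i - j) 3 ltac:(lia).
have : ((i - j) mod 3 = 0 \/ (i - j) mod 3 = 1 \/ (i - j) mod 3 = 2)%Z by lia.
set v := ((i - j) / 3)%Z in D *.
move=> [H|[H|H]]; [exists (inl (j + v, v)%Z)|exists (inr (inl (j + v, v)%Z))|exists (inr (inr (i - v - 1, - v - 1)%Z))];
  rewrite /case2 /h0 /h1 /h2; cbn [fst snd]; f_equal; lia.
Qed.

Lemma hex_dissect : hex = dil 3 hex + cst 2 * q * dil 3 hexc.
Proof.
rewrite {1}/hex (gen_split3 _ _ _ _ _ eA_fin h_inj h_sur).
have fC : fin (fun x => Z.of_nat 3 * eC x)%Z by apply: fin_scale eC_fin.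
have pC x : (0 <= Z.of_nat 3 * eC x)%Z by have := eC_pos x; lia.
have F : q ^ 1 * dil 3 hexc = gen (fun x => Z.of_nat 1 + Z.of_nat 3 * eC x)%Z unit_wt.
  rewrite /hexc (gen_dil _ _ 3) //; last exact: eC_fin.
  by rewrite gen_shift //; apply: fin_shift.
rewrite [X in X + _ + _](_ : _ = dil 3 hex); last first.
  rewrite /hex (gen_dil _ _ 3) //; last exact: eA_fin.
  by apply: gen_ext => -[x y] //; rewrite /eA /h0; cbn [fst snd]; lia.
rewrite [X in _ + X + _](_ : _ = q ^ 1 * dil 3 hexc); last first.
  by rewrite F; apply: gen_ext => -[x y] //; rewrite /eA /eC /h1; cbn [fst snd]; lia.
rewrite [X in _ + X](_ : _ = q ^ 1 * dil 3 hexc); last first.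
  by rewrite F; apply: gen_ext => -[x y] //; rewrite /eA /eC /h2; cbn [fst snd]; lia.
by ring.
Qed.

Definition e6 (x : (Z * Z * Z) * (Z * Z * Z)) : Z := (eT3 x.1 + eT3 x.2)%Z.
Definition s6 (x : (Z * Z * Z) * (Z * Z * Z)) : Z := (s3 x.1 + s3 x.2)%Z.
(** The coefficient of zeta^(-3) in the sixth power of the sum of q^T(j) zeta^j; the
    shift by 3 is due to the half-integral exponents in theta. *)
Definition numer6 : ser := gen e6 (fun x => if s6 x == (-3)%Z then 1%Z else 0%Z).

Lemma e6_fin : fin e6. Proof. exact: fin_prod eT3_fin eT3_fin eT3_pos eT3_pos. Qed.

Definition fst_map (f : Z * Z * Z -> Z * Z * Z) (x : (Z * Z * Z) * (Z * Z * Z)) := (f x.1, x.2).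

(** The condition on the total coordinate sum picks, for each u, the vectors h (y, kap u.2);
    reindexing by the pairs (u, y) absorbs it. *)
Lemma numer6_part (f h : Z * Z * Z -> Z * Z * Z) (kap : Z -> Z) (e : (Z * Z * Z) * (Z * Z) -> Z) :
  injective f -> injective h ->
  (forall u w, (s3 (f u) + s3 w = -3)%Z -> exists x, h (x, kap u.2) = w) ->
  (forall u y, s3 (f u) + s3 (h (y, kap u.2)) = -3)%Z ->
  (forall u y, eT3 (f u) + eT3 (h (y, kap u.2)) = e (u, y))%Z ->
  gen (fun x => e6 (fst_map f x)) (fun x => if s6 (fst_map f x) == (-3)%Z then 1%Z else 0%Z) = gen e unit_wt.
Proof.
move=> fi hi sur hs he.
have j1 : injective (fun x : (Z * Z * Z) * (Z * Z) => (x.1, h (x.2, kap x.1.2))).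
  by move=> [u x] [v y]; cbn [fst snd] => /[dup] /(f_equal fst) + /(f_equal snd); cbn [fst snd] => -> /hi [->].
have ff : fin (fun x => e6 (fst_map f x)).
  by apply: (fin_inj _ _ _ e6_fin) => -[u u'] [v v'] /[dup] /(f_equal fst) + /(f_equal snd); rewrite /fst_map; cbn [fst snd] => /fi -> ->.
rewrite (gen_inj _ j1 _ _ ff); last first.
  move=> [u w]; rewrite /s6 /fst_map; cbn [fst snd]; case: eqP => // /sur [x <-] _.
  by exists (u, x).
by apply: gen_ext => -[u y]; rewrite /e6 /s6 /fst_map /unit_wt; cbn [fst snd]; rewrite ?he ?hs.
Qed.

(** The first triple is split by its coordinate sum modulo 3. The total -3 then forces
    the class and the diagonal coordinate of the second triple, leaving two hexagonal
    sums and one sum over the common diagonal coordinate. *)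
Lemma numer6_lattice : numer6 = dil 6 Th * hex ^ 2 + cst 2 * theta24 * hexc ^ 2.
Proof.
have inj : injective (case2 (fst_map m0) (case2 (fst_map m1) (fst_map m2))).
  move=> [[u u']|[[u u']|[u u']]] [[v v']|[[v v']|[v v']]]; rewrite /case2 /fst_map; cbn [fst snd] => HH;
   have H := f_equal fst HH; have := f_equal snd HH; cbn [fst snd] in H |- * => H'; subst u'.
  - by rewrite (m0_inj _ _ H). - by have := m_inj (inl u) (inr (inl v)) H.
  - by have := m_inj (inl u) (inr (inr v)) H. - by have := m_inj (inr (inl u)) (inl v) H.
  - by rewrite (m1_inj _ _ H). - by have := m_inj (inr (inl u)) (inr (inr v)) H.
  - by have := m_inj (inr (inr u)) (inl v) H. - by have := m_inj (inr (inr u)) (inr (inl v)) H.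
  - by rewrite (m2_inj _ _ H).
have sur x : exists s, case2 (fst_map m0) (case2 (fst_map m1) (fst_map m2)) s = x.
  case: x => u w; case: (m_sur u) => -[v|[v|v]] <-; rewrite /case2 /fst_map.
  - by exists (inl (v, w)). - by exists (inr (inl (v, w))). - by exists (inr (inr (v, w))).
rewrite /numer6 (gen_split3 _ _ _ _ _ e6_fin inj sur).
have f6 : fin (fun k => Z.of_nat 6 * T k)%Z by apply: fin_scale fin_T.
have p6 k : (0 <= Z.of_nat 6 * T k)%Z by have := T_pos k; lia.
have pA x : (0 <= eA x.1 + Z.of_nat 6 * T x.2)%Z by have := eA_pos x.1; have := p6 x.2; lia.
have fA : fin (fun x : (Z * Z) * Z => eA x.1 + Z.of_nat 6 * T x.2)%Z by exact: fin_prod eA_fin f6 eA_pos p6.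
have pC x : (0 <= eC x.1 + e24 x.2)%Z by have := eC_pos x.1; have := e24_pos x.2; lia.
have fC : fin (fun x : (Z * Z) * Z => eC x.1 + e24 x.2)%Z by exact: fin_prod eC_fin fin_e24 eC_pos e24_pos.
have HA : dil 6 Th * hex ^ 2 = gen (fun x : (Z * Z * Z) * (Z * Z) => eA x.1.1 + Z.of_nat 6 * T x.1.2 + eA x.2)%Z unit_wt.
  have -> : dil 6 Th * hex ^ 2 = (hex * dil 6 Th) * hex by ring.
  rewrite /Th (gen_dil _ _ 6) //; last exact: fin_T.
  rewrite (gen_mul _ _ _ _ eA_fin f6 eA_pos p6) (gen_mul _ _ _ _ fA eA_fin pA eA_pos).
  by apply: gen_ext.
have HC : theta24 * hexc ^ 2 = gen (fun x : (Z * Z * Z) * (Z * Z) => eC x.1.1 + e24 x.1.2 + eC x.2)%Z unit_wt.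
  have -> : theta24 * hexc ^ 2 = (hexc * theta24) * hexc by ring.
  rewrite (gen_mul _ _ _ _ eC_fin fin_e24 eC_pos e24_pos) (gen_mul _ _ _ _ fC eC_fin pC eC_pos).
  by apply: gen_ext.
have ->: cst 2 * theta24 * hexc ^ 2 = theta24 * hexc ^ 2 + theta24 * hexc ^ 2 by ring.
have -> : forall X Y, X + (Y + Y) = X + Y + Y by move=> X Y; ring.
rewrite HA HC; congr (_ + _ + _)%ser.
(* The second diagonal coordinate is -1 - k, and 3 T(k) + 3 T(-1-k) = 6 T(k). *)
- apply: (numer6_part m0 m0 (fun k => -1 - k)%Z) m0_inj m0_inj _ _ _ => [[[a b] k] w|u y|[[a b] k] y];
    rewrite ?s3_m0 ?eT3_m0; cbn [fst snd]; try lia.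
    by move=> H; apply: m0_sur; lia.
  by have := triZ_double k; have := triZ_double (-1 - k); lia.
(* Both diagonal coordinates are k, and 2 pent(k) = 3 k^2 + k. *)
- apply: (numer6_part m1 m2 id) m1_inj m2_inj _ _ _ => [[[a b] k] w|u y|[[a b] k] y];
    rewrite ?s3_m1 ?s3_m2 ?eT3_m1 ?eT3_m2; cbn [fst snd]; try lia.
    by move=> H; apply: m2_sur; lia.
  by rewrite /e24; have := pent_double k; lia.
- apply: (numer6_part m2 m1 id) m2_inj m1_inj _ _ _ => [[[a b] k] w|u y|[[a b] k] y];
    rewrite ?s3_m1 ?s3_m2 ?eT3_m1 ?eT3_m2; cbn [fst snd]; try lia.
    by move=> H; apply: m1_sur; lia.
  by rewrite /e24; have := pent_double k; lia.
Qed.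

Lemma hex_coef0 : hex O = 1%Z.
Proof.
rewrite /hex (gen_coef eA unit_wt O [:: (0%Z, 0%Z)] eA_fin) //; first by rewrite big_seq1.
move=> [x y] E _; rewrite inE; apply/eqP; move: E; rewrite /eA; cbn [fst snd] => E.
have := Z.square_nonneg (x + y); have := Z.square_nonneg x; have := Z.square_nonneg y => h1 h2 h3.
have -> : x = 0%Z by nia. have -> // : y = 0%Z by nia.
Qed.

End Lattice.

Module Recursion.
Import Series Lattice.
Local Close Scope C_scope.
Local Open Scope ser_scope.

(** * The cubic theta functions *)

Notation "f [3]" := (dil 3 f) (at level 1, format "f [3]") : ser_scope.

(** The cubic theta function a(q), introduced as a quotient; that it is the theta
    series of the hexagonal lattice is hex_borwein_a. *)
Definition borwein_a : ser := Gs * p.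
Local Notation a := borwein_a.
(** c(q) / (3 q^(1/3)), which unlike c has integral exponents. *)
Definition borwein_k : ser := E[3] ^ 3 * p.
Local Notation k := borwein_k.
Definition borwein_b : ser := E ^ 3 * p[3].
Local Notation b := borwein_b.
Definition borwein_b_inv : ser := E[3] * p ^ 3.
Local Notation ib := borwein_b_inv.
Definition theta_even : ser := cst 2 * theta24.
Local Notation g := theta_even.

Lemma Ep : E * p = cst 1. Proof. exact: euler_partitions. Qed.
Lemma Ep3 : E[3] * p[3] = cst 1. Proof. by rewrite -dil_mul // Ep dil_cst. Qed.
Lemma Ep9 : E[3][3] * p[3][3] = cst 1. Proof. by rewrite -dil_mul // Ep3 dil_cst. Qed.
Lemma b_ib : b * ib = cst 1. Proof. rewrite /b /ib; ring [Ep Ep3]. Qed.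
Lemma dil9 f : dil 9 f = f[3][3]. Proof. by rewrite dil_comp. Qed.

Lemma a3E : a[3] = Gs[3] * p[3]. Proof. by rewrite /a dil_mul. Qed.
Lemma k3E : k[3] = E[3][3] ^ 3 * p[3]. Proof. by rewrite /k dil_mul // dil_pow. Qed.
Lemma b3E : b[3] = E[3] ^ 3 * p[3][3]. Proof. by rewrite /b dil_mul // dil_pow. Qed.
Lemma ib3E : ib[3] = E[3][3] * p[3] ^ 3. Proof. by rewrite /ib dil_mul // dil_pow. Qed.

Lemma b_lin : b = a[3] - cst 3 * q * k[3].
Proof. by rewrite {1}/b jacobi_dissect a3E k3E dil9; ring. Qed.

Lemma sec_E3 : (sec 0 (E ^ 3) = Gs) * (sec 1 (E ^ 3) = cst (-3) * E[3] ^ 3) * (sec 2 (E ^ 3) = cst 0).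
Proof.
have -> : E ^ 3 = mix Gs (cst (-3) * E[3] ^ 3) (cst 0).
  by rewrite jacobi_dissect /mix dil_cst_mul // dil_pow // dil_cst // dil9; ring.
by rewrite !sec_mix.
Qed.

Lemma norm_pow f n : norm (f ^ S n) = norm f ^ S n.
Proof.
elim: n => [|n IH].
  have -> : f ^ 1 = f by ring. by ring.
have -> : f ^ S (S n) = f * f ^ S n by []. by rewrite norm_mul IH.
Qed.

Lemma normE : norm E = E * b.
Proof. rewrite /b; have := norm_euler => e; have -> : norm E = norm E * E[3] * p[3] by ring [Ep3]. rewrite e; ring. Qed.

(** The norm of E^3 in two ways: as the cube of norm E = E b, and from the two nonzero
    sections of E^3. *)
Lemma borwein_cubic : a ^ 3 = b ^ 3 + cst 27 * q * k ^ 3.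
Proof.
have := norm_pow E 2; rewrite normE /norm !sec_E3 /a /k /b => H.
have -> : (Gs * p) ^ 3 = (Gs ^ 3 + q * (cst (-3) * E[3] ^ 3) ^ 3 + q ^ 2 * cst 0 ^ 3 -
     cst 3 * q * (Gs * (cst (-3) * E[3] ^ 3) * cst 0)) * p ^ 3 + cst 27 * q * (E[3] ^ 3 * p) ^ 3 by ring.
rewrite H; ring [Ep].
Qed.

Lemma Gs0 : Gs O = 1%Z.
Proof. by have := f_equal (fun s : ser => s O) (fst (fst sec_E3)). Qed.
Lemma a0 : a O = 1%Z. Proof. by rewrite /a mul_coef0 Gs0. Qed.

Lemma borwein_cubic3 : a[3] ^ 3 = b[3] ^ 3 + cst 27 * q ^ 3 * k[3] ^ 3.
Proof.
have := f_equal (dil 3) borwein_cubic; have -> : cst 27 * q * k ^ 3 = cst 27 * (q ^ 1 * k ^ 3) by ring.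
by rewrite dil_add // dil_cst_mul // dil_varpow_mul // !dil_pow //; cbv [Nat.mul Nat.add] => ->; ring.
Qed.

Lemma cube_inj (f h : ser) : f O = 1%Z -> h O = 1%Z -> f ^ 3 = h ^ 3 -> f = h.
Proof.
move=> f0 h0 e.
have {}e : (f ^ 2 + f * h + h ^ 2) * (f - h) = (f ^ 2 + f * h + h ^ 2) * cst 0.
  transitivity (f ^ 3 - h ^ 3); first by ring.
  by rewrite e; ring.
have -> : f = (f - h) + h by ring.
rewrite (mul_cancel _ _ _ _ e); first by ring.
by rewrite /= !add_coef !mul_coef0 f0 h0.
Qed.

(** Multiplied by b, both sides equal b(q^3)^3 k(q^3): on the right this is the factorisation
    of a(q^3)^3 - c(q^3)^3 by b = a(q^3) - c(q^3). *)
Lemma k_cubic : k ^ 3 = k[3] * (a[3] ^ 2 + cst 3 * q * a[3] * k[3] + cst 9 * q ^ 2 * k[3] ^ 2).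
Proof.
apply: (mul_cancel b); first by [].
have e : b * k ^ 3 = b[3] ^ 3 * k[3].
  by rewrite b3E k3E /b /k; ring [Ep Ep3 Ep9].
rewrite e; have -> : b[3] ^ 3 = a[3] ^ 3 - cst 27 * q ^ 3 * k[3] ^ 3 by rewrite borwein_cubic3; ring.
by rewrite b_lin; ring.
Qed.

(** Both sides have constant term 1 and the same cube, by borwein_cubic, b_lin and
    k_cubic. *)
Lemma a_lin : a = a[3] + cst 6 * q * k[3].
Proof.
apply: cube_inj; [exact: a0|by rewrite add_coef -!Ser.mulA cst_mul_coef var_mul /dil /= a0|].
by rewrite borwein_cubic b_lin; ring [k_cubic].
Qed.

Lemma hex_cross : cst 3 * k * hex = hexc * a.
Proof.
rewrite /k /a; transitivity ((cst 3 * E[3] ^ 3 * hex) * p); first by ring.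
by rewrite theta_cube_derivative; ring.
Qed.

(** The hexagonal series and a are dissected alike, and hex_cross makes their residue
    parts proportional, so hex / a is invariant under q -> q^3 and hence constant. *)
Lemma hex_borwein_a : hex = a.
Proof.
have e : a[3] * hex = a * hex[3].
  have := f_equal (dil 3) hex_cross.
  rewrite (dil_mul 3 _ (cst 3 * k) hex) // dil_cst_mul // (dil_mul 3 _ hexc a) // => c3.
  transitivity (a[3] * (hex[3] + cst 2 * q * hexc[3])); first by rewrite -hex_dissect.
  transitivity ((a[3] + cst 6 * q * k[3]) * hex[3]); last by rewrite -a_lin.
  transitivity (a[3] * hex[3] + cst 2 * q * (hexc[3] * a[3])); first by ring.
  by rewrite -c3; ring.
have la0 : hex O = 1%Z by exact: hex_coef0.
suff H : forall N, eqm (S N) hex a.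
  by apply: Ser.ext => n; apply: (H n); lia.
elim=> [|N IH]; first by move=> [|n] Hn; [rewrite la0 a0|lia].
apply: (eqm_cancel _ (a[3])); first by rewrite /dil /= a0.
(* Agreement below degree N + 1 dilates to agreement below 3 (N + 1). *)
rewrite e (Ser.mulC (a[3])); apply: eqm_mul => //.
by apply: (eqm_le (3 * S N)); [lia|apply: dil_eqm].
Qed.

Lemma hexc_borwein_k : hexc = cst 3 * k.
Proof.
apply: (mul_cancel a); first by rewrite a0.
by rewrite Ser.mulC -hex_cross hex_borwein_a; ring.
Qed.

Theorem numer6_borwein : numer6 = dil 6 Th * a ^ 2 + cst 9 * k ^ 2 * g.
Proof. by rewrite numer6_lattice hex_borwein_a hexc_borwein_k /g; ring. Qed.

(** The norm of E and the section of E^3 in degrees divisible by 3 differ by 9 q times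
    the product of the three sections. *)
Lemma sec_prod : sec 0 E * sec 1 E * sec 2 E = E * k[3].
Proof.
have [[s0 _] _] := sec_E3; have n := normE.
apply: var_cancel; apply: (cst_cancel 9) => //.
transitivity (sec 0 (E ^ 3) - norm E).
  have -> : E ^ 3 = mix (sec 0 E) (sec 1 E) (sec 2 E) * mix (sec 0 E) (sec 1 E) (sec 2 E) * mix (sec 0 E) (sec 1 E) (sec 2 E).
    by rewrite -dissect; ring.
  by rewrite !mix_mul !sec_mix /norm; ring.
rewrite s0 n; have -> : Gs = a * E by rewrite /a; ring [Ep].
by rewrite a_lin b_lin; ring.
Qed.

(** Expanding E times the sum of squares by residue classes reproduces the three
    sections of E^3 and of sec_prod with q replaced by q^3. *)
Lemma class_squares_b : cst 3 * (E * class_squares) = E[3] * (b + cst 2 * b[3]).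
Proof.
have sE := sec_E3; have pr := sec_prod.
have E3m : E ^ 3 = mix (sec 0 E) (sec 1 E) (sec 2 E) * mix (sec 0 E) (sec 1 E) (sec 2 E) * mix (sec 0 E) (sec 1 E) (sec 2 E).
  by rewrite -dissect; ring.
move: sE pr; rewrite E3m !mix_mul !sec_mix => -[[e0 e1] e2] pr.
rewrite /class_squares; have := dissect E; rewrite /mix.
move: e0 e1 e2 pr; move: (sec 0 E) (sec 1 E) (sec 2 E) => x0 x1 x2 e0 e1 e2 pr dE.
have f0 : x0 ^ 3 + q * x1 ^ 3 + q ^ 2 * x2 ^ 3 + cst 6 * q * (E * k[3]) = Gs.
  by rewrite -e0 -pr; ring.
have f1 : x0 ^ 2 * x1 + q * (x0 * x2 ^ 2) + q * (x1 ^ 2 * x2) = cst (-1) * E[3] ^ 3.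
  by apply: (cst_cancel 3) => //; transitivity (cst (-3) * E[3] ^ 3); [rewrite -e1; ring|ring].
have f2 : x0 ^ 2 * x2 + x0 * x1 ^ 2 + q * (x1 * x2 ^ 2) = cst 0.
  by apply: (cst_cancel 3) => //; transitivity (cst 0); [rewrite -e2; ring|ring].
have push := (fun f h => dil_add 3 f h, fun f h => dil_mul 3 (Nat.neq_succ_0 2) f h,
  dil_cst 3 (Nat.neq_succ_0 2), dil_var 3 (Nat.neq_succ_0 2)).
have F0 : x0[3] ^ 3 + q ^ 3 * x1[3] ^ 3 + q ^ 6 * x2[3] ^ 3 + cst 6 * q ^ 3 * (E[3] * k[3][3]) = Gs[3].
  by rewrite -f0 /= !push; ring.
have F1 : x0[3] ^ 2 * x1[3] + q ^ 3 * (x0[3] * x2[3] ^ 2) + q ^ 3 * (x1[3] ^ 2 * x2[3]) = cst (-1) * E[3][3] ^ 3.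
  have := f_equal (dil 3) f1; rewrite /= !push => e.
  transitivity (cst (-1) * ((E[3])[3] * ((E[3])[3] * ((E[3])[3] * cst 1)))); last by ring.
  by rewrite -e; ring.
have F2 : x0[3] ^ 2 * x2[3] + x0[3] * x1[3] ^ 2 + q ^ 3 * (x1[3] * x2[3] ^ 2) = cst 0.
  by have := f_equal (dil 3) f2; rewrite /= !push => e; rewrite -e; ring.
have H : E * (x0[3] ^ 2 + (q * x1[3]) ^ 2 + (q ^ 2 * x2[3]) ^ 2) =
   (x0[3] ^ 3 + q ^ 3 * x1[3] ^ 3 + q ^ 6 * x2[3] ^ 3)
   + q * (x0[3] ^ 2 * x1[3] + q ^ 3 * (x0[3] * x2[3] ^ 2) + q ^ 3 * (x1[3] ^ 2 * x2[3]))
   + q ^ 2 * (x0[3] ^ 2 * x2[3] + x0[3] * x1[3] ^ 2 + q ^ 3 * (x1[3] * x2[3] ^ 2)).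
  by rewrite {1}dE; ring.
rewrite {}H F1 F2.
have -> : x0[3] ^ 3 + q ^ 3 * x1[3] ^ 3 + q ^ 6 * x2[3] ^ 3 = Gs[3] - cst 6 * q ^ 3 * (E[3] * k[3][3]).
  by rewrite -F0; ring.
have aL : a[3] = a[3][3] + cst 6 * q ^ 3 * k[3][3].
  have := f_equal (dil 3) a_lin; have -> : forall f, cst 6 * q * f = cst 6 * (q ^ 1 * f) by move=> f; ring.
  by rewrite dil_add dil_cst_mul // dil_varpow_mul //; cbv [Nat.mul Nat.add] => e; rewrite {1}e; ring.
have bL : b[3] = a[3][3] - cst 3 * q ^ 3 * k[3][3].
  have := f_equal (dil 3) b_lin; have -> : forall f, cst 3 * q * f = cst 3 * (q ^ 1 * f) by move=> f; ring.
  by rewrite dil_sub dil_cst_mul // dil_varpow_mul //; cbv [Nat.mul Nat.add] => e; rewrite {1}e; ring.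
have -> : Gs[3] = a[3] * E[3] by rewrite a3E; ring [Ep3].
have -> : E[3][3] ^ 3 = k[3] * E[3] by rewrite k3E; ring [Ep3].
by rewrite bL b_lin; move: aL; move: (a[3][3]) => aa aL; rewrite aL; ring.
Qed.

(** The series whose value at q^3 enters three_term. By theta_tri_dissect the
    numerator is 2 q^2 Theta(q^18) - 2 theta24(q^3), which Odd_Even relies on. *)
Definition theta_defect : ser := (cst 3 * q ^ 2 * dil 18 Th - dil 2 Th) * ib.
Local Notation f2 := theta_defect.

(** class_squares_rel multiplied by 3 E, with the sum of squares replaced by
    class_squares_b. *)
Lemma three_term : cst 3 * g * k[3] = k * (cst 2 * dil 6 Th - b * f2[3]).
Proof.
have w := class_squares_rel; have wb := class_squares_b.
have ff : f2[3] = (cst 3 * q ^ 6 * dil 54 Th - dil 6 Th) * ib[3].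
  rewrite /f2 dil_mul // dil_sub; have -> : forall f, cst 3 * q ^ 2 * f = cst 3 * (q ^ 2 * f) by move=> f; ring.
  by rewrite dil_cst_mul // dil_varpow_mul // !dil_comp //; cbv [Nat.mul Nat.add]; ring.
have m : cst 3 * g * E * E[3][3] ^ 2 = E[3] * (dil 6 Th * (b + cst 2 * b[3]) - cst 3 * q ^ 6 * dil 54 Th * b).
  have bE : E ^ 3 = b * E[3] by rewrite /b; ring [Ep3].
  rewrite dil9 in w; transitivity (cst 3 * E * (cst 2 * theta24 * E[3][3] ^ 2)); first by rewrite /g; ring.
  transitivity (cst 3 * E * (dil 6 Th * class_squares - q ^ 6 * dil 54 Th * E ^ 2)); first by rewrite w; ring.
  transitivity (dil 6 Th * (cst 3 * (E * class_squares)) - cst 3 * q ^ 6 * dil 54 Th * E ^ 3); first by ring.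
  by rewrite wb bE; ring.
have b3p : b[3] * ib[3] = cst 1 by rewrite -dil_mul // b_ib dil_cst.
rewrite ff k3E.
transitivity (cst 3 * g * E * E[3][3] ^ 2 * (E[3][3] * p * p[3])); first by ring [Ep].
by rewrite m b3E ib3E /k; ring [Ep Ep3 Ep9].
Qed.

(** * The recursion under n -> 3n+1 *)

Definition euler_quotient : ser := q * (E[3] ^ 12 * p ^ 12).
Local Notation t := euler_quotient.
(** A Hauptmodul of level 3, equal to c^3/(9 b^3); the coefficients of the recursion
    are integral polynomials in it. *)
Definition hauptmodul : ser := cst 3 * t.
Local Notation r := hauptmodul.

Inductive Zr : ser -> Prop :=
| Zr_cst c : Zr (cst c)
| Zr_r : Zr r
| Zr_add f h : Zr f -> Zr h -> Zr (f + h)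
| Zr_mul f h : Zr f -> Zr h -> Zr (f * h).

(** alpha = a(q^3)/b(q^3), gamma = c(q^3)/b(q^3) and beta = b(q^3)/b(q). The last is the
    inverse of alpha - gamma, because b = a(q^3) - c(q^3). *)
Definition alpha : ser := a[3] * ib[3].
Definition gamma : ser := cst 3 * q * k[3] * ib[3].
Definition beta : ser := b[3] * ib.

Lemma b3_ib3 : b[3] * ib[3] = cst 1. Proof. by rewrite -dil_mul // b_ib dil_cst. Qed.
Lemma a3_alpha : a[3] = b[3] * alpha. Proof. rewrite /alpha; ring [b3_ib3]. Qed.
Lemma qk3_gamma : cst 3 * q * k[3] = b[3] * gamma. Proof. rewrite /gamma; ring [b3_ib3]. Qed.

Lemma r_dil : (cst 9 * r)[3] = cst 27 * q ^ 3 * k[3] ^ 3 * ib[3] ^ 3.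
Proof.
have -> : cst 9 * r = cst 27 * (q ^ 1 * (k ^ 3 * ib ^ 3)) by rewrite /r /t /k /ib; ring [Ep3].
by rewrite dil_cst_mul // dil_varpow_mul // dil_mul // !dil_pow //; cbv [Nat.mul Nat.add]; ring.
Qed.
(** Cubes of alpha and gamma are series in q^3, indeed polynomials in r(q^3): reduction
    modulo these relations leaves only exponents below 3. *)
Lemma gamma3 : gamma ^ 3 = (cst 9 * r)[3]. Proof. by rewrite r_dil /gamma; ring. Qed.
Lemma alpha3 : alpha ^ 3 = cst 1 + (cst 9 * r)[3].
Proof.
rewrite r_dil /alpha; transitivity (a[3] ^ 3 * ib[3] ^ 3); first by ring.
rewrite borwein_cubic3; ring [b3_ib3].
Qed.
Lemma b_alpha_gamma : b = b[3] * (alpha - gamma).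
Proof. by rewrite {1}b_lin a3_alpha qk3_gamma; ring. Qed.
Lemma beta_inv : (alpha - gamma) * beta = cst 1.
Proof. by rewrite /beta; transitivity (b[3] * (alpha - gamma) * ib); [ring|rewrite -b_alpha_gamma b_ib]. Qed.
(** 1/(alpha - gamma) equals (alpha^3 - gamma^3)/(alpha - gamma) because
    alpha^3 - gamma^3 = 1: beta is a polynomial, homogeneous of degree 2. *)
Lemma betaE : beta = alpha ^ 2 + alpha * gamma + gamma ^ 2.
Proof.
have e : (alpha - gamma) * (alpha ^ 2 + alpha * gamma + gamma ^ 2) = cst 1.
  by transitivity (alpha ^ 3 - gamma ^ 3); [ring|rewrite alpha3 gamma3; ring].
transitivity ((alpha - gamma) * (alpha ^ 2 + alpha * gamma + gamma ^ 2) * beta); first by rewrite e; ring.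
transitivity ((alpha - gamma) * beta * (alpha ^ 2 + alpha * gamma + gamma ^ 2)); first by ring.
by rewrite beta_inv; ring.
Qed.
Lemma a_alpha_gamma : a = b[3] * (alpha + cst 2 * gamma).
Proof. by rewrite {1}a_lin a3_alpha; have := qk3_gamma => e; transitivity (b[3] * alpha + cst 2 * (cst 3 * q * k[3])); [ring|rewrite e; ring]. Qed.
Lemma r_beta : r = gamma * beta ^ 4.
Proof. rewrite /r /t /gamma /beta /ib k3E b3E dil_mul // dil_pow //; ring [Ep Ep3 Ep9]. Qed.

(** The parts of Z[r](q^3)[alpha, gamma] of degree divisible by 3 and congruent to 1 modulo
    3. As gamma is q times a series in q^3 and alpha a series in q^3, the exponent of
    gamma is the residue class of the degree in q. *)
Definition deg0 (f : ser) : Prop := exists y0 y1 y2, [/\ Zr y0, Zr y1, Zr y2 &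
  f = y0[3] + alpha ^ 2 * gamma * y1[3] + alpha * gamma ^ 2 * y2[3]].
Definition deg1 (f : ser) : Prop := exists y0 y1 y2, [/\ Zr y0, Zr y1, Zr y2 &
  f = alpha * y0[3] + gamma * y1[3] + alpha ^ 2 * gamma ^ 2 * y2[3]].

Ltac zr := repeat first [exact: Zr_r | exact: Zr_cst | apply: Zr_add | apply: Zr_mul | assumption].

Lemma deg0_add f h : deg0 f -> deg0 h -> deg0 (f + h).
Proof.
move=> [x0 [x1 [x2 [X0 X1 X2 ->]]]] [y0 [y1 [y2 [Y0 Y1 Y2 ->]]]].
exists (x0 + y0), (x1 + y1), (x2 + y2); split; zr.
by rewrite !dil_add; ring.
Qed.
(** Elements A and R of Z[r] whose dilations are alpha^3 and gamma^3, in terms of which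
    every coefficient vector below is written. *)
Lemma Zr_cubes : exists A R, [/\ Zr A, Zr R, A[3] = alpha ^ 3 & R[3] = gamma ^ 3].
Proof.
exists (cst 1 + cst 9 * r), (cst 9 * r); split; zr.
  by rewrite alpha3 dil_add dil_cst.
by rewrite gamma3.
Qed.
Ltac push3 := rewrite ?(dil_add 3) ?(dil_mul 3) // ?(dil_add 3) ?(dil_mul 3) // ?(dil_add 3) ?(dil_mul 3) //.

Lemma deg0_mul f h : deg0 f -> deg0 h -> deg0 (f * h).
Proof.
move=> [x0 [x1 [x2 [X0 X1 X2 ->]]]] [y0 [y1 [y2 [Y0 Y1 Y2 ->]]]].
have [A [R [ZA ZR eA eR]]] := Zr_cubes.
exists (x0 * y0 + A * R * (x1 * y2 + x2 * y1)), (x0 * y1 + x1 * y0 + R * (x2 * y2)), (x0 * y2 + x2 * y0 + A * (x1 * y1)).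
split; zr.
by push3; rewrite eA eR; ring.
Qed.
Lemma deg1_mul f h : deg1 f -> deg0 h -> deg1 (f * h).
Proof.
move=> [x0 [x1 [x2 [X0 X1 X2 ->]]]] [y0 [y1 [y2 [Y0 Y1 Y2 ->]]]].
have [A [R [ZA ZR eA eR]]] := Zr_cubes.
exists (x0 * y0 + R * (x1 * y2) + A * R * (x2 * y1)), (x1 * y0 + A * (x0 * y1) + A * R * (x2 * y2)),
  (x2 * y0 + x0 * y2 + x1 * y1).
split; zr.
by push3; rewrite eA eR; ring.
Qed.
Lemma deg1_scale c f : deg1 f -> deg1 (cst c * f).
Proof.
move=> [y0 [y1 [y2 [Y0 Y1 Y2 ->]]]].
by exists (cst c * y0), (cst c * y1), (cst c * y2); split; zr; rewrite !dil_cst_mul //; ring.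
Qed.
Lemma deg1_add f h : deg1 f -> deg1 h -> deg1 (f + h).
Proof.
move=> [x0 [x1 [x2 [X0 X1 X2 ->]]]] [y0 [y1 [y2 [Y0 Y1 Y2 ->]]]].
exists (x0 + y0), (x1 + y1), (x2 + y2); split; zr.
by rewrite !dil_add; ring.
Qed.
Lemma deg0_cst c : deg0 (cst c).
Proof. by exists (cst c), (cst 0), (cst 0); split; zr; rewrite !dil_cst //; ring. Qed.

Lemma deg0_beta3 : exists y0 y1 y2, [/\ Zr y0, Zr y1, Zr y2 &
  beta ^ 3 = y0[3] + alpha ^ 2 * gamma * (y1[3]) + alpha * gamma ^ 2 * y2[3]].
Proof.
have [A [R [ZA ZR eA eR]]] := Zr_cubes.
exists (A * A + cst 7 * (A * R) + R * R), (cst 3 * A + cst 6 * R), (cst 6 * A + cst 3 * R).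
split; zr.
by push3; rewrite !(dil_cst 3) // eA eR betaE; ring.
Qed.
Lemma deg0_gamma_beta : deg0 (gamma * beta).
Proof.
have [A [R [ZA ZR eA eR]]] := Zr_cubes.
by exists R, (cst 1), (cst 1); split; zr; rewrite betaE !dil_cst // eR; ring.
Qed.
(** r = (gamma beta) beta^3 and both factors are homogeneous of degree divisible by 3. *)
Lemma deg0_r : deg0 r.
Proof.
have -> : r = gamma * beta * beta ^ 3 by rewrite r_beta; ring.
by apply: deg0_mul; [exact: deg0_gamma_beta|exact: deg0_beta3].
Qed.
(** The step that makes the recursion close up: the residue parts of an element of Z[r]
    have coordinates in Z[r] again. *)
Lemma Zr_deg0 f : Zr f -> deg0 f.
Proof.
elim=> [c||x y _ X _ Y|x y _ X _ Y]; [exact: deg0_cst|exact: deg0_r|exact: deg0_add|exact: deg0_mul].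
Qed.

Lemma deg1_beta2 : deg1 (beta ^ 2).
Proof.
have [A [R [ZA ZR eA eR]]] := Zr_cubes.
exists (A + cst 2 * R), (cst 2 * A + R), (cst 3); split; zr.
by push3; rewrite !(dil_cst 3) // eA eR betaE; ring.
Qed.
(** The product is (a/b)^2. Its coordinate in class 1 is divisible by 3, which gives one of the
    two factors 3 in the first section. *)
Lemma deg0_a2b2_div3 : exists y0 y1 y2, [/\ Zr y0, Zr y1, Zr y2 &
  (alpha + cst 2 * gamma) ^ 2 * beta ^ 2 = y0[3] + alpha ^ 2 * gamma * (cst 3 * y1)[3] + alpha * gamma ^ 2 * y2[3]].
Proof.
have [A [R [ZA ZR eA eR]]] := Zr_cubes.
exists (A * A + cst 22 * (A * R) + cst 4 * (R * R)), (cst 2 * A + cst 7 * R), (cst 15 * A + cst 12 * R).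
split; zr.
by push3; rewrite !(dil_cst 3) // eA eR betaE; ring.
Qed.
Lemma deg0_a2b2 : deg0 ((alpha + cst 2 * gamma) ^ 2 * beta ^ 2).
Proof.
have [y0 [y1 [y2 [Y0 Y1 Y2 e]]]] := deg0_a2b2_div3.
by exists y0, (cst 3 * y1), y2; split; zr.
Qed.

Lemma sec1_mix x0 x1 x2 : sec 1 (x0[3] + q * x1[3] + q ^ 2 * x2[3]) = x1.
Proof. by have [[_ ->] _] := sec_mix x0 x1 x2. Qed.

(** Its two theta factors are what the section makes of Theta(q^6) and theta_defect(q^3), to
    which three_term reduces even_form. *)
Definition odd_form (u v : ser) : ser :=
  E[3] ^ 2 * ib * (dil 2 Th * a ^ 2 * ib ^ 3 * u + f2 * v).
Definition even_form (x z : ser) : ser :=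
  p[3] ^ 2 * (dil 6 Th * a ^ 2 * ib ^ 2 * t * x + g * E[3] ^ 8 * p ^ 8 * z).
Definition Odd (m : nat) (f : ser) : Prop :=
  exists u v, [/\ Zr u, Zr v & f = cst (3 ^ Z.of_nat m) * odd_form u v].
Definition Even (m : nat) (f : ser) : Prop :=
  exists x z, [/\ Zr x, Zr z & f = cst (3 ^ Z.of_nat m) * even_form x z].

Lemma dil6_Th : dil 6 Th = (dil 2 Th)[3]. Proof. by rewrite dil_comp. Qed.
Lemma dil18_Th : dil 18 Th = (dil 6 Th)[3]. Proof. by rewrite dil_comp. Qed.

(** All factors except y and z are series in q^3, so the section picks their
    coordinates in class 1, which come with one factor gamma, the source of 3. *)
Lemma sec1_even y y1 z z1 :
  (exists y0 y2, y = y0[3] + alpha ^ 2 * gamma * y1[3] + alpha * gamma ^ 2 * y2[3]) ->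
  (exists z0 z2, z = alpha * z0[3] + gamma * z1[3] + alpha ^ 2 * gamma ^ 2 * z2[3]) ->
  sec 1 (p[3] ^ 2 * (dil 6 Th * y - f2[3] * b[3] * z)) =
    cst 3 * odd_form y1 (- z1).
Proof.
move=> [y0 [y2 ->]] [z0 [z2 ->]].
(* The argument sorted by residue classes of the degree. *)
rewrite [X in sec 1 X](_ : _ = (p ^ 2 * (dil 2 Th * y0 - f2 * a * z0))[3]
  + q * (p ^ 2 * (dil 2 Th * (cst 3 * a ^ 2 * k * ib ^ 3 * y1) - f2 * (cst 3 * k * z1)))[3]
  + q ^ 2 * (p ^ 2 * (dil 2 Th * (cst 9 * a * k ^ 2 * ib ^ 3 * y2) - f2 * (cst 9 * a ^ 2 * k ^ 2 * ib ^ 3 * z2)))[3]).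
  rewrite sec1_mix /odd_form.
  transitivity (cst 3 * (p ^ 2 * k * (dil 2 Th * a ^ 2 * ib ^ 3 * y1 - f2 * z1))); first by ring.
  have -> : p ^ 2 * k = E[3] ^ 2 * ib by rewrite /k /ib; ring.
  by ring.
have := b3_ib3; have := dil6_Th; rewrite /alpha /gamma.
move: (b) (ib) (a) (k) (p) (f2) (dil 2 Th) (dil 6 Th) => B IB A K P' F triZ_double T6 -> e.
rewrite /= !(dil_mul 3, dil_sub 3, dil_cst 3) //.
ring [e].
Qed.

Lemma kkE : cst 3 * g * (k[3] * (p[3][3] ^ 3 * E[3])) = k * (p[3][3] ^ 3 * E[3]) * (cst 2 * dil 6 Th - b * f2[3]).
Proof.
transitivity (cst 3 * g * k[3] * (p[3][3] ^ 3 * E[3])); first by ring.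
by rewrite three_term; ring.
Qed.
(** three_term divided by k(q^3) = E(q^9)^3 / E(q^3). *)
Lemma g_rel : cst 3 * g = k * p[3][3] ^ 3 * E[3] * (cst 2 * dil 6 Th - b * f2[3]).
Proof.
have := kkE; rewrite k3E => e.
transitivity (cst 3 * g * (E[3][3] ^ 3 * p[3] * (p[3][3] ^ 3 * E[3]))); first by ring [Ep3 Ep9].
by rewrite e; ring.
Qed.

Lemma beta3E : beta ^ 3 = E[3] ^ 12 * p[3][3] ^ 3 * p ^ 9.
Proof. by rewrite /beta b3E /ib; ring. Qed.

(** The form is multiplied by 3 so that g_rel applies; sec1_even returns this factor 3, which
    is then cancelled, and the power of 3 is unchanged. *)
Lemma Even_Odd m f : Even m f -> Odd m (sec 1 f).
Proof.
move=> [x [z [Zx Zz ->]]]; rewrite sec_cst_mul.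
have [y0 [y1 [y2 [_ Y1 _ ey]]]] : deg0 ((alpha + cst 2 * gamma) ^ 2 * beta ^ 2 * r * x + cst 2 * beta ^ 3 * z).
  apply: deg0_add; apply: deg0_mul; try exact: Zr_deg0.
    by apply: deg0_mul; [exact: deg0_a2b2|exact: deg0_r].
  by apply: deg0_mul; [exact: deg0_cst|exact: deg0_beta3].
have [z0 [z1 [z2 [_ Z1 _ ez]]]] := deg1_mul _ _ deg1_beta2 (Zr_deg0 _ Zz).
exists y1, (cst (-1) * z1); split; zr; congr Ser.mul.
(* The factor 3 turns t into r and makes 3 g available. *)
apply: (cst_cancel 3) => //; rewrite -sec_cst_mul.
have -> : cst 3 * even_form x z = p[3] ^ 2 * (dil 6 Th * ((alpha + cst 2 * gamma) ^ 2 * beta ^ 2 * r * x + cst 2 * beta ^ 3 * z)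
    - f2[3] * b[3] * (beta ^ 2 * z)).
  rewrite /even_form.
  transitivity (p[3] ^ 2 * (dil 6 Th * (a * ib) ^ 2 * (cst 3 * t) * x + cst 3 * g * (E[3] ^ 8 * p ^ 8) * z)); first by ring.
  have -> : a * ib = (alpha + cst 2 * gamma) * beta by rewrite a_alpha_gamma /beta; ring.
  rewrite g_rel -/r.
  have -> : k * p[3][3] ^ 3 * E[3] * (cst 2 * dil 6 Th - b * f2[3]) * (E[3] ^ 8 * p ^ 8) =
     beta ^ 3 * (cst 2 * dil 6 Th - b * f2[3]) by rewrite beta3E /k; ring.
  have -> : beta ^ 3 * (cst 2 * dil 6 Th - b * f2[3]) = cst 2 * dil 6 Th * beta ^ 3 - f2[3] * b[3] * beta ^ 2.
    have -> : beta ^ 3 * (cst 2 * dil 6 Th - b * f2[3]) = cst 2 * dil 6 Th * beta ^ 3 - f2[3] * beta ^ 2 * (b * beta) by ring.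
    have -> : b * beta = b[3] by rewrite /beta; ring [b_ib].
    by ring.
  by ring.
rewrite (sec1_even _ y1 _ z1); last 2 first.
- by exists y0, y2.
- by exists z0, z2.
by have -> : - z1 = cst (-1) * z1 by ring.
Qed.

(** Since q^2 Theta(q^18) already has degree 2 modulo 3, its cofactor contributes through
    class 2, with gamma^2 and so with 9; the cofactor of g(q^3) contributes through
    class 1, with gamma and so with 3. *)
Lemma sec1_odd y y2 z z1 :
  (exists y0 y1, y = alpha * y0[3] + gamma * y1[3] + alpha ^ 2 * gamma ^ 2 * y2[3]) ->
  (exists z0 z2, z = alpha * z0[3] + gamma * z1[3] + alpha ^ 2 * gamma ^ 2 * z2[3]) ->
  sec 1 (E[3] ^ 2 * ib[3] ^ 2 * (q ^ 2 * dil 18 Th * y + g[3] * z)) =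
    cst 3 * even_form (cst 3 * y2) z1.
Proof.
move=> [y0 [y1 ->]] [z0 [z2 ->]].
rewrite [X in sec 1 X](_ : _ = (E ^ 2 * (q * dil 6 Th * (cst 3 * k * ib ^ 3 * y1) + g * (a * ib ^ 3 * z0)))[3]
  + q * (E ^ 2 * (q * dil 6 Th * (cst 9 * a ^ 2 * k ^ 2 * ib ^ 6 * y2) + g * (cst 3 * k * ib ^ 3 * z1)))[3]
  + q ^ 2 * (E ^ 2 * (dil 6 Th * (a * ib ^ 3 * y0) + g * (cst 9 * a ^ 2 * k ^ 2 * ib ^ 6 * z2)))[3]).
  rewrite sec1_mix /even_form.
  have e1 : E ^ 2 * q * k ^ 2 * ib ^ 6 = p[3] ^ 2 * ib ^ 2 * t by rewrite /k /ib /t; ring [Ep Ep3].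
  have e2 : E ^ 2 * k * ib ^ 3 = p[3] ^ 2 * (E[3] ^ 8 * p ^ 8) by rewrite /k /ib; ring [Ep Ep3].
  transitivity (cst 9 * dil 6 Th * a ^ 2 * (E ^ 2 * q * k ^ 2 * ib ^ 6) * y2 + cst 3 * g * (E ^ 2 * k * ib ^ 3) * z1); first by ring.
  by rewrite e1 e2; ring.
have := b3_ib3; have := dil18_Th; rewrite /alpha /gamma.
move: (b) (ib) (a) (k) (p) (g) (E) (dil 18 Th) (dil 6 Th) => B IB A K P' F EE triZ_double T6 -> e.
rewrite /= !(dil_add 3, dil_mul 3, dil_sub 3, dil_cst 3, dil_var 3) //.
ring [e].
Qed.

(** The dissection of Theta(q^2) brings both generators to the shape required by
    sec1_odd, where the factor 3 is a real gain. *)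
Lemma Odd_Even m f : Odd m f -> Even (S m) (sec 1 f).
Proof.
move=> [u [v [Zu Zv ->]]]; rewrite sec_cst_mul.
have Su : deg1 (beta ^ 2 * ((alpha + cst 2 * gamma) ^ 2 * beta ^ 2 * u)).
  by apply: deg1_mul; [exact: deg1_beta2|apply: deg0_mul; [exact: deg0_a2b2|exact: Zr_deg0]].
have Sv : deg1 (beta ^ 2 * v) by apply: deg1_mul; [exact: deg1_beta2|exact: Zr_deg0].
have [y0 [y1 [y2 [_ _ Y2 ey]]]] := deg1_add _ _ Su (deg1_scale 2 _ Sv).
have [z0 [z1 [z2 [_ Z1 _ ez]]]] := deg1_add _ _ Su (deg1_scale (-1) _ Sv).
exists (cst 3 * y2), z1; split; zr.
rewrite Nat2Z.inj_succ Z.pow_succ_r; last by lia.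
have -> : forall c d, cst (c * d) = cst c * cst d by move=> c d; rewrite Ser.cst_mul; apply: Ser.ext => -[|n] /=; lia.
transitivity (cst (3 ^ Z.of_nat m) * (cst 3 * even_form (cst 3 * y2) z1)); last by ring.
congr Ser.mul; rewrite -(sec1_odd _ y2 _ z1 (ex_intro _ y0 (ex_intro _ y1 ey)) (ex_intro _ z0 (ex_intro _ z2 ez))).
congr (sec 1 _); rewrite /odd_form /f2 theta_tri_dissect.
have e1 : ib = beta * ib[3] by rewrite /beta; ring [b3_ib3].
have -> : g[3] = cst 2 * dil 3 theta24 by rewrite /g dil_cst_mul.
move: e1 a_alpha_gamma b3_ib3; move: (ib[3]) (b[3]) (E[3]) => IB B E' e1 e2 e3.
by rewrite e1 e2; ring [e3].
Qed.

Definition cpsi60_series : ser := numer6 * p ^ 6.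

(** One factor 3 is that of sec1_even. The other is present in both coordinates: in
    (a/b)^2 by deg0_a2b2_div3, and in the rest because numer6 contains 9 g k^2, of which
    g_rel uses up only one factor 3. *)
Lemma cpsi60_series_Odd : Odd 2 (sec 1 cpsi60_series).
Proof.
have [w0 [w1 [w2 [_ W1 _ ew]]]] := deg0_a2b2_div3.
have [v0 [v1 [v2 [_ V1 _ ev]]]] := deg0_beta3.
have [z0 [z1 [z2 [_ Z1 _ ez]]]] := deg1_beta2.
exists (w1 + cst 2 * v1), (cst (-1) * z1); split; zr.
have -> : cpsi60_series = p[3] ^ 2 * (dil 6 Th * ((alpha + cst 2 * gamma) ^ 2 * beta ^ 2 + cst 6 * beta ^ 3)
    - f2[3] * b[3] * (cst 3 * beta ^ 2)).
  have -> : (alpha + cst 2 * gamma) ^ 2 * beta ^ 2 = a ^ 2 * ib ^ 2 by rewrite a_alpha_gamma /beta; ring.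
  rewrite /cpsi60_series numer6_borwein.
  transitivity (dil 6 Th * a ^ 2 * p ^ 6 + cst 3 * k ^ 2 * (cst 3 * g) * p ^ 6); first by ring.
  rewrite g_rel.
  transitivity (dil 6 Th * a ^ 2 * p ^ 6 + cst 3 * (k ^ 3 * p[3][3] ^ 3 * E[3] * p ^ 6) * (cst 2 * dil 6 Th) - cst 3 * f2[3] * (k ^ 3 * p[3][3] ^ 3 * E[3] * p ^ 6 * b)); first by ring.
  have -> : k ^ 3 * p[3][3] ^ 3 * E[3] * p ^ 6 = p[3] ^ 2 * beta ^ 3 by rewrite beta3E /k; ring [Ep3].
  have -> : p[3] ^ 2 * beta ^ 3 * b = p[3] ^ 2 * beta ^ 2 * b[3].
    by transitivity (p[3] ^ 2 * beta ^ 2 * b[3] * (b * ib)); [rewrite /beta; ring|rewrite b_ib; ring].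
  have -> : p ^ 6 = p[3] ^ 2 * ib ^ 2 by rewrite /ib; ring [Ep3].
  by ring.
rewrite (sec1_even _ (cst 3 * w1 + cst 6 * v1) _ (cst 3 * z1)); last 2 first.
- exists (w0 + cst 6 * v0), (w2 + cst 6 * v2).
  by rewrite ew ev !dil_add !dil_cst_mul //; ring.
- exists (cst 3 * z0), (cst 3 * z2).
  by rewrite ez !dil_cst_mul //; ring.
rewrite /odd_form; set c := cst (3 ^ Z.of_nat 2); have -> : c = cst 9 by [].
by ring.
Qed.

Fixpoint sec1_iter (n : nat) : ser := match n with O => cpsi60_series | S m => sec 1 (sec1_iter m) end.

Lemma sec1_iter_forms j : Odd (j + 2) (sec1_iter (2 * j + 1)) /\ Even (j + 3) (sec1_iter (2 * j + 2)).
Proof.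
have K m f : Odd m f -> Odd m f /\ Even (S m) (sec 1 f) by move=> h; split=> //; exact: Odd_Even.
elim: j => [|j [_ IH]]; first by apply: (K 2%nat); exact: cpsi60_series_Odd.
have -> : (2 * S j + 1 = S (2 * j + 2))%nat by lia.
have -> : (2 * S j + 2 = S (S (2 * j + 2)))%nat by lia.
have -> : (S j + 2 = j + 3)%nat by lia.
have -> : (S j + 3 = S (j + 3))%nat by lia.
by apply: K; apply: Even_Odd.
Qed.

Lemma sec1_iter_div n m : (0 < n)%nat -> (sec1_iter n m mod 3 ^ Z.of_nat (n / 2 + 2) = 0)%Z.
Proof.
move=> n0.
have [j Hj] : exists j, n = (2 * j + 1)%nat \/ n = (2 * j + 2)%nat.
  by exists ((n - 1) / 2)%nat; have := Nat.div_mod_eq (n - 1) 2; have := Nat.mod_upper_bound (n - 1) 2; lia.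
have [[u [v [_ _ e1]]] [x [z [_ _ e2]]]] := sec1_iter_forms j.
case: Hj => ->; rewrite ?e1 ?e2 cst_mul_coef Z.mul_comm.
  have -> : ((2 * j + 1) / 2 = j)%nat.
    by rewrite Nat.add_comm Nat.mul_comm Nat.div_add.
  by rewrite Z.mod_mul //; apply: Z.pow_nonzero; lia.
have -> : ((2 * j + 2) / 2 + 2 = j + 3)%nat.
  have -> : (2 * j + 2 = 0 + (j + 1) * 2)%nat by lia.
  by rewrite Nat.div_add //= ; lia.
by rewrite Z.mod_mul //; apply: Z.pow_nonzero; lia.
Qed.

(** Each section replaces n by 3n + 1 and so triples 2n + 1. *)
Lemma sec1_iter_index e : forall n m, (2 * n + 1 = 3 ^ e * (2 * m + 1))%nat -> sec1_iter e m = cpsi60_series n.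
Proof.
elim: e => [|e IH] n m H; first by rewrite /=; congr cpsi60_series; move: H; rewrite /=; lia.
rewrite /= /sec; apply: IH; rewrite Nat.pow_succ_r' in H; nia.
Qed.

Theorem cpsi60_series_div (n alpha : nat) : (0 < alpha)%nat ->
  ((2 * Z.of_nat n) mod 3 ^ Z.of_nat alpha = (-1) mod 3 ^ Z.of_nat alpha)%Z ->
  (cpsi60_series n mod 3 ^ Z.of_nat (alpha / 2 + 2) = 0)%Z.
Proof.
move=> a0 H.
have P3 : (0 < 3 ^ Z.of_nat alpha)%Z by apply: Z.pow_pos_nonneg; lia.
have D : (3 ^ Z.of_nat alpha | 2 * Z.of_nat n + 1)%Z.
  apply (proj1 (Z.mod_divide (2 * Z.of_nat n + 1) (3 ^ Z.of_nat alpha) ltac:(lia))).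
  rewrite Z.add_mod; last by lia.
  by rewrite H -Z.add_mod; [apply: Z.mod_0_l; lia|lia].
case: D => d Hd.
have dpos : (0 < d)%Z by nia.
(* The cofactor d is odd because 2n + 1 is. *)
have [m Hm] : exists m, d = (2 * Z.of_nat m + 1)%Z.
  exists (Z.to_nat (d / 2)).
  have E3 : Z.odd (3 ^ Z.of_nat alpha) by rewrite Z.odd_pow //; lia.
  have : Z.odd (2 * Z.of_nat n + 1) = true by rewrite Z.add_comm Z.odd_add_mul_2.
  rewrite Hd Z.odd_mul => /andP [Od _].
  have := Zmod_odd d; rewrite Od => Om.
  have := Z_div_mod_eq_full d 2; rewrite Om => e.
  by rewrite Z2Nat.id; lia.
rewrite -(sec1_iter_index alpha n m); first exact: sec1_iter_div.
apply: Nat2Z.inj; rewrite Nat2Z.inj_mul Nat2Z.inj_pow; lia.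
Qed.

End Recursion.

Module Analysis.
Import Series Lattice Recursion.
Import eqtype ssrnat seq bigop zify_ssreflect.
Local Close Scope C_scope.
Local Open Scope R_scope.

(** * Unconditional summation in C *)

Lemma Rplus_A : associative Rplus. Proof. by move=> x y z; ring. Qed.
Lemma Rplus_C : commutative Rplus. Proof. by move=> x y; ring. Qed.
Lemma Rplus_0 : left_id 0 Rplus. Proof. by move=> x; ring. Qed.
HB.instance Definition _ := Monoid.isComLaw.Build R 0 Rplus Rplus_A Rplus_C Rplus_0.
Lemma Cplus_A : associative Cplus. Proof. by move=> x y z; ring. Qed.
Lemma Cplus_C : commutative Cplus. Proof. by move=> x y; ring. Qed.
Lemma Cplus_0 : left_id (RtoC 0) Cplus. Proof. by move=> x; ring. Qed.
HB.instance Definition _ := Monoid.isComLaw.Build C (RtoC 0) Cplus Cplus_A Cplus_C Cplus_0.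

Definition csum {I : Type} (J : seq I) (f : I -> C) : C := \big[Cplus/RtoC 0]_(i <- J) f i.
Definition rsum {I : Type} (J : seq I) (f : I -> R) : R := \big[Rplus/0]_(i <- J) f i.

Section Finite.
Context {I : Type}.
Implicit Types (J : seq I).
Lemma csum_cons i J f : csum (i :: J) f = (f i + csum J f)%C. Proof. by rewrite /csum big_cons. Qed.
Lemma rsum_cons i J f : rsum (i :: J) f = f i + rsum J f. Proof. by rewrite /rsum big_cons. Qed.
Lemma csum_nil (f : I -> C) : csum [::] f = RtoC 0. Proof. by rewrite /csum big_nil. Qed.
Lemma rsum_nil (f : I -> R) : rsum [::] f = 0. Proof. by rewrite /rsum big_nil. Qed.
Lemma csum_cat J K f : csum (J ++ K) f = (csum J f + csum K f)%C. Proof. by rewrite /csum big_cat. Qed.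
Lemma rsum_cat J K f : rsum (J ++ K) f = rsum J f + rsum K f. Proof. by rewrite /rsum big_cat. Qed.
Lemma csum_add J f h : csum J (fun i => f i + h i)%C = (csum J f + csum J h)%C.
Proof. by rewrite /csum big_split. Qed.
Lemma csum_scal J c f : csum J (fun i => c * f i)%C = (c * csum J f)%C.
Proof. by elim: J => [|i J IH]; rewrite ?csum_nil ?csum_cons ?IH; ring. Qed.
Lemma rsum_scal J c f : rsum J (fun i => c * f i) = c * rsum J f.
Proof. by elim: J => [|i J IH]; rewrite ?rsum_nil ?rsum_cons ?IH; ring. Qed.
Lemma csum_norm J f : Cmod (csum J f) <= rsum J (fun i => Cmod (f i)).
Proof.
elim: J => [|i J IH]; first by rewrite csum_nil rsum_nil Cmod_0; lra.
rewrite csum_cons rsum_cons; apply: Rle_trans (Cmod_triangle _ _) _; lra.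
Qed.
Lemma rsum_pos J f : (forall i, 0 <= f i) -> 0 <= rsum J f.
Proof. by move=> H; elim: J => [|i J IH]; rewrite ?rsum_nil ?rsum_cons; [lra|have := H i; lra]. Qed.
Lemma rsum_le J f h : (forall i, f i <= h i) -> rsum J f <= rsum J h.
Proof. by move=> H; elim: J => [|i J IH]; rewrite ?rsum_nil ?rsum_cons; [lra|have := H i; lra]. Qed.
Lemma csum_filter J (P : pred I) f : csum [seq i <- J | P i] f = csum J (fun i => if P i then f i else RtoC 0).
Proof. by rewrite /csum big_filter big_mkcond. Qed.
Lemma rsum_filter J (P : pred I) f : rsum [seq i <- J | P i] f = rsum J (fun i => if P i then f i else 0).
Proof. by rewrite /rsum big_filter big_mkcond. Qed.
End Finite.

Section Net.
Context {I : eqType}.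
Implicit Types (J : seq I) (f : I -> C).

(** Convergence of the net of finite partial sums, indexed by an arbitrary type, so that Z,
    Z^6 and N can be exchanged by reindexing and regrouping. *)
Definition has_sum f (l : C) := forall eps, 0 < eps ->
  exists J0 : seq I, forall J, uniq J -> {subset J0 <= J} -> Cmod (csum J f - l) < eps.
(** Absolute summability, with an explicit bound of the finite sums of moduli. *)
Definition bounded f (M : R) := forall J, uniq J -> rsum J (fun i => Cmod (f i)) <= M.

Lemma rsum_sub J K (f : I -> R) : (forall i, 0 <= f i) -> uniq J -> {subset J <= K} -> rsum J f <= rsum K f.
Proof.
move=> p0 UJ S.
have -> : rsum J f = rsum [seq i <- undup K | i \in J] f.
  rewrite /rsum; apply: perm_big; apply: uniq_perm => //; first by rewrite filter_uniq // undup_uniq.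
  by move=> i; rewrite mem_filter mem_undup; case E : (i \in J) => //=; rewrite S.
rewrite rsum_filter; apply: (Rle_trans _ (rsum (undup K) f)).
  by apply: rsum_le => i; case: ifP => // _; lra.
elim: K {S} => [|i K IH] /=; first by lra.
by case: ifP => _; rewrite !rsum_cons; have := p0 i; lra.
Qed.

Lemma csum_split J (P : pred I) f :
  csum J f = (csum [seq i <- J | P i] f + csum [seq i <- J | ~~ P i] f)%C.
Proof. by rewrite /csum (bigID P) !big_filter. Qed.

Lemma csum_perm J K f : uniq J -> uniq K -> J =i K -> csum J f = csum K f.
Proof. by move=> u v e; rewrite /csum; apply: perm_big; apply: uniq_perm. Qed.

Lemma csum_diff J0 J f : uniq J -> uniq J0 -> {subset J0 <= J} ->
  csum J f = (csum J0 f + csum [seq i <- J | i \notin J0] f)%C.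
Proof.
move=> UJ U0 S; rewrite (csum_split J (mem J0)); congr Cplus.
apply: csum_perm; rewrite ?filter_uniq // => i; rewrite mem_filter /=.
by case E : (i \in J0) => //=; rewrite S.
Qed.

Lemma Cmod_sym x y : Cmod (x - y) = Cmod (y - x).
Proof. by rewrite -Cmod_opp; congr Cmod; ring. Qed.

Lemma has_sum_uniq f l l' : has_sum f l -> has_sum f l' -> l = l'.
Proof.
move=> H H'.
suff Z : Cmod (l - l') = 0.
  have := Cmod_eq_0 _ Z => e; have -> : l = (l - l' + l')%C by ring.
  by rewrite e; ring.
have [//|n0] : Cmod (l - l') = 0 \/ 0 < Cmod (l - l') by have := Cmod_ge_0 (l - l'); lra.
have [J0 K0] := H (Cmod (l - l') / 2) ltac:(lra).
have [J1 K1] := H' (Cmod (l - l') / 2) ltac:(lra).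
set J := undup (J0 ++ J1).
have k0 : Cmod (csum J f - l) < Cmod (l - l') / 2.
  by apply: K0; [exact: undup_uniq|move=> i hi; rewrite mem_undup mem_cat hi].
have k1 : Cmod (csum J f - l') < Cmod (l - l') / 2.
  by apply: K1; [exact: undup_uniq|move=> i hi; rewrite mem_undup mem_cat hi orbT].
have := Cmod_triangle (l - csum J f) (csum J f - l').
have -> : (l - csum J f + (csum J f - l') = l - l')%C by ring.
rewrite (Cmod_sym l (csum J f)); lra.
Qed.

(** A finite set whose sum of moduli is within eps of the supremum leaves
    less than eps outside. *)
Lemma bounded_tail f M : bounded f M -> forall eps, 0 < eps -> exists J0, uniq J0 /\
  forall J, uniq J -> (forall i, i \in J -> i \notin J0) -> rsum J (fun i => Cmod (f i)) < eps.
Proof.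
move=> B eps e0.
pose S x := exists J, uniq J /\ rsum J (fun i => Cmod (f i)) = x.
have bS : bound S by exists M => x [J [U <-]]; apply: B.
have [s [ub lb]] := completeness S bS (ex_intro _ (rsum [::] (fun i => Cmod (f i))) (ex_intro _ [::] (conj isT erefl))).
have [x [[J0 [U0 E0]] Hx]] : exists x, S x /\ s - eps < x.
  apply: NNPP => N; suff : s <= s - eps by lra.
  apply: lb => x Sx; case: (Rle_lt_dec x (s - eps)) => // H; case: N; by exists x.
exists J0; split=> // J U D.
have := ub (rsum (J0 ++ J) (fun i => Cmod (f i))) (ex_intro _ _ (conj _ erefl)).
rewrite rsum_cat E0 cat_uniq U0 U andbT /= => K.
have {}K : x + rsum J (fun i => Cmod (f i)) <= s.
  by apply: K; apply/hasPn => i /D.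
lra.
Qed.

(** The filter generated by the finite sums is Cauchy, by bounded_tail. *)
Lemma has_sum_ex f M : bounded f M -> exists l, has_sum f l.
Proof.
move=> B.
pose F (P : C -> Prop) := exists J0 : seq I, forall J, uniq J -> {subset J0 <= J} -> P (csum J f).
have PF : ProperFilter F.
  split.
    move=> P [J0 H]; exists (csum (undup J0) f); apply: H; first exact: undup_uniq.
    by move=> i; rewrite mem_undup.
  split.
  - by exists [::].
  - move=> P Q [J0 H0] [J1 H1]; exists (J0 ++ J1) => J U S; split.
      by apply: H0 => // i hi; apply: S; rewrite mem_cat hi.
    by apply: H1 => // i hi; apply: S; rewrite mem_cat hi orbT.
  - by move=> P Q PQ [J0 H0]; exists J0 => J U S; apply: PQ; apply: H0.
have CF : forall eps : posreal, exists x : C, F (ball x eps).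
  move=> eps; have [J0 [U0 H]] := bounded_tail f M B eps (cond_pos eps).
  exists (csum J0 f), J0 => J U S; apply: C_NormedModule_mixin_compat1.
  have -> : minus (csum J f) (csum J0 f) = csum [seq i <- J | i \notin J0] f :> C.
    by rewrite (csum_diff J0 J) // /minus /plus /opp /=; ring.
  apply: Rle_lt_trans (csum_norm _ _) _; apply: H; first by rewrite filter_uniq.
  by move=> i; rewrite mem_filter => /andP [].
have L := C_complete_ax1 F PF CF.
exists (C_complete_lim F) => eps e0.
(* The balls of C are squares; their points are within sqrt 2 times the radius. *)
have e2 : 0 < eps / sqrt 2 by apply: Rdiv_lt_0_compat => //; apply: sqrt_lt_R0; lra.
have [J0 H] := L (mkposreal _ e2); exists J0 => J U S.
have := C_NormedModule_mixin_compat2 _ _ _ (H J U S) => /=.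
have -> : sqrt 2 * (eps / sqrt 2) = eps by field; apply: Rgt_not_eq; apply: sqrt_lt_R0; lra.
by [].
Qed.

Lemma has_sum_le f l M : has_sum f l -> bounded f M -> Cmod l <= M.
Proof.
move=> H B; apply: Rnot_lt_le => lt.
have [J0 K] := H (Cmod l - M) ltac:(lra).
have U := undup_uniq J0.
have k : Cmod (csum (undup J0) f - l) < Cmod l - M by apply: K => // i; rewrite mem_undup.
have b := B _ U; have c := csum_norm (undup J0) f.
have := Cmod_triangle (l - csum (undup J0) f) (csum (undup J0) f).
have -> : (l - csum (undup J0) f + csum (undup J0) f = l)%C by ring.
rewrite (Cmod_sym l (csum (undup J0) f)); lra.
Qed.

Lemma has_sum_ext f h l : (forall i, f i = h i) -> has_sum f l -> has_sum h l.
Proof. by move=> /functional_extensionality ->. Qed.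
Lemma bounded_ext f h M : (forall i, f i = h i) -> bounded f M -> bounded h M.
Proof. by move=> /functional_extensionality ->. Qed.
Lemma bounded_dom f h M : (forall i, Cmod (h i) <= Cmod (f i)) -> bounded f M -> bounded h M.
Proof. by move=> D B J U; apply: Rle_trans (B J U); apply: rsum_le. Qed.

Lemma has_sum_scal c f l : has_sum f l -> has_sum (fun i => c * f i)%C (c * l)%C.
Proof.
move=> H eps e0.
have k0 : 0 < Cmod c + 1 by have := Cmod_ge_0 c; lra.
have [J0 K] := H (eps / (Cmod c + 1)) ltac:(apply: Rdiv_lt_0_compat; lra).
exists J0 => J U S; rewrite csum_scal.
have -> : (c * csum J f - c * l = c * (csum J f - l))%C by ring.
rewrite Cmod_mult; have := K J U S; have := Cmod_ge_0 (csum J f - l); have := Cmod_ge_0 c.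
set x := Cmod c in k0 *; set y := Cmod (csum J f - l) => x0 y0 h.
have h1 : (x + 1) * y < (x + 1) * (eps / (x + 1)) by apply: Rmult_lt_compat_l; lra.
have h2 : (x + 1) * (eps / (x + 1)) = eps by field; lra.
by rewrite h2 in h1; nra.
Qed.
Lemma bounded_scal c f M : bounded f M -> bounded (fun i => c * f i)%C (Cmod c * M).
Proof.
move=> B J U; have -> : rsum J (fun i => Cmod (c * f i)) = Cmod c * rsum J (fun i => Cmod (f i)).
  by rewrite -rsum_scal; congr rsum; apply: functional_extensionality => i; rewrite Cmod_mult.
by apply: Rmult_le_compat_l; [exact: Cmod_ge_0|exact: B].
Qed.
Lemma has_sum_add f h l m : has_sum f l -> has_sum h m -> has_sum (fun i => f i + h i)%C (l + m)%C.
Proof.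
move=> H K eps e0.
have [J0 H0] := H (eps / 2) ltac:(lra). have [J1 H1] := K (eps / 2) ltac:(lra).
exists (J0 ++ J1) => J U S; rewrite csum_add.
have -> : (csum J f + csum J h - (l + m) = (csum J f - l) + (csum J h - m))%C by ring.
apply: Rle_lt_trans (Cmod_triangle _ _) _.
have h0 : Cmod (csum J f - l) < eps / 2 by apply: H0 => // i hi; apply: S; rewrite mem_cat hi.
have h1 : Cmod (csum J h - m) < eps / 2 by apply: H1 => // i hi; apply: S; rewrite mem_cat hi orbT.
lra.
Qed.

Lemma has_sum_finite f (L : seq I) : uniq L -> (forall i, f i <> RtoC 0 -> i \in L) -> has_sum f (csum L f).
Proof.
move=> U H eps e0; exists L => J UJ S; rewrite (csum_diff L J) //.
have -> : csum [seq i <- J | i \notin L] f = RtoC 0.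
  rewrite csum_filter /csum big1 // => i _; case: ifP => // /negP n.
  by case: (excluded_middle_informative (f i = RtoC 0)) => // /H.
have -> : (csum L f + RtoC 0 - csum L f = RtoC 0)%C by ring.
by rewrite Cmod_0.
Qed.
End Net.

Section Regroup.
Context {I B : eqType} (phi : I -> B).
(** Common core of the next two lemmas: finitely many fibre sums are approximated
    simultaneously by one finite partial sum of f. The index set can be made to contain the
    part of J0 over Bs. *)
Lemma fiber_approx (f : I -> C) (h : B -> C) (J0 : seq I) :
  (forall b, has_sum (fun i => if phi i == b then f i else RtoC 0) (h b)) ->
  forall (Bs : seq B) (d : R), 0 < d -> uniq Bs -> exists J, [/\ uniq J,
    forall i, i \in J0 -> phi i \in Bs -> i \in J, Cmod (csum J f - csum Bs h) < d &
    rsum Bs (fun b => Cmod (h b)) <= rsum J (fun i => Cmod (f i)) + d].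
Proof.
move=> K.
suff N : forall (Bs : seq B) (d : R), 0 < d -> uniq Bs -> exists J,
    (uniq J /\ forall i, i \in J -> phi i \in Bs) /\ [/\
    forall i, i \in J0 -> phi i \in Bs -> i \in J, Cmod (csum J f - csum Bs h) < d &
    rsum Bs (fun b => Cmod (h b)) <= rsum J (fun i => Cmod (f i)) + d].
  by move=> Bs d d0 UB; have [J [[U _] [X Y Z]]] := N Bs d d0 UB; exists J.
elim=> [|b Bs IH] d d0.
  move=> _; exists [::]; split=> //; split=> //; last by rewrite !rsum_nil; lra.
  by rewrite !csum_nil; have -> : (RtoC 0 - RtoC 0 = RtoC 0)%C by [ring]; rewrite Cmod_0.
move=> /= /andP [nb UC].
have [J1 [[U1 M1] [S1 D1 N1]]] := IH (d / 2) ltac:(lra) UC.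
have [J2 H2] := K b (d / 2) ltac:(lra).
set J3 := [seq i <- undup (J2 ++ J0) | phi i == b].
have U3 : uniq J3 by rewrite filter_uniq // undup_uniq.
have k : Cmod (csum J3 f - h b) < d / 2.
  rewrite /J3 csum_filter; apply: H2; first exact: undup_uniq.
  by move=> i hi; rewrite mem_undup mem_cat hi.
exists (J3 ++ J1); split; first split.
- rewrite cat_uniq U3 U1 andbT /=; apply/hasPn => i /M1 m; rewrite mem_filter negb_and.
  by apply/orP; left; apply/eqP => e; move: nb; rewrite -e m.
- move=> i; rewrite mem_cat => /orP [|/M1 m]; last by rewrite in_cons m orbT.
  by rewrite mem_filter => /andP [/eqP -> _]; rewrite in_cons eqxx.
split.
- move=> i mi; rewrite in_cons => /orP [e|m]; rewrite mem_cat; last by rewrite S1 // orbT.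
  by rewrite mem_filter e mem_undup mem_cat mi orbT.
- rewrite csum_cat csum_cons.
  have -> : (csum J3 f + csum J1 f - (h b + csum Bs h) = (csum J3 f - h b) + (csum J1 f - csum Bs h))%C by ring.
  apply: Rle_lt_trans (Cmod_triangle _ _) _; lra.
rewrite rsum_cat rsum_cons.
have t := Cmod_triangle (h b - csum J3 f) (csum J3 f).
have e : (h b - csum J3 f + csum J3 f = h b)%C by ring.
rewrite e (Cmod_sym (h b)) in t.
have := csum_norm J3 f; lra.
Qed.

Lemma has_sum_regroup (f : I -> C) l (h : B -> C) : has_sum f l ->
  (forall b, has_sum (fun i => if phi i == b then f i else RtoC 0) (h b)) -> has_sum h l.
Proof.
move=> H K eps e0.
have [J0 H0] := H (eps / 2) ltac:(lra).
exists (map phi J0) => Bs UB SB.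
have [J1 [U1 S1 D1 _]] := fiber_approx f h J0 K Bs (eps / 2) ltac:(lra) UB.
have k := H0 J1 U1 (fun i hi => S1 i hi (SB _ (map_f phi hi))).
have -> : (csum Bs h - l = (csum Bs h - csum J1 f) + (csum J1 f - l))%C by ring.
apply: Rle_lt_trans (Cmod_triangle _ _) _; rewrite (Cmod_sym (csum Bs h)); lra.
Qed.

Lemma bounded_regroup (f : I -> C) M (h : B -> C) : bounded f M ->
  (forall b, has_sum (fun i => if phi i == b then f i else RtoC 0) (h b)) -> bounded h M.
Proof.
move=> Bf K Bs UB; apply: le_epsilon => eps e0.
have [J1 [U1 _ _ D1]] := fiber_approx f h [::] K Bs eps e0 UB.
have := Bf J1 U1; lra.
Qed.

Lemma bounded_fiber (f : I -> C) M b : bounded f M -> bounded (fun i => if phi i == b then f i else RtoC 0) M.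
Proof.
by apply: bounded_dom => i; case: ifP => _; [lra|rewrite Cmod_0; exact: Cmod_ge_0].
Qed.
End Regroup.

Section Inj.
Context {I J : eqType} (h : J -> I) (hi : injective h).
Lemma csum_map (K : seq J) (f : I -> C) : csum (map h K) f = csum K (fun j => f (h j)).
Proof. by rewrite /csum big_map. Qed.
Lemma has_sum_inj (f : I -> C) l : (forall i, f i <> RtoC 0 -> exists j, h j = i) ->
  has_sum f l -> has_sum (fun j => f (h j)) l.
Proof.
move=> S H eps e0; have [J0 H0] := H eps e0; have [K0 HK] := preimages h hi J0.
exists K0 => K U SK; set E := [seq i <- undup J0 | i \notin map h K].
have e1 : csum E f = RtoC 0.
  rewrite /csum big1_seq // => i /andP [_]; rewrite mem_filter mem_undup => /andP [n m].
  case: (excluded_middle_informative (f i = RtoC 0)) => // /S [j ej].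
  by case/negP: n; apply/mapP; exists j => //; apply: SK; apply: HK; rewrite ej.
have := H0 (map h K ++ E); rewrite csum_cat e1 csum_map Cplus_comm Cplus_0 => k; apply: k.
  rewrite cat_uniq map_inj_uniq // U filter_uniq ?undup_uniq // andbT /=.
  by apply/hasPn => i; rewrite mem_filter => /andP [].
move=> i mi; rewrite mem_cat mem_filter mem_undup mi andbT; by case: (i \in map h K).
Qed.
End Inj.

Section Product.
Context {I J : eqType}.
Lemma bounded_prod (f : I -> C) (h : J -> C) M N : bounded f M -> bounded h N ->
  bounded (fun x : I * J => f x.1 * h x.2)%C (M * N).
Proof.
move=> Bf Bh K U.
set A := undup (map fst K); set B := undup (map snd K).
apply: (Rle_trans _ (rsum (allpairs pair A B) (fun x => Cmod (f x.1 * h x.2)))).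
  apply: rsum_sub => // [i|[x y] m]; first exact: Cmod_ge_0.
  by apply: allpairs_f; rewrite mem_undup; [exact: (map_f fst m)|exact: (map_f snd m)].
have -> : rsum (allpairs pair A B) (fun x => Cmod (f x.1 * h x.2)) =
  rsum A (fun i => Cmod (f i)) * rsum B (fun j => Cmod (h j)).
  elim: A => [|i A IH]; first by rewrite /= !rsum_nil; ring.
  rewrite /= rsum_cat rsum_cons IH Rmult_plus_distr_r; congr Rplus.
  rewrite /rsum big_map -/(rsum B _) -/(rsum B _) -rsum_scal; congr rsum.
  by apply: functional_extensionality => j; rewrite Cmod_mult.
apply: Rmult_le_compat; try (apply: rsum_pos => ?; exact: Cmod_ge_0).
  by apply: Bf; exact: undup_uniq.
by apply: Bh; exact: undup_uniq.
Qed.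

(** Summability of the double family is clear from the bound; its value is found by
    summing over the second variable first. *)
Lemma has_sum_prod (f : I -> C) (h : J -> C) M N l m : bounded f M -> bounded h N ->
  has_sum f l -> has_sum h m -> has_sum (fun x : I * J => f x.1 * h x.2)%C (l * m)%C.
Proof.
move=> Bf Bh Hf Hh; have [s Hs] := has_sum_ex _ _ (bounded_prod _ _ _ _ Bf Bh).
have K : has_sum (fun i => m * f i)%C s.
  apply: (has_sum_regroup fst _ _ _ Hs) => b.
  have inj : injective (fun j : J => (b, j)) by move=> x y [].
  have [l' Hl'] := has_sum_ex _ _ (bounded_fiber fst _ _ b (bounded_prod _ _ _ _ Bf Bh)).
  have := has_sum_inj _ inj _ _ _ Hl' => /= e.
  have {}e : has_sum (fun j => f b * h j)%C l'.
    apply: (has_sum_ext (fun j : J => if b == b then f b * h j else RtoC 0)%C); first by move=> j; rewrite eqxx.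
    by apply: e => -[x y] /=; case: eqP => // -> _; exists y.
  by have -> : (m * f b = l')%C by rewrite Cmult_comm; apply: has_sum_uniq (has_sum_scal _ _ _ Hh) e.
by have -> : (l * m = s)%C by rewrite Cmult_comm; apply: has_sum_uniq (has_sum_scal _ _ _ Hf) K.
Qed.
End Product.

Lemma sum_n_csum (f : nat -> C) n : @sum_n C_AbelianMonoid f n = csum (iota 0 n.+1) f.
Proof.
elim: n => [|n IH]; first by rewrite sum_O -[iota 0 1]/[:: 0%N] csum_cons csum_nil Cplus_comm Cplus_0.
rewrite sum_Sn IH -[in RHS](addn1 n.+1) iotaD csum_cat add0n -[iota n.+1 1]/[:: n.+1] csum_cons csum_nil.
by rewrite /plus /=; ring.
Qed.

Lemma has_sum_nat (f : nat -> C) l : has_sum f l -> forall eps, 0 < eps ->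
  exists N, forall n, (N <= n)%N -> Cmod (@sum_n C_AbelianMonoid f n - l) < eps.
Proof.
move=> H eps e0; have [J0 H0] := H eps e0.
exists (\max_(j <- J0) j)%N => n Hn; rewrite sum_n_csum; apply: H0; first exact: iota_uniq.
by move=> j mj; rewrite mem_iota /= add0n ltnS; apply: leq_trans Hn; exact: leq_bigmax_seq.
Qed.

Lemma has_sum_series (f : nat -> C) l : has_sum f l ->
  @is_series C_AbsRing C_NormedModule f l.
Proof.
move=> H P [eps HP]; have [N HN] := has_sum_nat f l H eps (cond_pos eps).
by exists N => n /leP Hn; apply: HP; apply: C_NormedModule_mixin_compat1; exact: HN.
Qed.

(** * Values of power series and the convergence of the Euler product *)

(** For terms >= 0 the value of the sum bounds the partial sums, so a bound on the value
    alone gives absolute summability. *)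
Lemma has_sum_bounded_pos {I : eqType} (f : I -> R) l : (forall i, 0 <= f i) ->
  has_sum (fun i => RtoC (f i)) l -> bounded (fun i => RtoC (f i)) (Cmod l).
Proof.
move=> p0 H J U; apply: le_epsilon => eps e0.
have [J0 H0] := H eps e0.
have e K : csum K (fun i => RtoC (f i)) = RtoC (rsum K f).
  by elim: K => [|i K IH]; rewrite ?csum_nil ?rsum_nil ?csum_cons ?rsum_cons ?IH ?RtoC_plus.
have e2 K : rsum K (fun i => Cmod (RtoC (f i))) = rsum K f.
  by congr rsum; apply: functional_extensionality => i; rewrite Cmod_R Rabs_pos_eq.
have := H0 (undup (J ++ J0)) (undup_uniq _).
rewrite e e2 => K; set s := undup (J ++ J0) in K.
have {}K : Cmod (RtoC (rsum s f) - l) < eps by apply: K => i hi; rewrite mem_undup mem_cat hi orbT.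
have L : rsum J f <= rsum s f.
  by apply: rsum_sub => // i hi; rewrite mem_undup mem_cat hi.
have := Cmod_triangle (RtoC (rsum s f) - l) l.
have -> : (RtoC (rsum s f) - l + l = RtoC (rsum s f))%C by ring.
rewrite Cmod_R Rabs_pos_eq; last exact: rsum_pos.
lra.
Qed.

Definition term (f : ser) (Q : C) (n : nat) : C := (RtoC (IZR (f n)) * Q ^ n)%C.
(** v is the value of the absolutely convergent series f at Q; absolute convergence
    is part of the notion because products need it. *)
Definition ev (f : ser) (Q v : C) : Prop := has_sum (term f Q) v /\ exists M, bounded (term f Q) M.

Lemma ev_uniq f Q v w : ev f Q v -> ev f Q w -> v = w.
Proof. by move=> [H _] [K _]; apply: has_sum_uniq H K. Qed.

Lemma ev_mul f g Q v w : ev f Q v -> ev g Q w -> ev (Ser.mul f g) Q (v * w)%C.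
Proof.
move=> [Hf [M Bf]] [Hg [N Bg]].
have P := has_sum_prod _ _ _ _ _ _ Bf Bg Hf Hg.
have BP := bounded_prod _ _ _ _ Bf Bg.
have F n : has_sum (fun x : nat * nat => if (x.1 + x.2)%N == n then (term f Q x.1 * term g Q x.2)%C else RtoC 0)
   (term (Ser.mul f g) Q n).
  set L := [seq (i, (n - i)%N) | i <- iota 0 n.+1].
  have UL : uniq L by rewrite map_inj_uniq ?iota_uniq // => i j [].
  have -> : term (Ser.mul f g) Q n = csum L (fun x : nat * nat => if (x.1 + x.2)%N == n then (term f Q x.1 * term g Q x.2)%C else RtoC 0).
    rewrite /term mul_coef /L /csum big_map.
    have : forall s, (forall i, i \in s -> (i <= n)%N) ->
      (IZR (\zsum_(i <- s) (f i * g (n - i)%N)) * Q ^ n)%C =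
       \big[Cplus/RtoC 0]_(i <- s) (if (i + (n - i))%N == n then (IZR (f i) * Q ^ i * (IZR (g (n - i)%N) * Q ^ (n - i)))%C else RtoC 0).
      elim=> [|i s IH] Hs; first by rewrite !big_nil; ring.
      have Hi : (i <= n)%N by apply: Hs; rewrite in_cons eqxx.
      rewrite !big_cons -IH; last by move=> j hj; apply: Hs; rewrite in_cons hj orbT.
      rewrite subnKC // eqxx plus_IZR mult_IZR RtoC_plus RtoC_mult.
      have -> : (Q ^ n = Q ^ i * Q ^ (n - i))%C by rewrite -Cpow_add_r; congr Cpow; lia.
      by ring.
    by apply=> i; rewrite mem_iota /= add0n ltnS.
  apply: has_sum_finite => // -[i j] /=; case: eqP => // e _.
  by apply/mapP; exists i; [rewrite mem_iota; apply/andP; split=> //; lia|congr pair; lia].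
split; first exact: (has_sum_regroup (fun x : nat * nat => (x.1 + x.2)%N) _ _ _ P F).
by exists (M * N); exact: (bounded_regroup (fun x : nat * nat => (x.1 + x.2)%N) _ _ _ BP F).
Qed.

Lemma ev_finite f Q (N : nat) : (forall n, (N <= n)%N -> f n = 0%Z) -> ev f Q (csum (iota 0 N) (term f Q)).
Proof.
move=> H.
have K n : term f Q n <> RtoC 0 -> n \in iota 0 N.
  rewrite mem_iota /= add0n ltnNge => nz; apply/negP => h; apply: nz.
  by rewrite /term H //; ring.
split; first exact: has_sum_finite (iota_uniq _ _) K.
exists (rsum (iota 0 N) (fun i => Cmod (term f Q i))) => J U.
have -> : rsum J (fun i => Cmod (term f Q i)) = rsum [seq i <- J | i \in iota 0 N] (fun i => Cmod (term f Q i)).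
  rewrite rsum_filter; congr rsum; apply: functional_extensionality => i; case: ifP => // n.
  case: (excluded_middle_informative (term f Q i = RtoC 0)) => [->|/K]; first by rewrite Cmod_0.
  by rewrite n.
apply: rsum_sub; [move=> i; exact: Cmod_ge_0|by rewrite filter_uniq|by move=> i; rewrite mem_filter => /andP []].
Qed.

Lemma ev_cst c Q : ev (Ser.cst c) Q (RtoC (IZR c)).
Proof.
have := ev_finite (Ser.cst c) Q 1 _.
rewrite -[iota 0 1]/[:: 0%N] csum_cons csum_nil /term /=.
have -> : (IZR c * RtoC 1 + RtoC 0 = IZR c)%C by ring.
by apply => -[|n].
Qed.

Lemma ev_add f g Q v w : ev f Q v -> ev g Q w -> ev (Ser.add f g) Q (v + w)%C.
Proof.
move=> [Hf [M Bf]] [Hg [N Bg]].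
have e i : (term f Q i + term g Q i)%C = term (Ser.add f g) Q i.
  by rewrite /term add_coef plus_IZR RtoC_plus; ring.
split; first exact: has_sum_ext e (has_sum_add _ _ _ _ Hf Hg).
exists (M + N) => J U; apply: Rle_trans (Rplus_le_compat _ _ _ _ (Bf J U) (Bg J U)).
have -> : rsum J (fun i => Cmod (term f Q i)) + rsum J (fun i => Cmod (term g Q i)) =
  rsum J (fun i => Cmod (term f Q i) + Cmod (term g Q i)) by rewrite /rsum big_split.
by apply: rsum_le => i; rewrite -e; exact: Cmod_triangle.
Qed.

Lemma ev_var Q : ev Ser.var Q Q.
Proof.
have := ev_finite Ser.var Q 2 _.
rewrite -[iota 0 2]/[:: 0%N; 1%N] !csum_cons csum_nil /term /=.
have -> : (0%R * RtoC 1 + (1%R * (Q * RtoC 1) + RtoC 0) = Q)%C by ring.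
by apply => -[|[|n]].
Qed.

Lemma ev_pow f Q v n : ev f Q v -> ev (Ser.pow f n) Q (v ^ n)%C.
Proof. by move=> H; elim: n => [|n IH] /=; [exact: ev_cst|exact: ev_mul]. Qed.

Fixpoint poch_at (Q : C) (n : nat) : C := match n with O => RtoC 1 | S m => (poch_at Q m * (1 - Q ^ n))%C end.

Lemma ev_1m n Q : ev (Ser.sub (Ser.cst 1) (Ser.pow Ser.var n)) Q (1 - Q ^ n)%C.
Proof.
have -> : (Ser.sub (Ser.cst 1) (Ser.pow Ser.var n) = Ser.add (Ser.cst 1) (Ser.mul (Ser.cst (-1)) (Ser.pow Ser.var n))).
  by ring.
have -> : (1 - Q ^ n = 1%R + (-1)%R * Q ^ n)%C by ring.
by apply: ev_add; [exact: ev_cst|apply: ev_mul; [exact: ev_cst|apply: ev_pow; exact: ev_var]].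
Qed.
Lemma ev_poch n Q : ev (poch n) Q (poch_at Q n).
Proof. by elim: n => [|n IH]; [exact: ev_cst|apply: ev_mul => //; exact: (ev_1m n.+1)]. Qed.

Lemma geom_sum x N : 0 <= x < 1 -> rsum (iota 0 N) (fun n => x ^ n) <= / (1 - x).
Proof.
move=> H.
have -> : rsum (iota 0 N) (fun n => x ^ n) = (1 - x ^ N) / (1 - x).
  elim: N => [|N IH]; first by rewrite rsum_nil /=; field; lra.
  by rewrite -addn1 iotaD rsum_cat IH add0n -[iota N 1]/[:: N] rsum_cons rsum_nil addn1 /=; field; lra.
rewrite /Rdiv -[X in _ <= X]Rmult_1_l; apply: Rmult_le_compat_r.
  by apply: Rlt_le; apply: Rinv_0_lt_compat; lra.
have := pow_le x N; lra.
Qed.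
Lemma bounded_nat (f : nat -> C) M : (forall N, rsum (iota 0 N) (fun i => Cmod (f i)) <= M) -> bounded f M.
Proof.
move=> H J U; apply: Rle_trans (H (\max_(j <- J) j).+1).
apply: rsum_sub => // [i|i mi]; first exact: Cmod_ge_0.
by rewrite mem_iota /= add0n ltnS; exact: leq_bigmax_seq.
Qed.
Lemma bounded_geom x : 0 <= x < 1 -> bounded (fun n => RtoC (x ^ n)) (/ (1 - x)).
Proof.
move=> H; apply: bounded_nat => N; apply: Rle_trans (geom_sum x N H).
by apply: rsum_le => i; rewrite Cmod_R Rabs_pos_eq; [lra|apply: pow_le; lra].
Qed.

Lemma Cmod_pow Q n : Cmod (Q ^ n)%C = Cmod Q ^ n.
Proof. by elim: n => [|n IH] /=; rewrite ?Cmod_1 ?Cmod_mult ?IH. Qed.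

Lemma ev_geo_ex m Q : Cmod Q < 1 -> exists v, ev (geo m) Q v.
Proof.
move=> q1.
have B : bounded (term (geo m) Q) (/ (1 - Cmod Q)).
  apply: bounded_dom (bounded_geom (Cmod Q) _); last by have := Cmod_ge_0 Q; lra.
  move=> n; rewrite /term Cmod_mult !Cmod_R Cmod_pow (Rabs_pos_eq (_ ^ _)); last by apply: pow_le; exact: Cmod_ge_0.
  have := pow_le (Cmod Q) n (Cmod_ge_0 Q) => h.
  by rewrite /geo; case: ifP => _; rewrite ?Rabs_R1 ?Rabs_R0; lra.
by have [v Hv] := has_sum_ex _ _ B; exists v; split=> //; exists (/ (1 - Cmod Q)).
Qed.

Lemma ev_inv_poch n Q : Cmod Q < 1 -> exists v, ev (inv_poch n) Q v /\ (poch_at Q n * v = 1)%C.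
Proof.
move=> q1.
have [v Hv] : exists v, ev (inv_poch n) Q v.
  elim: n => [|n [v IH]]; first by exists (RtoC 1); exact: ev_cst.
  have [w Hw] := ev_geo_ex (S n) Q q1.
  by exists (v * w)%C; apply: ev_mul.
exists v; split=> //; have := ev_mul _ _ _ _ _ (ev_poch n Q) Hv; rewrite poch_inv => h.
exact: ev_uniq h (ev_cst 1 Q).
Qed.

Lemma mulc_ge f g n : (forall i, (0 <= f i)%Z) -> (forall i, (0 <= g i)%Z) -> (f n * g O <= Ser.mul f g n)%Z.
Proof.
move=> f0 g0; rewrite Ser.mulC mul_coef.
have -> : iota 0 n.+1 = 0%N :: iota 1 n by [].
rewrite big_cons subn0.
suff : (0 <= \zsum_(i <- iota 1 n) (g i * f (n - i)%N))%Z by lia.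
by elim: (iota 1 n) => [|i s IH]; rewrite ?big_nil ?big_cons; [lia|have := f0 (n - i)%N; have := g0 i; nia].
Qed.
Lemma geo_ge0 m n : (0 <= geo m n)%Z. Proof. by rewrite /geo; case: ifP. Qed.
Lemma mul_pos f g n : (forall i, (0 <= f i)%Z) -> (forall i, (0 <= g i)%Z) -> (0 <= Ser.mul f g n)%Z.
Proof. by move=> f0 g0; have := mulc_ge f g n f0 g0; have := f0 n; have := g0 O; nia. Qed.
Lemma inv_poch_ge0 m n : (0 <= inv_poch m n)%Z.
Proof. by elim: m n => [|m IH] n; [case: n|apply: mul_pos => // i; exact: geo_ge0]. Qed.
Lemma geo0 m : geo m O = 1%Z.
Proof. by rewrite /geo PeanoNat.Nat.Div0.mod_0_l. Qed.
(** Each factor 1/(1 - q^m) has constant term 1 and coefficients >= 0. The coefficients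
    of 1/(q;q)_m thus increase to the partition numbers, which gives the domination needed for
    the passage to the infinite product. *)
Lemma inv_poch_mono m d n : (inv_poch m n <= inv_poch (m + d) n)%Z.
Proof.
elim: d => [|d IH]; first by rewrite addn0; lia.
rewrite addnS; have := mulc_ge (inv_poch (m + d)) (geo (S (m + d))) n (inv_poch_ge0 _) (geo_ge0 _).
by rewrite geo0 -/(inv_poch (m + d).+1); lia.
Qed.
Lemma partitions_coef m n : (n <= m)%N -> p n = inv_poch m n.
Proof. by move=> H; apply: (partitions_inv_poch m); lia. Qed.
Lemma inv_poch_le_partitions m n : (inv_poch m n <= p n)%Z.
Proof.
rewrite (partitions_coef (m + n)); first exact: inv_poch_mono.
by rewrite leq_addl.
Qed.

Lemma rsum_iota1 n f : rsum (iota 1 n.+1) f = rsum (iota 1 n) f + f n.+1.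
Proof. by rewrite -[in LHS](addn1 n) iotaD rsum_cat -[iota (1 + n) 1]/[:: n.+1] rsum_cons rsum_nil Rplus_0_r. Qed.

(** 1 - y >= exp(-y/(1-x)) for 0 <= y <= x, applied to each factor. *)
Lemma poch_at_lower x n : 0 <= x < 1 -> exp (- (/ (1 - x) * rsum (iota 1 n) (fun m => x ^ m))) <= Cmod (poch_at (RtoC x) n).
Proof.
move=> H; elim: n => [|n IH]; first by rewrite rsum_nil Rmult_0_r Ropp_0 exp_0 /= Cmod_1; lra.
rewrite rsum_iota1 [poch_at _ n.+1]/= Cmod_mult.
set s := rsum _ _ in IH *.
have y0 : 0 <= x ^ n.+1 by apply: pow_le; lra.
have y1 : x ^ n.+1 <= x.
  have : x ^ n <= 1 by rewrite -(pow1 n); apply: pow_incr; lra.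
  by rewrite /=; nra.
have -> : Cmod (1 - RtoC x * RtoC x ^ n) = 1 - x ^ n.+1.
  have -> : (1 - RtoC x * RtoC x ^ n = RtoC (1 - x ^ n.+1))%C by rewrite RtoC_minus /= RtoC_mult RtoC_pow.
  by rewrite Cmod_R Rabs_pos_eq; lra.
set y := x ^ n.+1 in y0 y1 *.
have -> : - (/ (1 - x) * (s + y)) = - (/ (1 - x) * s) + - (/ (1 - x) * y) by ring.
rewrite exp_plus; apply: Rmult_le_compat => //; try (apply: Rlt_le; exact: exp_pos).
rewrite exp_Ropp -[X in _ <= X]Rinv_inv; apply: Rinv_le_contravar; first by apply: Rinv_0_lt_compat; lra.
apply: Rle_trans (exp_ineq1_le _).
have k0 : 0 < 1 - x by lra.
have : / (1 - y) <= / (1 - x) by apply: Rinv_le_contravar; lra.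
have e1 : / (1 - y) * (1 - y) = 1 by field; lra.
nra.
Qed.

Definition inv_poch_bound x : R := exp (/ (1 - x) * / (1 - x)).

Lemma poch_at_bound x n : 0 <= x < 1 -> / inv_poch_bound x <= Cmod (poch_at (RtoC x) n).
Proof.
move=> H; apply: Rle_trans (poch_at_lower x n H).
rewrite /inv_poch_bound -exp_Ropp.
have L : / (1 - x) * rsum (iota 1 n) (fun m => x ^ m) <= / (1 - x) * / (1 - x).
  apply: Rmult_le_compat_l; first by apply: Rlt_le; apply: Rinv_0_lt_compat; lra.
  apply: Rle_trans (geom_sum x n.+1 H).
  have -> : iota 0 n.+1 = 0%N :: iota 1 n by [].
  by rewrite rsum_cons /=; lra.
have [e|l] : / (1 - x) * rsum (iota 1 n) (fun m => x ^ m) = / (1 - x) * / (1 - x) \/ / (1 - x) * rsum (iota 1 n) (fun m => x ^ m) < / (1 - x) * / (1 - x) by lra.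
  by rewrite e; lra.
by apply: Rlt_le; apply: exp_increasing; lra.
Qed.

(** A partial sum of the partition series is one of 1/(q;q)_N for N large, whose value is
    bounded independently of N by poch_at_bound. *)
Lemma partitions_bounded_real x : 0 <= x < 1 -> bounded (term p (RtoC x)) (inv_poch_bound x).
Proof.
move=> H; apply: bounded_nat => N.
have q1 : Cmod (RtoC x) < 1 by rewrite Cmod_R Rabs_pos_eq; lra.
have [v [[Hv _] PV]] := ev_inv_poch N (RtoC x) q1.
have e n : term (inv_poch N) (RtoC x) n = RtoC (IZR (inv_poch N n) * x ^ n) by rewrite /term RtoC_mult RtoC_pow.
have Hv' := has_sum_ext _ _ _ e Hv.
have pos n : 0 <= IZR (inv_poch N n) * x ^ n.
  by apply: Rmult_le_pos; [apply: IZR_le; exact: inv_poch_ge0|apply: pow_le; lra].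
have B := has_sum_bounded_pos _ _ pos Hv' (iota 0 N) (iota_uniq _ _).
have -> : rsum (iota 0 N) (fun i => Cmod (term p (RtoC x) i)) = rsum (iota 0 N) (fun i => Cmod (RtoC (IZR (inv_poch N i) * x ^ i))).
  rewrite /rsum big_seq [RHS]big_seq; apply: eq_bigr => i; rewrite mem_iota /= add0n => hi.
  by rewrite -e /term (partitions_coef N) // ltnW.
apply: Rle_trans B _.
have L := poch_at_bound x N H.
have := f_equal Cmod PV; rewrite Cmod_mult Cmod_1 => m.
have K0 : 0 < inv_poch_bound x by exact: exp_pos.
have : / inv_poch_bound x * Cmod v <= 1 by rewrite -m; apply: Rmult_le_compat_r => //; exact: Cmod_ge_0.
move=> h; have : inv_poch_bound x * (/ inv_poch_bound x * Cmod v) <= inv_poch_bound x * 1 by apply: Rmult_le_compat_l; lra.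
have -> : inv_poch_bound x * (/ inv_poch_bound x * Cmod v) = Cmod v by field; lra.
lra.
Qed.

Lemma term_norm f Q n : Cmod (term f Q n) = Rabs (IZR (f n)) * Cmod Q ^ n.
Proof. by rewrite /term Cmod_mult Cmod_R Cmod_pow. Qed.

Lemma partitions_bounded Q : Cmod Q < 1 -> bounded (term p Q) (inv_poch_bound (Cmod Q)).
Proof.
move=> q1; have q0 := Cmod_ge_0 Q; apply: bounded_dom (partitions_bounded_real (Cmod Q) (conj q0 q1)).
by move=> n; rewrite !term_norm Cmod_R (Rabs_pos_eq (Cmod Q)) //; lra.
Qed.

Lemma ev_partitions Q : Cmod Q < 1 -> exists v, ev p Q v.
Proof.
move=> q1; have B := partitions_bounded Q q1; have [v Hv] := has_sum_ex _ _ B.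
by exists v; split=> //; exists (inv_poch_bound (Cmod Q)).
Qed.

(** The difference of 1/(q;q)_n and the partition series has no terms in degrees <= n,
    and beyond these it is dominated by the tail of the partition series. *)
Lemma poch_at_inv_lim Q v : Cmod Q < 1 -> ev p Q v -> forall eps, 0 < eps ->
  exists N, forall n, (N <= n)%N -> exists w, (poch_at Q n * w = 1)%C /\ Cmod (w - v) < eps.
Proof.
move=> q1 [Hv _] eps e0.
have [J0 [U0 T0]] := bounded_tail _ _ (partitions_bounded Q q1) (eps / 2) ltac:(lra).
exists (\max_(j <- J0) j)%N => n Hn.
have [w [[Hw _] PW]] := ev_inv_poch n Q q1; exists w; split=> //.
have D := has_sum_add _ _ _ _ Hw (has_sum_scal (-1)%R _ _ Hv).
have -> : (w - v = w + (-1)%R * v)%C by ring.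
apply: (Rle_lt_trans _ (eps / 2)); last by lra.
apply: has_sum_le D _ => J U.
set h := fun i => Cmod _.
have hE i : h i <= (if i \notin J0 then Cmod (term p Q i) else 0).
  rewrite /h; have -> : (term (inv_poch n) Q i + (-1)%R * term p Q i = RtoC (IZR (inv_poch n i - p i)) * Q ^ i)%C.
    by rewrite /term minus_IZR RtoC_minus; ring.
  rewrite Cmod_mult Cmod_R Cmod_pow term_norm.
  have P0 := pow_le _ i (Cmod_ge_0 Q).
  case: ifP => [_|/negbFE m].
    apply: Rmult_le_compat_r => //; rewrite !Rabs_Zabs; apply: IZR_le.
    have := inv_poch_le_partitions n i; have := inv_poch_ge0 n i; lia.
  have -> : (inv_poch n i - p i)%Z = 0%Z.
    rewrite (partitions_coef n); first by lia.
    by apply: leq_trans Hn; exact: leq_bigmax_seq.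
  by rewrite Rabs_R0; lra.
apply: (Rle_trans _ (rsum J (fun i => if i \notin J0 then Cmod (term p Q i) else 0))); first exact: rsum_le.
rewrite -(rsum_filter J (fun i => i \notin J0)); apply: Rlt_le; apply: T0; first by rewrite filter_uniq.
by move=> i; rewrite mem_filter => /andP [].
Qed.

Lemma poch_at_upper Q n : Cmod Q < 1 -> Cmod (poch_at Q n) <= exp (/ (1 - Cmod Q)).
Proof.
move=> q1; have q0 := Cmod_ge_0 Q.
have H : Cmod (poch_at Q n) <= exp (rsum (iota 1 n) (fun m => Cmod Q ^ m)).
  elim: n => [|n IH]; first by rewrite rsum_nil exp_0 /= Cmod_1; lra.
  rewrite rsum_iota1 [poch_at _ n.+1]/= Cmod_mult exp_plus.
  apply: Rmult_le_compat => //; try exact: Cmod_ge_0.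
  apply: Rle_trans (exp_ineq1_le _); apply: Rle_trans (Cmod_triangle _ _) _.
  rewrite Cmod_1 Cmod_opp Cmod_mult Cmod_pow -/(Cmod Q ^ n.+1); lra.
apply: Rle_trans H _.
have := geom_sum (Cmod Q) n.+1 (conj q0 q1).
have -> : iota 0 n.+1 = 0%N :: iota 1 n by [].
rewrite rsum_cons /= => L; apply: Rlt_le; apply: exp_increasing; lra.
Qed.

(** The partial products are bounded, so the limit of their inverses is nonzero and
    inversion is continuous there. *)
Lemma poch_at_lim Q v : Cmod Q < 1 -> ev p Q v -> v <> RtoC 0 /\
  forall eps, 0 < eps -> exists N, forall n, (N <= n)%N -> Cmod (poch_at Q n - / v) < eps.
Proof.
move=> q1 Ev; set K := exp (/ (1 - Cmod Q)).
have K0 : 0 < K by exact: exp_pos.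
have nz : v <> RtoC 0.
  move=> v0; have [N H] := poch_at_inv_lim Q v q1 Ev (/ K) (Rinv_0_lt_compat _ K0).
  have [w [PW D]] := H N (leqnn N).
  have U := poch_at_upper Q N q1; have := f_equal Cmod PW; rewrite Cmod_mult Cmod_1.
  have e : (w - v = w)%C by rewrite v0; ring.
  rewrite e in D => m.
  have : Cmod (poch_at Q N) * Cmod w <= K * Cmod w by apply: Rmult_le_compat_r => //; exact: Cmod_ge_0.
  have : K * Cmod w < K * / K by apply: Rmult_lt_compat_l.
  have -> : K * / K = 1 by field; lra.
  lra.
split=> // eps e0.
have V0 : 0 < Cmod v by exact: (proj1 (Cmod_gt_0 v)).
have [N H] := poch_at_inv_lim Q v q1 Ev (eps * Cmod v / K) ltac:(apply: Rdiv_lt_0_compat => //; nra).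
exists N => n Hn; have [w [PW D]] := H n Hn.
have -> : (poch_at Q n - / v = poch_at Q n * (v - w) * / v)%C.
  have -> : (poch_at Q n * (v - w) * / v = (poch_at Q n * v - poch_at Q n * w) * / v)%C by ring.
  by rewrite PW; field.
rewrite !Cmod_mult Cmod_inv // Cmod_sym.
have U := poch_at_upper Q n q1; rewrite -/K in U.
apply: (Rle_lt_trans _ (K * Cmod (w - v) * / Cmod v)).
  apply: Rmult_le_compat_r; first by apply: Rlt_le; apply: Rinv_0_lt_compat.
  by apply: Rmult_le_compat_r => //; exact: Cmod_ge_0.
have -> : eps = K * (eps * Cmod v / K) * / Cmod v by field; lra.
apply: Rmult_lt_compat_r; first by apply: Rinv_0_lt_compat.
by apply: Rmult_lt_compat_l.
Qed.

(** * Evaluation of theta, eta and F_6 *)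

Lemma Cexp_add u w : Cexp (u + w)%C = (Cexp u * Cexp w)%C.
Proof.
rewrite /Cexp re_plus im_plus exp_plus cos_plus sin_plus /Cmult /=; congr pair; ring.
Qed.
Lemma Cexp_0 : Cexp (RtoC 0) = RtoC 1.
Proof. by rewrite /Cexp /= exp_0 cos_0 sin_0; congr pair; ring. Qed.
Lemma Cexp_norm w : Cmod (Cexp w) = exp (Re w).
Proof.
rewrite /Cexp /Cmod /=.
have -> : exp (Re w) * cos (Im w) * (exp (Re w) * cos (Im w) * 1) + exp (Re w) * sin (Im w) * (exp (Re w) * sin (Im w) * 1)
  = exp (Re w) * exp (Re w) * (Rsqr (sin (Im w)) + Rsqr (cos (Im w))) by rewrite /Rsqr; ring.
by rewrite sin2_cos2 Rmult_1_r sqrt_square //; apply: Rlt_le; exact: exp_pos.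
Qed.
Lemma Cexp_neq0 w : Cexp w <> RtoC 0.
Proof. by apply/Cmod_gt_0; rewrite Cexp_norm; exact: exp_pos. Qed.

Lemma qpow_add tau x y : qpow tau (x + y) = (qpow tau x * qpow tau y)%C.
Proof. by rewrite /qpow -Cexp_add; congr Cexp; rewrite RtoC_plus; ring. Qed.
Lemma zetapow_add z x y : zetapow z (x + y) = (zetapow z x * zetapow z y)%C.
Proof. by rewrite /zetapow -Cexp_add; congr Cexp; rewrite RtoC_plus; ring. Qed.
Lemma zetapow_z0 x : zetapow (RtoC 0) x = RtoC 1.
Proof. by rewrite /zetapow -Cexp_0; congr Cexp; ring. Qed.
Lemma qpow_nat tau n : qpow tau (INR n) = (qq tau ^ n)%C.
Proof.
elim: n => [|n IH]; first by rewrite /qpow /= -Cexp_0; congr Cexp; ring.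
by rewrite S_INR Rplus_comm qpow_add IH.
Qed.
Lemma zetapow_mul6 z : (zetapow z (1/2) ^ 6)%C = zetapow z 3.
Proof.
rewrite /Cpow Cmult_1_r -!zetapow_add; congr zetapow; lra.
Qed.

Lemma qq_norm tau : Cmod (qq tau) = exp (- (2 * PI * Im tau)).
Proof.
rewrite /qq /qpow Cexp_norm; congr exp; case: tau => x y; rewrite /Ci /=; ring.
Qed.
Lemma qq_lt1 tau : 0 < Im tau -> Cmod (qq tau) < 1.
Proof.
move=> H; rewrite qq_norm -exp_0; apply: exp_increasing.
by have := PI_RGT_0; nra.
Qed.
Lemma zetapow_norm z x : Cmod (zetapow z x) = exp (- (2 * PI * Im z * x)).
Proof. by rewrite /zetapow Cexp_norm; congr exp; case: z => u v; rewrite /Ci /=; ring. Qed.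

Lemma exp_mono x y : x <= y -> exp x <= exp y.
Proof. by move=> [l|->]; [apply: Rlt_le; exact: exp_increasing|lra]. Qed.

Lemma exp_m1 : 0 <= exp (-1) < 1.
Proof. by split; [apply: Rlt_le; exact: exp_pos|rewrite -exp_0; apply: exp_increasing; lra]. Qed.
Lemma exp_opp_INR n : exp (- INR n) = exp (-1) ^ n.
Proof.
elim: n => [|n IH]; first by rewrite /= Ropp_0 exp_0.
by rewrite S_INR Ropp_plus_distr exp_plus IH /= Rmult_comm.
Qed.
Lemma bounded_exp (u : nat -> C) M : 0 <= M -> (forall n, Cmod (u n) <= M * exp (- INR n)) -> exists N, bounded u N.
Proof.
move=> M0 h; exists (Cmod M * / (1 - exp (-1))).
apply: bounded_dom (bounded_scal (RtoC M) _ _ (bounded_geom _ exp_m1)) => n.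
rewrite Cmod_mult !Cmod_R (Rabs_pos_eq M) // Rabs_pos_eq -?exp_opp_INR //; exact: Rlt_le (exp_pos _).
Qed.

(** The summand of theta after extraction of q^(1/8) zeta^(1/2). *)
Definition theta_term tau z (j : Z) : C := (qq tau ^ (Z.to_nat (T j)) * zetapow z (IZR j))%C.

Lemma cos_sin_Z j : cos (2 * PI * IZR j) = 1 /\ sin (2 * PI * IZR j) = 0.
Proof.
have N n : cos (2 * PI * INR n) = 1 /\ sin (2 * PI * INR n) = 0.
  have e : 2 * PI * INR n = 0 + 2 * INR n * PI by ring.
  by rewrite e cos_period sin_period cos_0 sin_0.
case: (Z.le_gt_cases 0 j) => h.
  by have := N (Z.to_nat j); rewrite INR_IZR_INZ Z2Nat.id.
have := N (Z.to_nat (- j)); rewrite INR_IZR_INZ Z2Nat.id; last by lia.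
rewrite opp_IZR; have -> : 2 * PI * - IZR j = - (2 * PI * IZR j) by ring.
rewrite cos_neg sin_neg => -[-> h2]; split=> //; lra.
Qed.
Lemma Cexp_half j : Cexp (2 * PI * Ci * (IZR j + 1 / 2)%R)%C = (- RtoC 1)%C.
Proof.
have -> : (2 * PI * Ci * (IZR j + 1 / 2)%R)%C = (0, 2 * PI * IZR j + PI)%R.
  rewrite /Ci /Cmult /=; congr pair; field.
rewrite /Cexp /= exp_0 neg_cos neg_sin; have [-> ->] := cos_sin_Z j.
by rewrite /RtoC /Copp /=; congr pair; ring.
Qed.

Definition theta_summand tau z (m : R) : C :=
  Cexp (PI * Ci * (m * m)%R * tau + 2 * PI * Ci * m * (z + (1 / 2)%R))%C.

(** m = j + 1/2 gives m^2/2 = T(j) + 1/8, and the two shifts of z by 1/2 amount to the factor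
    e^(2 pi i m) = -1. *)
Lemma theta_summand_shift tau z j :
  theta_summand tau (z + (1 / 2)%R)%C (IZR j + 1 / 2) = (- (qpow tau (1 / 8) * zetapow z (1 / 2)) * theta_term tau z j)%C.
Proof.
rewrite /theta_term -qpow_nat INR_IZR_INZ Z2Nat.id; last exact: T_pos.
have -> : (- (qpow tau (1 / 8) * zetapow z (1 / 2)) * (qpow tau (IZR (T j)) * zetapow z (IZR j)))%C =
  (qpow tau (IZR (T j) + 1 / 8) * zetapow z (IZR j + 1 / 2) * (- RtoC 1))%C.
  by rewrite qpow_add zetapow_add; ring.
rewrite -(Cexp_half j) /qpow /zetapow -!Cexp_add /theta_summand; congr Cexp.
have e : (IZR j + 1 / 2) * (IZR j + 1 / 2) = 2 * (IZR (T j) + 1 / 8).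
  have := f_equal IZR (triZ_double j); rewrite !mult_IZR plus_IZR; lra.
rewrite e RtoC_mult; set m := RtoC (IZR j + 1 / 2); set t := RtoC (IZR (T j) + 1 / 8).
have e2 : (RtoC (1 / 2) + RtoC (1 / 2) = RtoC 1)%C by rewrite -RtoC_plus; congr RtoC; lra.
transitivity (PI * Ci * (2 * t) * tau + 2 * PI * Ci * m * (z + (RtoC (1 / 2) + RtoC (1 / 2))))%C; first by ring.
by rewrite e2; ring.
Qed.

Lemma bounded_Z (f : Z -> C) M N : bounded (fun n => f (Z.of_nat n)) M ->
  bounded (fun n => f (-1 - Z.of_nat n)%Z) N -> bounded f (M + N).
Proof.
move=> B1 B2 J U.
have K (P : pred Z) (h : nat -> Z) (g : Z -> nat) L : (forall j, P j -> h (g j) = j) ->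
   bounded (fun n => f (h n)) L -> rsum [seq j <- J | P j] (fun i => Cmod (f i)) <= L.
  move=> hg B; have := B [seq g j | j <- J & P j].
  have -> : rsum [seq g j | j <- J & P j] (fun i => Cmod (f (h i))) = rsum [seq j <- J | P j] (fun i => Cmod (f i)).
    by rewrite /rsum big_map !big_filter; apply: eq_bigr => j /hg ->.
  apply; rewrite map_inj_in_uniq ?filter_uniq // => i j; rewrite !mem_filter => /andP [pi _] /andP [pj _] e.
  by rewrite -(hg i pi) -(hg j pj) e.
have -> : rsum J (fun i => Cmod (f i)) = rsum [seq j <- J | Z.leb 0 j] (fun i => Cmod (f i)) + rsum [seq j <- J | ~~ Z.leb 0 j] (fun i => Cmod (f i)).
  by rewrite /rsum (bigID (fun j => Z.leb 0 j)) !big_filter.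
apply: Rplus_le_compat.
  by apply: (K _ Z.of_nat Z.to_nat) => // j /Z.leb_le h; rewrite Z2Nat.id.
apply: (K _ (fun n => -1 - Z.of_nat n)%Z (fun j => Z.to_nat (-1 - j))) => // j /negP h.
by rewrite Z2Nat.id; [lia|apply: Znot_gt_le => k; apply: h; apply/Z.leb_le; lia].
Qed.

Lemma theta_term_norm tau z j : Cmod (theta_term tau z j) = exp (- (2 * PI * Im tau * IZR (T j)) - 2 * PI * Im z * IZR j).
Proof.
rewrite /theta_term Cmod_mult zetapow_norm -qpow_nat INR_IZR_INZ Z2Nat.id; last exact: T_pos.
rewrite /qpow Cexp_norm -exp_plus; congr exp; case: tau => x y; rewrite /Ci /=; ring.
Qed.

(** Completing the square bounds the quadratic exponent by a constant minus the absolute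
    value of the index. *)
Lemma theta_term_bounded tau z : 0 < Im tau -> exists M, bounded (theta_term tau z) M.
Proof.
move=> Ht; set A := 2 * PI * Im tau; set b := 2 * PI * Im z.
have A0 : 0 < A by have := PI_RGT_0; rewrite /A; nra.
(* Bb bounds the linear terms, and K is the maximum of Bb x - A x^2 / 2. *)
set Bb := A / 2 + Rabs b + 1.
set K := Bb * Bb / (2 * A).
have D j : Cmod (theta_term tau z j) <= exp K * exp (- Rabs (IZR j)).
  rewrite theta_term_norm -/A -/b -exp_plus; apply: exp_mono.
  have := f_equal IZR (triZ_double j); rewrite !mult_IZR plus_IZR => e.
  have {e}e : A * IZR (T j) = A / 2 * (IZR j * IZR j) + A / 2 * IZR j by nra.
  have h1 : - (b * IZR j) <= Rabs b * Rabs (IZR j).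
    by rewrite -Rabs_mult -Rabs_Ropp; exact: Rle_abs.
  have h2 : - (A / 2 * IZR j) <= A / 2 * Rabs (IZR j).
    by have := Rle_abs (- IZR j); rewrite Rabs_Ropp; nra.
  have h3 : IZR j * IZR j = Rabs (IZR j) * Rabs (IZR j) by rewrite -Rabs_mult Rabs_pos_eq //; nra.
  rewrite e h3; move: (Rabs (IZR j)) h1 h2 => x h1 h2.
  have h4 : 0 <= A / 2 * (x - Bb / A) * (x - Bb / A) by have := pow2_ge_0 (x - Bb / A); nra.
  have h5 : A / 2 * (x - Bb / A) * (x - Bb / A) = A / 2 * (x * x) - Bb * x + K by rewrite /K; field; lra.
  have h6 : Bb * x = A / 2 * x + Rabs b * x + x by rewrite /Bb; ring.
  lra.
have Kp := exp_pos K.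
have [M B1] : exists M, bounded (fun n => theta_term tau z (Z.of_nat n)) M.
  apply: (bounded_exp _ (exp K)) => [|n]; first by lra.
  apply: Rle_trans (D _) _; rewrite -INR_IZR_INZ Rabs_pos_eq; [lra|exact: pos_INR].
have [N B2] : exists N, bounded (fun n => theta_term tau z (-1 - Z.of_nat n)%Z) N.
  apply: (bounded_exp _ (exp K)) => [|n]; first by lra.
  apply: Rle_trans (D _) _; apply: Rmult_le_compat_l; first by lra.
  rewrite minus_IZR -INR_IZR_INZ; apply: exp_mono.
  have -> : IZR (-1) - INR n = - (INR n + 1) by ring.
  rewrite Rabs_Ropp Rabs_pos_eq; have := pos_INR n; lra.
by exists (M + N); exact: bounded_Z.
Qed.

(** The two-sided sums of the definitions are pairs of one-sided ones, starting at 0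
    and at -1. *)
Lemma has_sum_halves (f : Z -> C) l M : has_sum f l -> bounded f M -> exists l1 l2,
  has_sum (fun n => f (Z.of_nat n)) l1 /\ has_sum (fun n => f (-1 - Z.of_nat n)%Z) l2 /\ l = (l1 + l2)%C.
Proof.
move=> H B.
pose f1 j := if Z.leb 0 j then f j else RtoC 0; pose f2 j := if Z.leb 0 j then RtoC 0 else f j.
have B1 : bounded f1 M by apply: bounded_dom B => j; rewrite /f1; case: ifP => _; [lra|rewrite Cmod_0; exact: Cmod_ge_0].
have B2 : bounded f2 M by apply: bounded_dom B => j; rewrite /f2; case: ifP => _; [rewrite Cmod_0; exact: Cmod_ge_0|lra].
have [l1 H1] := has_sum_ex _ _ B1; have [l2 H2] := has_sum_ex _ _ B2.
exists l1, l2; split.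
  apply: (has_sum_ext (fun n => f1 (Z.of_nat n))); last apply: (has_sum_inj Z.of_nat _ _ _ _ H1).
  - by move=> n; rewrite /f1; case: Z.leb_spec => // h; lia.
  - exact: of_nat_inj.
  - by move=> j; rewrite /f1; case: Z.leb_spec => // h _; exists (Z.to_nat j); rewrite Z2Nat.id.
split.
  apply: (has_sum_ext (fun n => f2 (-1 - Z.of_nat n)%Z)); last apply: (has_sum_inj (fun n => -1 - Z.of_nat n)%Z _ _ _ _ H2).
  - by move=> n; rewrite /f2; case: Z.leb_spec => // h; lia.
  - exact: neg_nat_inj.
  - by move=> j; rewrite /f2; case: Z.leb_spec => // h _; exists (Z.to_nat (-1 - j)); rewrite Z2Nat.id; lia.
apply: has_sum_uniq H _; apply: has_sum_ext (has_sum_add _ _ _ _ H1 H2) => j.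
by rewrite /f1 /f2; case: ifP => _; ring.
Qed.

Lemma CLim_eq (u : nat -> C) l : (forall eps, 0 < eps -> exists N, forall n, (N <= n)%N -> Cmod (u n - l) < eps) ->
  CLim u = l.
Proof.
move=> H; rewrite /CLim.
have K (g : C -> R) : (forall x, Rabs (g x) <= Cmod x) -> (forall x y, g (x - y)%C = g x - g y) ->
  real (Lim_seq (fun n => g (u n))) = g l.
  move=> gb gl; have -> : Lim_seq (fun n => g (u n)) = Finite (g l); last by [].
  apply: is_lim_seq_unique; apply/is_lim_seq_spec => eps.
  have [N HN] := H eps (cond_pos eps); exists N => n Hn.
  by rewrite -gl; apply: Rle_lt_trans (gb _) _; apply: HN; apply/leP.
rewrite (K Re) ?(K Im); first by case: (l).
- by move=> x; apply: Rle_trans (Rmax_r _ _) (Rmax_Cmod x).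
- by move=> [a b] [c d].
- by move=> x; apply: Rle_trans (Rmax_l _ _) (Rmax_Cmod x).
- by move=> [a b] [c d].
Qed.

Lemma has_sum_CSeries (f : nat -> C) l : has_sum f l -> CSeries f = l.
Proof. by move=> H; apply: CLim_eq; exact: has_sum_nat. Qed.

Lemma theta_val tau z s M : has_sum (theta_term tau z) s -> bounded (theta_term tau z) M ->
  (- theta tau (z + (1 / 2)%R))%C = (qpow tau (1 / 8) * zetapow z (1 / 2) * s)%C.
Proof.
move=> H B; have [l1 [l2 [H1 [H2 ->]]]] := has_sum_halves _ _ _ H B.
rewrite /theta /CSeries_coset.
set c := (- (qpow tau (1 / 8) * zetapow z (1 / 2)))%C.
rewrite (has_sum_CSeries _ (c * l1)%C); last first.
  apply: has_sum_ext (has_sum_scal c _ _ H1) => n.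
  rewrite -theta_summand_shift /theta_summand; have -> : IZR (Z.of_nat n) + 1 / 2 = 1 / 2 + INR n; last by [].
  by rewrite -INR_IZR_INZ; ring.
rewrite (has_sum_CSeries _ (c * l2)%C); last first.
  apply: has_sum_ext (has_sum_scal c _ _ H2) => n.
  rewrite -theta_summand_shift /theta_summand; have -> : IZR (-1 - Z.of_nat n) + 1 / 2 = 1 / 2 - 1 - INR n; last by [].
  by rewrite minus_IZR -INR_IZR_INZ; lra.
by rewrite /c; ring.
Qed.

Lemma Cprod_poch_at tau n : Cprod (fun j => 1 - qq tau ^ S j)%C n = poch_at (qq tau) n.
Proof. by elim: n => [|n IH] //=; rewrite IH. Qed.

Lemma qpoch_val tau v : 0 < Im tau -> ev p (qq tau) v -> v <> RtoC 0 /\ qpoch_inf tau = (/ v)%C.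
Proof.
move=> Ht Hv; have [nz L] := poch_at_lim _ _ (qq_lt1 _ Ht) Hv; split=> //.
apply: CLim_eq => eps e0; have [N H] := L eps e0; exists N => n Hn.
by rewrite Cprod_poch_at; apply: H.
Qed.

Lemma Fk_val tau z s M v : 0 < Im tau -> has_sum (theta_term tau z) s -> bounded (theta_term tau z) M -> ev p (qq tau) v ->
  Fk 6 tau z = (zetapow z 3 * s ^ 6 * v ^ 6)%C.
Proof.
move=> Ht H B Hv; have [nz qv] := qpoch_val tau v Ht Hv.
rewrite /Fk (theta_val _ _ _ _ H B) /Defs.eta qv -(zetapow_mul6 z).
have -> : qpow tau (1 / 8) = (qpow tau (1 / 12) * qpow tau (1 / 24))%C by rewrite -qpow_add; congr qpow; lra.
have n1 := Cexp_neq0 (2 * PI * Ci * (1 / 12)%R * tau)%C; have n2 := Cexp_neq0 (2 * PI * Ci * (1 / 24)%R * tau)%C.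
rewrite -/(qpow tau (1/12)) in n1; rewrite -/(qpow tau (1 / 24)) in n2.
move: (qpow tau (1 / 12)) (qpow tau (1 / 24)) n1 n2 => x y n1 n2.
have -> : (x * y * zetapow z (1 / 2) * s / (x * (y * / v)) = zetapow z (1 / 2) * s * v)%C.
  by field; repeat split.
by rewrite !Cpow_mult_l; ring.
Qed.

(** * Existence: the Laurent coefficients of F_6 *)

Definition I6 : eqType := ((Z * Z * Z) * (Z * Z * Z))%type.

Definition term6 tau z (x : I6) : C := (qq tau ^ (Z.to_nat (e6 x)) * zetapow z (IZR (s6 x)))%C.

Lemma term6_sum tau z s M : has_sum (theta_term tau z) s -> bounded (theta_term tau z) M ->
  has_sum (term6 tau z) (s ^ 6)%C /\ exists M6, bounded (term6 tau z) M6.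
Proof.
move=> H B.
have B2 := bounded_prod _ _ _ _ B B; have H2 := has_sum_prod _ _ _ _ _ _ B B H H.
have B3 := bounded_prod _ _ _ _ B2 B; have H3 := has_sum_prod _ _ _ _ _ _ B2 B H2 H.
have B6 := bounded_prod _ _ _ _ B3 B3; have H6 := has_sum_prod _ _ _ _ _ _ B3 B3 H3 H3.
have e (x : I6) : (theta_term tau z x.1.1.1 * theta_term tau z x.1.1.2 * theta_term tau z x.1.2 *
    (theta_term tau z x.2.1.1 * theta_term tau z x.2.1.2 * theta_term tau z x.2.2))%C = term6 tau z x.
  case: x => [[[a b] c] [[d f] g]]; rewrite /term6 /e6 /s6 /eT3 /s3 /theta_term; cbn [fst snd].
  have := T_pos a; have := T_pos b; have := T_pos c; have := T_pos d; have := T_pos f; have := T_pos g => t1 t2 t3 t4 t5 t6.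
  have -> : Z.to_nat (T a + T b + T c + (T d + T f + T g)) =
    (Z.to_nat (T a) + Z.to_nat (T b) + Z.to_nat (T c) + (Z.to_nat (T d) + Z.to_nat (T f) + Z.to_nat (T g)))%coq_nat by lia.
  by rewrite !Cpow_add_r !plus_IZR !zetapow_add; ring.
split; last by exists (M * M * M * (M * M * M)); exact: bounded_ext e B6.
have -> : (s ^ 6 = s * s * s * (s * s * s))%C by ring.
exact: has_sum_ext e H6.
Qed.

Definition laurent_term tau (b : Z) (x : I6) : C := if s6 x == b then (qq tau ^ (Z.to_nat (e6 x)))%C else RtoC 0.
(** The coefficient of zeta^b in the sixth power of the sum of q^T(j) zeta^j. *)
Definition laurent_coef tau (b : Z) : C := epsilon (inhabits (RtoC 0)) (has_sum (laurent_term tau b)).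

Lemma laurent_term_bounded tau : 0 < Im tau -> exists M, forall b, bounded (laurent_term tau b) M.
Proof.
move=> Ht; have [M B] := theta_term_bounded tau (RtoC 0) Ht.
have [s H] := has_sum_ex _ _ B; have [_ [M6 B6]] := term6_sum _ _ _ _ H B.
exists M6 => b; apply: bounded_dom B6 => x; rewrite /laurent_term /term6 zetapow_z0.
by case: ifP => _; [rewrite Cmult_1_r; lra|rewrite Cmod_0; exact: Cmod_ge_0].
Qed.

Lemma laurent_coef_spec tau b : 0 < Im tau -> has_sum (laurent_term tau b) (laurent_coef tau b).
Proof.
move=> Ht; apply: (epsilon_spec (inhabits (RtoC 0)) (has_sum (laurent_term tau b))).
have [M B] := laurent_term_bounded tau Ht; exact: has_sum_ex (B b).
Qed.

(** Regrouping the sum over Z^6 by the exponent of zeta. *)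
Lemma laurent_expansion tau z s M : 0 < Im tau -> has_sum (theta_term tau z) s -> bounded (theta_term tau z) M ->
  has_sum (fun b => zetapow z (IZR b) * laurent_coef tau b)%C (s ^ 6)%C /\
  exists N, bounded (fun b => zetapow z (IZR b) * laurent_coef tau b)%C N.
Proof.
move=> Ht H B; have [H6 [M6 B6]] := term6_sum _ _ _ _ H B.
have F b : has_sum (fun x : I6 => if s6 x == b then term6 tau z x else RtoC 0) (zetapow z (IZR b) * laurent_coef tau b)%C.
  apply: has_sum_ext (has_sum_scal (zetapow z (IZR b)) _ _ (laurent_coef_spec tau b Ht)) => x.
  by rewrite /laurent_term /term6; case: eqP => [->|_]; ring.
split; first exact: has_sum_regroup H6 F.
by exists M6; exact: bounded_regroup B6 F.
Qed.

(** Regrouping the sum over Z^6, restricted to coordinate sum -3, by the exponent of q. *)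
Lemma ev_numer6 tau : 0 < Im tau -> ev numer6 (qq tau) (laurent_coef tau (-3)).
Proof.
move=> Ht; have H := laurent_coef_spec tau (-3) Ht; have [M B] := laurent_term_bounded tau Ht.
have F n : has_sum (fun x : I6 => if Z.to_nat (e6 x) == n then laurent_term tau (-3) x else RtoC 0) (term numer6 (qq tau) n).
  have [U L] := fiberP e6 n e6_fin.
  have e6p x : (0 <= e6 x)%Z by rewrite /e6; have := eT3_pos x.1; have := eT3_pos x.2; lia.
  have -> : term numer6 (qq tau) n = csum (fiber e6 n) (fun x : I6 => if Z.to_nat (e6 x) == n then laurent_term tau (-3) x else RtoC 0).
    rewrite /term /numer6 /gen /csum.
    have : forall l : seq I6, (forall x, x \in l -> e6 x = Z.of_nat n) ->
      (IZR (\zsum_(x <- l) (if s6 x == (-3)%Z then 1 else 0)) * qq tau ^ n)%C =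
      \big[Cplus/RtoC 0]_(x <- l) (if Z.to_nat (e6 x) == n then laurent_term tau (-3) x else RtoC 0).
      elim=> [|x l IH] Hl; first by rewrite !big_nil; ring.
      rewrite !big_cons -IH; last by move=> y my; apply: Hl; rewrite in_cons my orbT.
      have ex : e6 x = Z.of_nat n by apply: Hl; rewrite in_cons eqxx.
      rewrite plus_IZR RtoC_plus /laurent_term ex Nat2Z.id eqxx.
      by case: ifP => _; ring.
    by apply=> x; rewrite L => /eqP.
  apply: has_sum_finite => // x; case: eqP => // e _; rewrite L; apply/eqP.
  by rewrite -e Z2Nat.id.
split; first exact: has_sum_regroup H F.
by exists M; exact: bounded_regroup (B (-3)%Z) F.
Qed.

Lemma Int_part_IZR k : Int_part (IZR k) = k.
Proof. by symmetry; apply: Int_part_spec; lra. Qed.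

(** The Laurent coefficient of F_6 at zeta^x is that of the numerator at x - 3, divided by
    E^6; at x = 0 it is numer6 / E^6. *)
Theorem cpsi60_series_is_cpsi : is_cpsi 6 0 cpsi60_series.
Proof.
move=> tau Ht; have [v Hv] := ev_partitions _ (qq_lt1 tau Ht).
exists (fun x => laurent_coef tau (Int_part x - 3) * v ^ 6)%C; split.
  move=> z; have [M B] := theta_term_bounded tau z Ht; have [s H] := has_sum_ex _ _ B.
  have [HA [N BA]] := laurent_expansion _ _ _ _ Ht H B.
  have [l1 [l2 [H1 [H2 el]]]] := has_sum_halves _ _ _ HA BA.
  set c := (v ^ 6 * zetapow z 3)%C.
  have e3 : INR 6 / 2 = 3 by rewrite /=; lra.
  exists (c * l1)%C, (c * l2)%C; split.
    apply: has_sum_series; apply: has_sum_ext (has_sum_scal c _ _ H1) => n.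
    rewrite e3; have -> : 3 + INR n = IZR (Z.of_nat n + 3) by rewrite plus_IZR -INR_IZR_INZ; ring.
    rewrite Int_part_IZR plus_IZR zetapow_add; have -> : (Z.of_nat n + 3 - 3 = Z.of_nat n)%Z by lia.
    by rewrite /c; ring.
  split; last by rewrite (Fk_val _ _ _ _ _ Ht H B Hv) el /c; ring.
  apply: has_sum_series; apply: has_sum_ext (has_sum_scal c _ _ H2) => n.
  rewrite e3; have -> : 3 - 1 - INR n = IZR (-1 - Z.of_nat n + 3) by rewrite plus_IZR minus_IZR -INR_IZR_INZ; ring.
  rewrite Int_part_IZR plus_IZR zetapow_add; have -> : (-1 - Z.of_nat n + 3 - 3 = -1 - Z.of_nat n)%Z by lia.
  by rewrite /c; ring.
rewrite (Int_part_IZR 0); apply: has_sum_series.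
by have [] := ev_mul _ _ _ _ _ (ev_numer6 tau Ht) (ev_pow _ _ _ 6 Hv).
Qed.

(** * Uniqueness of the Laurent coefficients *)

Lemma series_bounded (u : nat -> C) l : is_Cseries u l -> exists M, 0 <= M /\ forall n, Cmod (u n) <= M.
Proof.
move=> H; have [M HM] := @filterlim_bounded C_AbsRing C_NormedModule (sum_n u) (ex_intro _ l H).
have M0 : 0 <= M by apply: Rle_trans (HM 0%N); exact: Cmod_ge_0.
exists (M + M); split; first by lra.
case=> [|n].
  by have := HM 0%N; rewrite sum_O => h; apply: Rle_trans h _; lra.
have e : u n.+1 = (sum_n u n.+1 - sum_n u n)%C :> C by rewrite sum_Sn /plus /=; ring.
rewrite e; apply: Rle_trans (Cmod_triangle _ _) _; rewrite Cmod_opp.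
have h1 : Cmod (sum_n u n.+1) <= M := HM n.+1.
have h2 : Cmod (sum_n u n) <= M := HM n.
lra.
Qed.

Lemma series_uniq (u : nat -> C) l l' : is_Cseries u l -> is_Cseries u l' -> l = l'.
Proof. by move=> H H'; exact: (@filterlim_locally_unique nat C_AbsRing C_NormedModule eventually _ (sum_n u) l l' H H'). Qed.

(** Boundedness against an exponential growing at least like e^y is decay like e^(-y). *)
Lemma exp_decay x w y c M : 0 <= x -> y - c <= w -> x * exp w <= M -> x <= M * exp c * exp (- y).
Proof.
move=> x0 h H; have ep := exp_pos (y - c).
have h2 : x * exp (y - c) <= M by apply: Rle_trans H; apply: Rmult_le_compat_l => //; exact: exp_mono.
have -> : M * exp c * exp (- y) = M * / exp (y - c).
  by rewrite -exp_Ropp Rmult_assoc -exp_plus; congr (_ * exp _); ring.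
have -> : x = x * exp (y - c) * / exp (y - c) by field; lra.
by apply: Rmult_le_compat_r => //; apply: Rlt_le; exact: Rinv_0_lt_compat.
Qed.

(** The definition of an expansion provides two one-sided series, which might converge only
    conditionally. Convergence at z = -i and
    z = i forces exponential decay of the coefficients in both directions, and
    hence absolute summability for real z. *)
Lemma expansion_has_sum tau A : is_zeta_expansion 6 tau A ->
  (exists M, bounded (fun j : Z => A (IZR j + 3)%R) M) /\
  forall x : R, has_sum (fun j : Z => A (IZR j + 3)%R * zetapow (RtoC x) (IZR j + 3)%R)%C (Fk 6 tau (RtoC x)).
Proof.
move=> H; have e6 : INR 6 / 2 = 3 by rewrite /=; lra.
have PI0 := PI2_1; have PIp : 2 < PI by lra.
have [M0 B0] : exists M, bounded (fun n => A (IZR (Z.of_nat n) + 3)) M.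
  (* At z = -i the modulus of zeta^b is e^(2 pi b), and at z = i it is e^(-2 pi b). *)
  have [l1 [l2 [H1 _]]] := H (- Ci)%C; have [M [M0 HM]] := series_bounded _ _ H1.
  apply: (bounded_exp _ (M * exp 0)) => [|n]; first by apply: Rmult_le_pos => //; exact: Rlt_le (exp_pos _).
  have := HM n; rewrite e6 Cmod_mult zetapow_norm -INR_IZR_INZ Rplus_comm.
  apply: exp_decay; first exact: Cmod_ge_0.
  by have -> : Im (- Ci)%C = -1; [rewrite /Ci /=; ring|have := pos_INR n; nra].
have [N0 B1] : exists M, bounded (fun n => A (IZR (-1 - Z.of_nat n) + 3)) M.
  have [l1 [l2 [_ [H2 _]]]] := H Ci; have [M [M0' HM]] := series_bounded _ _ H2.
  apply: (bounded_exp _ (M * exp (4 * PI))) => [|n]; first by apply: Rmult_le_pos => //; exact: Rlt_le (exp_pos _).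
  have := HM n; rewrite e6 Cmod_mult zetapow_norm minus_IZR -INR_IZR_INZ.
  have -> : 3 - 1 - INR n = -1 - INR n + 3 by ring.
  apply: exp_decay; first exact: Cmod_ge_0.
  by have -> : Im Ci = 1 by []; have := pos_INR n; nra.
have B := bounded_Z (fun j => A (IZR j + 3)%R) _ _ B0 B1.
split; first by exists (M0 + N0).
move=> x.
have Bx : bounded (fun j : Z => A (IZR j + 3)%R * zetapow (RtoC x) (IZR j + 3)%R)%C (M0 + N0).
  apply: bounded_dom B => j; rewrite Cmod_mult zetapow_norm /=.
  by have -> : - (2 * PI * 0 * (IZR j + 3)%R) = 0 by [ring]; rewrite exp_0; lra.
have [l Hl] := has_sum_ex _ _ Bx; have [m1 [m2 [K1 [K2 el]]]] := has_sum_halves _ _ _ Hl Bx.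
have [l1 [l2 [H1 [H2 ->]]]] := H (RtoC x).
have -> : l1 = m1.
  apply: series_uniq H1 _; apply: has_sum_series; apply: has_sum_ext K1 => n.
  by rewrite e6 -INR_IZR_INZ Rplus_comm.
have -> : l2 = m2.
  apply: series_uniq H2 _; apply: has_sum_series; apply: has_sum_ext K2 => n.
  rewrite e6; have -> : 3 - 1 - INR n = IZR (-1 - Z.of_nat n) + 3; last by [].
  by rewrite minus_IZR -INR_IZR_INZ; ring.
by rewrite -el.
Qed.

Lemma Cexp_int d : Cexp (2 * PI * Ci * IZR d)%C = RtoC 1.
Proof.
have -> : (2 * PI * Ci * IZR d)%C = (0, 2 * PI * IZR d)%R by rewrite /Ci /Cmult /=; congr pair; ring.
rewrite /Cexp /= exp_0; have [-> ->] := cos_sin_Z d.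
by rewrite /RtoC; congr pair; ring.
Qed.

(** The average of a sum at x and x + 1/2^(k+1) keeps the exponents divisible by
    2^(k+1) among those divisible by 2^k. After k steps every exponent
    of absolute value below 2^k other than 0 has disappeared, and the rest is a tail. *)
Lemma coefficient_zero (D : Z -> C) M : bounded D M ->
  (forall x : R, has_sum (fun j => D j * zetapow (RtoC x) (IZR j + 3)%R)%C (RtoC 0)) -> D (-3)%Z = RtoC 0.
Proof.
move=> B H.
have Pk (k : nat) : forall x : R, has_sum (fun j => if Z.eqb ((j + 3) mod 2 ^ Z.of_nat k) 0
    then D j * zetapow (RtoC x) (IZR j + 3)%R else RtoC 0)%C (RtoC 0).
  elim: k => [|k IH] x.
    by apply: has_sum_ext (H x) => j; rewrite Z.mod_1_r.
  set h := / (2 * IZR (2 ^ Z.of_nat k)).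
  have p0 : (0 < 2 ^ Z.of_nat k)%Z by apply: Z.pow_pos_nonneg; lia.
  have p0R : 0 < IZR (2 ^ Z.of_nat k) by apply: IZR_lt.
  have := has_sum_scal (RtoC (/ 2)) _ _ (has_sum_add _ _ _ _ (IH x) (IH (x + h))).
  have -> : (RtoC (/ 2) * (RtoC 0 + RtoC 0) = RtoC 0)%C by ring.
  apply: has_sum_ext => j; rewrite Nat2Z.inj_succ Z.pow_succ_r; last by lia.
  have zh : zetapow (RtoC (x + h)) (IZR j + 3)%R = (zetapow (RtoC x) (IZR j + 3)%R * zetapow (RtoC h) (IZR j + 3)%R)%C.
    by rewrite /zetapow -Cexp_add; congr Cexp; rewrite (RtoC_plus x h); ring.
  have h2 : (RtoC (/ 2) + RtoC (/ 2) = RtoC 1)%C by rewrite -RtoC_plus; congr RtoC; lra.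
  case: Z.eqb_spec => [e|ne].
    have [c hc] : exists c, (j + 3 = c * 2 ^ Z.of_nat k)%Z by apply/Z.mod_divide => //; lia.
    have ej : IZR j + 3 = IZR c * IZR (2 ^ Z.of_nat k) by rewrite -mult_IZR -hc plus_IZR.
    have [d [ed|ed]] : exists d, c = (2 * d)%Z \/ c = (2 * d + 1)%Z.
      by exists (c / 2)%Z; have := Z_div_mod_eq_full c 2; have := Z.mod_pos_bound c 2; lia.
      have -> : Z.eqb ((j + 3) mod (2 * 2 ^ Z.of_nat k)) 0.
        apply/Z.eqb_eq; rewrite hc ed; have -> : (2 * d * 2 ^ Z.of_nat k = d * (2 * 2 ^ Z.of_nat k))%Z by ring.
        by apply: Z.mod_mul; lia.
      rewrite zh; have -> : zetapow (RtoC h) (IZR j + 3)%R = RtoC 1.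
        rewrite -(Cexp_int d) /zetapow; congr Cexp.
        have -> : IZR d = (IZR j + 3)%R * h by rewrite ej ed mult_IZR /h; field; lra.
        by rewrite RtoC_mult; ring.
      transitivity (D j * zetapow (RtoC x) (IZR j + 3)%R * (RtoC (/ 2) + RtoC (/ 2)))%C; first by ring.
      by rewrite h2; ring.
    have -> : Z.eqb ((j + 3) mod (2 * 2 ^ Z.of_nat k)) 0 = false.
      apply/negbTE/negP => /Z.eqb_eq /Z.mod_divide [|m hm]; first by lia.
      have : (2 * d + 1 = 2 * m)%Z; last by lia.
      by apply: (Z.mul_reg_r _ _ (2 ^ Z.of_nat k)); [lia|rewrite -ed -hc hm; ring].
    rewrite zh; have -> : zetapow (RtoC h) (IZR j + 3)%R = (- RtoC 1)%C.
      rewrite -(Cexp_half d) /zetapow; congr Cexp.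
      have -> : IZR d + 1 / 2 = (IZR j + 3)%R * h by rewrite ej ed plus_IZR mult_IZR /h; field; lra.
      by rewrite RtoC_mult; ring.
    by ring.
  have -> : Z.eqb ((j + 3) mod (2 * 2 ^ Z.of_nat k)) 0 = false.
    apply/negbTE/negP => /Z.eqb_eq /Z.mod_divide [|m hm]; first by lia.
    by apply: ne; rewrite hm; have -> : (m * (2 * 2 ^ Z.of_nat k) = m * 2 * 2 ^ Z.of_nat k)%Z by [ring]; apply: Z.mod_mul; lia.
  by ring.
have S eps : 0 < eps -> Cmod (D (-3)%Z) <= 2 * eps.
  move=> e0; have [J0 [U0 T0]] := bounded_tail _ _ B eps e0.
  have [k Hk] : exists k : nat, forall j, j \in J0 -> (Z.abs (j + 3) < 2 ^ Z.of_nat k)%Z.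
    elim: J0 {U0 T0} => [|i J0 [k IH]]; first by exists 0%N.
    exists (k + Z.to_nat (Z.abs (i + 3)))%N => j.
    rewrite Nat2Z.inj_add Z2Nat.id; last by lia.
    rewrite Z.pow_add_r; try lia.
    have h1 := Z.pow_pos_nonneg 2 (Z.of_nat k) ltac:(lia) ltac:(lia).
    have h2 : (Z.abs (i + 3) < 2 ^ Z.abs (i + 3))%Z by apply: Z.pow_gt_lin_r; lia.
    rewrite in_cons => /orP [/eqP ->|/IH]; nia.
  have [J1 H1] := Pk k 0 eps e0.
  set f := fun j => _ in H1.
  (* The index -3 is the exponent 0; J0 and J1 serve the two estimates. *)
  set J := undup ((-3)%Z :: J0 ++ J1).
  have UJ : uniq J by exact: undup_uniq.
  have f3 : f (-3)%Z = D (-3)%Z.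
    rewrite /f; have -> : (-3 + 3 = 0)%Z by []. rewrite Z.mod_0_l; last by lia.
    by rewrite /= zetapow_z0; ring.
  have K : Cmod (csum J f - RtoC 0) < eps by apply: H1 => // i hi; rewrite mem_undup in_cons mem_cat hi !orbT.
  have D1 : csum J f = (csum [:: (-3)%Z] f + csum [seq i <- J | i \notin [:: (-3)%Z]] f)%C.
    by apply: csum_diff => // i; rewrite inE => /eqP ->; rewrite mem_undup in_cons eqxx.
  rewrite csum_cons csum_nil f3 in D1.
  set R := csum [seq i <- J | _] f in D1.
  have RB : Cmod R <= eps.
    apply: Rle_trans (csum_norm _ _) _.
    apply: (Rle_trans _ (rsum [seq i <- [seq i <- J | i \notin [:: (-3)%Z]] | i \notin J0] (fun i => Cmod (D i)))).
      rewrite (rsum_filter _ (fun i => i \notin J0)) /rsum big_seq [X in _ <= X]big_seq.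
      elim/big_ind2: _ => [||i hi]; [lra|move=> *; lra|].
      rewrite /f; move: hi; rewrite mem_filter inE => /andP [/eqP n3 _].
      case: (boolP (i \in J0)) => /= m.
        case: Z.eqb_spec => [e|_]; last by rewrite Cmod_0; lra.
        exfalso; apply: n3; have := Hk i m; have [c hc] : exists c, (i + 3 = c * 2 ^ Z.of_nat k)%Z.
          by apply/Z.mod_divide => //; have := Z.pow_pos_nonneg 2 (Z.of_nat k); lia.
        have pk := Z.pow_pos_nonneg 2 (Z.of_nat k) ltac:(lia) ltac:(lia).
        rewrite hc Z.abs_mul (Z.abs_eq (2 ^ _)); last by lia.
        move=> lt; have c0 : c = 0%Z by nia.
        by rewrite c0 in hc; lia.
      case: ifP => _; last by rewrite Cmod_0; exact: Cmod_ge_0.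
      by rewrite Cmod_mult zetapow_norm /=; have -> : - (2 * PI * 0 * (IZR i + 3)%R) = 0 by [ring]; rewrite exp_0; lra.
    apply: Rlt_le; apply: T0; first by rewrite !filter_uniq.
    by move=> i; rewrite mem_filter => /andP [].
  have e : D (-3)%Z = ((csum J f - RtoC 0) - R)%C by rewrite D1; ring.
  rewrite e; apply: Rle_trans (Cmod_triangle _ _) _; rewrite Cmod_opp; lra.
have Z0 : Cmod (D (-3)%Z) = 0.
  apply: Rle_antisym; last exact: Cmod_ge_0.
  apply: le_epsilon => eps e0; have := S (eps / 2) ltac:(lra); lra.
exact: Cmod_eq_0.
Qed.

Lemma expansion_unique tau A A' : is_zeta_expansion 6 tau A -> is_zeta_expansion 6 tau A' -> A 0 = A' 0.
Proof.
move=> /expansion_has_sum [[M B] H] /expansion_has_sum [[M' B'] H'].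
pose D (j : Z) : C := (A (IZR j + 3)%R + (-1)%R * A' (IZR j + 3)%R)%C.
have z : (IZR (-3) + 3 = 0) by lra.
have := coefficient_zero D (M + Cmod (-1)%R * M') _ _.
rewrite {3}/D z => e; have -> : A 0 = (A 0 + (-1)%R * A' 0 + A' 0)%C by ring.
rewrite e; first by ring.
  move=> J U; have b1 := B J U; have b2 := bounded_scal (-1)%R _ _ B' J U.
  apply: Rle_trans (Rplus_le_compat _ _ _ _ b1 b2).
  have -> : forall f g : Z -> R, rsum J f + rsum J g = rsum J (fun j => f j + g j) by move=> f g; rewrite /rsum big_split.
  by apply: rsum_le => j; exact: Cmod_triangle.
move=> x; have := has_sum_add _ _ _ _ (H x) (has_sum_scal (-1)%R _ _ (H' x)).
have -> : (Fk 6 tau (RtoC x) + (-1)%R * Fk 6 tau (RtoC x) = RtoC 0)%C by ring.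
by apply: has_sum_ext => j; rewrite /D; ring.
Qed.

(** * Identification of the coefficient sequence *)

(** Continuity of the power series at 0, inside its disk of convergence. *)
Lemma pseries_head (a : nat -> R) : (forall x, 0 < x < 1 -> is_pseries a x 0) -> a O = 0.
Proof.
move=> H; apply: NNPP => a0.
have cr : Rbar_lt (Rabs 0) (CV_radius a).
  (* Outside the disk of convergence the terms would not tend to 0, so the radius is at least 1/2. *)
  rewrite Rabs_R0; apply: (Rbar_lt_le_trans _ (Finite (/ 2))); first by rewrite /=; lra.
  have -> : / 2 = Rabs (/ 2) by rewrite Rabs_pos_eq; lra.
  apply: Rbar_not_lt_le => lt.
  have := CV_disk_outside a (/ 2) lt; apply.
  have := H (/ 2) ltac:(lra) => /is_pseries_R h.
  by apply: ex_series_lim_0; exists 0.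
have /continuity_pt_filterlim C := PSeries_continuity a 0 cr.
rewrite PSeries_0 in C.
have L : locally (a O) (fun v => Rabs (v - a O) < Rabs (a O)).
  by exists (mkposreal _ (Rabs_pos_lt _ a0)) => y; exact.
have [d Hd] := C _ L.
have d0 := cond_pos d; set y := Rmin (d / 2) (/ 2).
have y0 : 0 < y by rewrite /y; apply: Rmin_glb_lt; lra.
have y1 : y <= / 2 by exact: Rmin_r.
have y2 : y <= d / 2 by exact: Rmin_l.
have := Hd y; rewrite (is_pseries_unique _ _ _ (H y ltac:(lra))).
have -> : 0 - a O = - a O by ring. rewrite Rabs_Ropp => K.
suff : Rabs (a O) < Rabs (a O) by lra.
apply: K; rewrite /ball /= /AbsRing_ball /abs /minus /plus /opp /=.
by rewrite Ropp_0 Rplus_0_r Rabs_pos_eq; lra.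
Qed.

(** A zero constant term is divided out, and the induction proceeds on the degree. *)
Lemma pseries_zero n : forall a : nat -> R, (forall x, 0 < x < 1 -> is_pseries a x 0) -> a n = 0.
Proof.
elim: n => [|n IH] a H; first exact: pseries_head.
apply: (IH (PS_decr_1 a)) => x Hx.
have a0 := pseries_head a H.
have e : mult (/ x) x = one by rewrite /mult /one /=; field; lra.
have := is_pseries_decr_1 a x (/ x) 0 e (H x Hx); rewrite a0.
have -> : scal (/ x) (plus 0 (opp 0)) = 0 :> R by rewrite /scal /plus /opp /= /mult /=; ring.
by [].
Qed.

Lemma Re_series (u : nat -> C) l : is_Cseries u l -> is_series (fun n => Re (u n)) (Re l).
Proof.
move=> H P [eps HP].
have [N HN] := H (fun y => P (Re y)) (ex_intro _ eps (fun y hy => HP _ (proj1 hy))).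
exists N => n Hn; have := HN n Hn.
have -> : Re (sum_n u n) = sum_n (fun n => Re (u n)) n; last by [].
by elim: n {Hn} => [|n IH]; rewrite ?sum_O ?sum_Sn //= -IH.
Qed.

(** Two solutions of is_cpsi give the same coefficient of zeta^0 for tau = i y,
    where q runs through the interval from 0 to 1, hence the same power series. *)
Lemma cpsi_60 : cpsi 6 0 = cpsi60_series.
Proof.
have S : is_cpsi 6 0 (cpsi 6 0).
  apply: (epsilon_spec (inhabits (fun _ : nat => 0%Z)) (is_cpsi 6 0)).
  by exists cpsi60_series; exact: cpsi60_series_is_cpsi.
move: (cpsi 6 0) S => c S.
suff H : forall x, 0 < x < 1 -> is_pseries (fun n => IZR (c n - cpsi60_series n)) x 0.
  apply: functional_extensionality => n; have := pseries_zero n _ H => /eq_IZR; lia.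
(* For tau = i y this y gives q = x. *)
move=> x Hx; set y := - ln x / (2 * PI).
have PIp := PI_RGT_0.
have lx : ln x < 0 by rewrite -ln_1; apply: ln_increasing; lra.
have y0 : 0 < Im (0, y) by rewrite /= /y; apply: Rdiv_lt_0_compat; lra.
have qx : qq (0, y) = RtoC x.
  rewrite /qq /qpow /Cexp.
  have -> : (2 * PI * Ci * 1 * (0, y))%C = RtoC (ln x).
    by rewrite /Ci /Cmult /RtoC /= /y; congr pair; field; lra.
  rewrite /= cos_0 sin_0 exp_ln; last by lra.
  by rewrite /RtoC; congr pair; ring.
have [A [EA SA]] := S _ y0; have [A' [EA' SA']] := cpsi60_series_is_cpsi _ y0.
rewrite (expansion_unique _ _ _ EA EA') qx in SA; rewrite qx in SA'.
have R1 := Re_series _ _ SA; have R2 := Re_series _ _ SA'.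
apply/is_pseries_R.
have := is_series_minus _ _ _ _ R1 R2.
have -> : plus (Re (A' 0)) (opp (Re (A' 0))) = 0 by rewrite /plus /opp /=; ring.
apply: is_series_ext => n; rewrite minus_IZR -RtoC_pow -!RtoC_mult /= /plus /opp /=; ring.
Qed.

End Analysis.

Theorem theorem1p2 (n alpha : nat) (hn : (1 <= n)%nat) (halpha : (1 <= alpha)%nat)
  (h : ((2 * Z.of_nat n) mod 3 ^ Z.of_nat alpha = (-1) mod 3 ^ Z.of_nat alpha)%Z) :
  (cpsi 6 0%R n mod 3 ^ Z.of_nat (alpha / 2 + 2) = 0)%Z.
Proof. rewrite Analysis.cpsi_60; exact: Recursion.cpsi60_series_div h. Qed.
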